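(* Let $\alpha,\beta,R,r,\zeta>0$ and $\gamma\ge0$, and suppose that the error distribution is known with $f_\varepsilon\in\mathcal D^\beta(R,\gamma)$. Suppose the kernel $K$ satisfies $\operatorname{supp}\varphi_K\subseteq[-1,1]$ and has order $\ell=\langle\alpha\rangle+1$. Let $\widehat q_{\tau,b}$ be the quantile estimator based on $\widehat f_b$ (defined in the context), let $b_n^*=n^{-1/(2\alpha+2(\beta\vee1/2)+1)}$ and let $U_n\to\infty$, $U_n=\mathcal O(\log n)$. Then, uniformly over $f\in\mathcal C^\alpha(R,r,\zeta,U_n)$, as $n\to\infty$, $$\left|\int_{-\infty}^{q_\tau}\bigl(\widehat f_{b_n^*}(x)-f(x)\bigr)\,dx\right|=\mathcal O_P\bigl(\psi_n(\alpha,\beta)\bigr),\qquad |\widehat q_{\tau,b_n^*}-q_\tau|=\mathcal O_P\bigl(\psi_n(\alpha,\beta)\bigr),$$ where for $k\ge1$ $$\psi_k(\alpha,\beta)=\begin{cases}k^{-1/2},&\beta\in(0,1/2),\\(\log k/k)^{1/2},&\beta=1/2,\\k^{-(\alpha+1)/(2\alpha+2\beta+1)},&\beta>1/2.\end{cases}$$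
   Context: Model. $X_1,\dots,X_n$ are i.i.d. real random variables with Lebesgue density $f$; $\varepsilon_1,\dots,\varepsilon_n$ are i.i.d. with known Lebesgue density $f_\varepsilon$, independent of $(X_j)$. One observes $Y_j=X_j+\varepsilon_j$, $j=1,\dots,n$. Fix $\tau\in(0,1)$; $q_\tau$ denotes the $\tau$-quantile of $f$. Notation. $\mathcal F g(u)=\int_{\mathbb R}e^{iux}g(x)\,dx$, $\mathcal F^{-1}[h(u)](x)=\frac1{2\pi}\int e^{-iux}h(u)\,du$; $\varphi_\varepsilon=\mathcal F f_\varepsilon$, $\varphi_n(u)=\frac1n\sum_{j=1}^n e^{iuY_j}$, $\varphi_K=\mathcal F K$ for a kernel $K:\mathbb R\to\mathbb R$, $K\in L^1(\mathbb R)$. For $b>0$, $$\widehat f_b(x)=\mathcal F^{-1}\Bigl[\frac{\varphi_n(u)\varphi_K(bu)}{\varphi_\varepsilon(u)}\Bigr](x),\qquad \widehat q_{\tau,b}=\arg\min_{\eta\in[-U_n,U_n]}\Bigl|\int_{-\infty}^\eta\widehat f_b(x)\,dx-\tau\Bigr|$$ (any minimizer). $K$ has order $\ell$ if $\int|K(x)||x|^{\ell+1}dx<\infty$, $\int K=1$ and $\int x^kK(x)\,dx=0$ for $k=1,\dots,\ell$. $\langle\alpha\rangle$ is the largest integer strictly smaller than $\alpha$. Hölder norm on an interval $I$: $\|g\|_{C^\alpha(I)}=\sum_{k=0}^{\langle\alpha\rangle}\|g^{(k)}\|_{L^\infty(I)}+\sup_{x\ne y\in I}\frac{|g^{(\langle\alpha\rangle)}(x)-g^{(\langle\alpha\rangle)}(y)|}{|x-y|^{\alpha-\langle\alpha\rangle}}$,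 and $C^\alpha(I,R)=\{g \text{ continuous and bounded on } I:\|g\|_{C^\alpha(I)}\le R\}$. Classes. $\mathcal C^\alpha(R,r,\zeta,U)$ is the set of probability densities $f$ on $\mathbb R$ with $\|f\|_\infty\le R$ having a $\tau$-quantile $q_\tau\in[-U,U]$ such that $f\in C^\alpha([q_\tau-\zeta,q_\tau+\zeta],R)$ and $f(q_\tau)\ge r$. $\mathcal D^\beta(R,\gamma)$ is the set of probability densities $f_\varepsilon$ on $\mathbb R$ with $\frac1R(1+|u|)^{-\beta}\le|\mathcal F f_\varepsilon(u)|\le R(1+|u|)^{-\beta}$, $|(\mathcal F f_\varepsilon)'(u)|\le R(1+|u|)^{-1-\beta}$ for all $u\in\mathbb R$, and $\int|x|^\gamma f_\varepsilon(x)\,dx\le R$. $A_n=\mathcal O_P(B_n)$ uniformly over a parameter set $\Theta$ means: for every $c>0$ there is $C>0$ such that $\sup_{\theta\in\Theta}P_\theta(A_n(\theta)>CB_n(\theta))<c$ (for $n$ large enough). *)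

(* Defs.v *)
From HB Require Import structures.
From mathcomp Require Import all_boot all_order all_algebra.
From mathcomp Require Import complex.
From mathcomp Require Import all_classical all_reals all_analysis.

Set Implicit Arguments.
Unset Strict Implicit.
Unset Printing Implicit Defensive.

Import Order.TTheory GRing.Theory Num.Theory.
Import numFieldNormedType.Exports.

Local Open Scope classical_set_scope.
Local Open Scope ring_scope.

(* <alpha>, the largest integer strictly smaller than alpha, for alpha > 0 *)
Definition strict_floor {R : realType} (alpha : R) : nat :=
  (`|Num.ceil alpha|%N).-1.

Lemma strict_floorP {R : realType} (alpha : R) : 0 < alpha ->
  (strict_floor alpha)%:R < alpha <= (strict_floor alpha).+1%:R.
Proof.
move=> a0; rewrite /strict_floor.
have := ceil_itv alpha; have : 0 < Num.ceil alpha by rewrite ceil_gt0.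
case: (Num.ceil alpha) => // -[//|m] _ /=.
by rewrite -[m.+1 in X in X -> _]addn1 PoszD addrK -PoszD addn1 !pmulrn.
Qed.

Section fourier.
Context {R : realType}.
Local Notation mu := (@lebesgue_measure R).
Local Open Scope complex_scope.

Definition expi (t : R) : R[i] := cos t +i* sin t.

Definition Cintegral (g : R -> R[i]) : R[i] :=
  (\int[mu]_x complex.Re (g x)) +i* (\int[mu]_x complex.Im (g x)).

Definition fourier (g : R -> R) (u : R) : R[i] :=
  Cintegral (fun x => expi (u * x) * (g x)%:C).

Definition inv_fourier (h : R -> R[i]) (x : R) : R[i] :=
  ((2 * pi)^-1)%:C * Cintegral (fun u => expi (- (u * x)) * h u).

Definition Cderivable (g : R -> R[i]) (u : R) : Prop :=
  derivable (fun t => complex.Re (g t)) u 1 /\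
  derivable (fun t => complex.Im (g t)) u 1.

Definition Cderive (g : R -> R[i]) (u : R) : R[i] :=
  derive1 (fun t => complex.Re (g t)) u +i*
  derive1 (fun t => complex.Im (g t)) u.

End fourier.

Section densities.
Context {R : realType}.
Local Notation mu := (@lebesgue_measure R).

Definition is_density (f : R -> R) : Prop :=
  [/\ measurable_fun setT f, forall x, 0 <= f x &
      (\int[mu]_x (f x)%:E = 1)%E].

Definition is_quantile (tau : R) (f : R -> R) (q : R) : Prop :=
  \int[mu]_(x in `]-oo, q]) f x = tau.

(* Derivative relative to I: two-sided in the interior, one-sided at the
   endpoints that belong to I. *)
Definition quotient_on (I : set R) (g : R -> R) (x : R) : set_system R :=
  (fun y => (g y - g x) / (y - x)) @ within I x^'.

Definition derivable_on (I : set R) (g : R -> R) : Prop :=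
  forall x, I x -> cvg (quotient_on I g x).

Definition derive_on (I : set R) (g : R -> R) (x : R) : R :=
  lim (quotient_on I g x).

Definition holder_norm (I : set R) (alpha : R) (g : R -> R) : \bar R :=
  let m := strict_floor alpha in
  let D k := iter k (derive_on I) g in
  (\sum_(0 <= k < m.+1) 'N[mu]_+oo [(EFin \o D k) \_ I]
   + ereal_sup [set (`|D m xy.1 - D m xy.2|
                     / `|xy.1 - xy.2| `^ (alpha - m%:R))%:E
               | xy in [set xy | [/\ I xy.1, I xy.2 & xy.1 != xy.2]]])%E.

Definition holder_ball (I : set R) (alpha L : R) : set (R -> R) :=
  [set g | [/\ {within I, continuous g}, [bounded g x | x in I],
     (forall k, (k < strict_floor alpha)%N ->
        derivable_on I (iter k (derive_on I) g)) &
     (holder_norm I alpha g <= L%:E)%E]].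

(* Here L is the radius of the class, R being the field of real numbers. *)
Definition density_class (tau alpha L r zeta U : R) : set (R -> R) :=
  [set f | [/\ is_density f, ('N[mu]_+oo [EFin \o f] <= L%:E)%E &
     exists q, [/\ is_quantile tau f q, q \in `[- U, U],
       holder_ball `[q - zeta, q + zeta] alpha L f & r <= f q]]].

Definition error_class (beta L gamma : R) : set (R -> R) :=
  [set g | [/\ is_density g,
     (forall u, L^-1 * (1 + `|u|) `^ (- beta)
                  <= ComplexField.Normc.normc (fourier g u)
                  <= L * (1 + `|u|) `^ (- beta)),
     (forall u, Cderivable (fourier g) u /\
        ComplexField.Normc.normc (Cderive (fourier g) u)
          <= L * (1 + `|u|) `^ (- 1 - beta)) &
     (\int[mu]_x (`|x| `^ gamma * g x)%:E <= L%:E)%E]].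

Definition kernel_of_order (l : nat) (K : R -> R) : Prop :=
  [/\ (\int[mu]_x (`|K x| * `|x| ^+ l.+1)%:E < +oo)%E,
      \int[mu]_x K x = 1 &
      forall k : nat, (1 <= k <= l)%N -> \int[mu]_x (x ^+ k * K x) = 0].

End densities.

Section estimators.
Context {R : realType}.
Local Notation mu := (@lebesgue_measure R).
Local Open Scope complex_scope.

Definition emp_char (n : nat) (Y : 'I_n -> R) (u : R) : R[i] :=
  (n%:R^-1)%:C * \sum_(j < n) expi (u * Y j).

(* The inverse Fourier transform below is real-valued: the integrand takes
   conjugate values at u and -u, since K and the density feps are real. *)
Definition fhat (feps K : R -> R) (b : R) (n : nat) (Y : 'I_n -> R) (x : R)
    : R :=
  complex.Re (inv_fourier
    (fun u => emp_char Y u * fourier K (b * u) / fourier feps u) x).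

Definition is_quantile_estimate (feps K : R -> R) (tau U b : R) (n : nat)
    (Y : 'I_n -> R) (q : R) : Prop :=
  let crit eta := `|\int[mu]_(x in `]-oo, eta]) fhat feps K b Y x - tau| in
  q \in `[- U, U] /\ forall eta, eta \in `[- U, U] -> crit q <= crit eta.

End estimators.

Section model.
Context {R : realType} d (T : measurableType d) (P : probability T R).
Local Notation mu := (@lebesgue_measure R).

Definition has_density (X : {RV P >-> R}) (f : R -> R) : Prop :=
  forall A, measurable A ->
    distribution P X A = (\int[mu]_(x in A) (f x)%:E)%E.

(* Subfamilies are covered by taking A i = setT outside of them. *)
Definition mutually_independent (I : finType) (X : I -> {RV P >-> R}) : Prop :=
  forall A : I -> set R, (forall i, measurable (A i)) ->
    (P (\bigcap_i (X i @^-1` A i)) = \prod_i P (X i @^-1` A i))%E.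

(* Joint independence of the 2n variables X_1, ..., X_n, eps_1, ..., eps_n:
   each sample is independent, and the two samples are independent. *)
Definition deconvolution_model (n : nat) (X eps : 'I_n -> {RV P >-> R})
    (f feps : R -> R) : Prop :=
  [/\ forall j, has_density (X j) f, forall j, has_density (eps j) feps &
      mutually_independent
        (fun k : 'I_n + 'I_n =>
           match k with inl j => X j | inr j => eps j end)].

End model.

(* A n theta = O_P(B n) uniformly over theta in Theta n, where A n theta is a
   random variable under P n theta. *)
Definition unif_bigOP {R : realType} (S : Type) (d : nat -> measure_display)
    (T : forall n, measurableType (d n))
    (P : forall n, S -> probability (T n) R) (Theta : nat -> set S)
    (A : forall n, S -> T n -> R) (B : nat -> R) : Prop :=
  forall c : R, 0 < c -> exists2 C : R, 0 < C &
    \forall n \near \oo,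
      (ereal_sup [set P n theta [set w | (C * B n < A n theta w)%R]
                 | theta in Theta n] < c%:E)%E.

Definition bstar {R : realType} (alpha beta : R) (n : nat) : R :=
  n%:R `^ (- (2 * alpha + 2 * Num.max beta 2^-1 + 1)^-1).

Definition psi {R : realType} (alpha beta : R) (k : nat) : R :=
  if beta < 2^-1 then k%:R `^ (- 2^-1)
  else if beta == 2^-1 then (ln k%:R / k%:R) `^ 2^-1
  else k%:R `^ (- ((alpha + 1) / (2 * alpha + 2 * beta + 1))).

(* Main.v *)
(** Writing [Y_j = X_j + eps_j], the estimated distribution function at [eta] is
    the sample mean of [dprim (eta - Y_j)], where [dprim] is the primitive of the
    deconvolution kernel [dkernel].  Its expectation is the integral of
    [K u * F (eta - b u)], so a Taylor expansion of the distribution function [F]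
    and the vanishing moments of [K] make the bias of order [b ^ (alpha + 1)].
    For the variance, a cutoff at frequency 1 splits [dprim] into a bounded part
    and a square integrable one; by Plancherel the squared norm of the latter is
    at most a multiple of the integral of [(1 + |u|) ^ (2 beta - 2)] over
    [|u| <= 1 / b], whose three regimes give the three cases of [psi].  Chebyshev's
    inequality then yields the first claim.

    For the quantile, [f >= r / 2] near [q] makes [F] grow linearly there, so it
    suffices that the centred process [D eta - D q] stays below a small multiple
    of [|eta - q|] for [|eta - q| >= T psi].  No chaining is needed for this: with
    [Z t = D (q + t) - D q], the quotient [(Z t / t) ^ 2] exceeds its value at [t0]
    by at most the integral of [2 |Z| |Z'| / t ^ 2] over [t >= t0], and the
    expectation of this integral is small because [Z] has standard deviation
    [O (psi)] and [Z'] has bounded variance at the bandwidth [bstar]. *)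

Require Import Defs.
From HB Require Import structures.
From mathcomp Require Import all_boot all_order all_algebra.
From mathcomp Require Import complex.
From mathcomp Require Import all_classical all_reals all_analysis.
From mathcomp Require Import measurable_realfun ess_sup_inf.
From mathcomp Require Import ring lra.

Set Implicit Arguments.
Unset Strict Implicit.
Unset Printing Implicit Defensive.

Import Order.TTheory GRing.Theory Num.Theory.
Import numFieldNormedType.Exports.

Local Open Scope classical_set_scope.
Local Open Scope ring_scope.

(** * Real-valued Lebesgue integrals *)

Section real_integral.
Context d (T : measurableType d) (R : realType) (m : {measure set T -> \bar R}).
Implicit Types (f g : T -> R) (D : set T).

(** The kernel is not explicit: its symbol [phi_K (b u) / phi_eps (u)] is only known to be Lipschitz
    and to vanish for [|u| >= 1 / b]. Lipschitz continuity comes from the first moment of [K] and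
    from the derivative bound on [phi_eps]; it puts both the inverse transform [k] and [x k (x)] in
    [L^2], so that [k] is integrable and its primitive from [-oo] exists. The Lipschitz constant
    degenerates as [b] tends to 0 and therefore never enters a rate: rates come from the modulus
    bound [(1 + |u|) ^ beta] on the symbol and from a low-frequency part whose constants do not
    depend on [b]. Two scales govern the quantile. The Hölder condition holds only near [q];
    elsewhere the bias is merely [O (b)]. At distance [delta] or more, however, only the fixed gap
    [r delta / 2] of [F] has to be beaten, at the cost of a factor [psi U_n ^ 2], which tends to 0
    because [U_n = O (log n)]. In the slope argument the product [|Z| |Z'|] is split with weight
    [1 / psi]: this balances variances of orders [psi ^ 2] and [1], so that from [t0 psi] on the
    exceptional probability is of order [1 / t0], uniformly in [n]. *)

Lemma EFin_Rintegral D f : measurable D -> m.-integrable D (EFin \o f) ->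
  (\int[m]_(x in D) f x)%:E = (\int[m]_(x in D) (f x)%:E)%E.
Proof. by move=> mD fi; rewrite /Rintegral fineK//; exact: integrable_fin_num. Qed.

Lemma integrable_measurable D f : m.-integrable D (EFin \o f) ->
  measurable_fun D f.
Proof. by move/measurable_int/measurable_EFinP. Qed.

Lemma integrable_le D f g : measurable D -> measurable_fun D f ->
  (forall x, D x -> `|f x| <= g x) -> m.-integrable D (EFin \o g) ->
  m.-integrable D (EFin \o f).
Proof.
move=> mD mf fg; apply: le_integrable => //; first exact/measurable_EFinP.
by move=> x Dx /=; rewrite lee_fin (le_trans (fg _ Dx))// ler_norm.
Qed.

Lemma le_normr_Rintegral_le D f g : measurable D -> measurable_fun D f ->
  (forall x, D x -> `|f x| <= g x) -> m.-integrable D (EFin \o g) ->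
  `|\int[m]_(x in D) f x| <= \int[m]_(x in D) g x.
Proof.
move=> mD mf fg gi; have fi := integrable_le mD mf fg gi.
apply: le_trans (le_normr_Rintegral mD fi) _.
by apply: le_Rintegral => //; apply: integrable_norm.
Qed.

Lemma ge0_le_Rintegral D f g : measurable D -> measurable_fun D f ->
  (forall x, D x -> 0 <= f x) -> (forall x, D x -> f x <= g x) ->
  m.-integrable D (EFin \o g) ->
  \int[m]_(x in D) f x <= \int[m]_(x in D) g x.
Proof.
move=> mD mf f0 fg gi; apply: le_Rintegral => //.
by apply: (integrable_le mD mf _ gi) => x Dx; rewrite ger0_norm ?f0 ?fg.
Qed.

(** Bounds produced by Plancherel and Fatou live in [\bar R]; this converts one into integrability
    together with a bound on the real integral. *)
Lemma ge0_integrable_of_le D f c : measurable D -> measurable_fun D f ->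
  (forall x, D x -> 0 <= f x) -> (\int[m]_(x in D) (f x)%:E <= c%:E)%E ->
  m.-integrable D (EFin \o f) /\ \int[m]_(x in D) f x <= c.
Proof.
move=> mD mf f0 fc.
have fi : m.-integrable D (EFin \o f).
  apply/integrableP; split; first exact/measurable_EFinP.
  rewrite (eq_integral (fun x => (f x)%:E)).
    exact: le_lt_trans fc (ltry _).
  by move=> x; rewrite inE => Dx /=; rewrite ger0_norm// f0.
by split => //; rewrite -lee_fin EFin_Rintegral.
Qed.

Lemma integrable_mulr D f g M : measurable D -> measurable_fun D g ->
  (forall x, D x -> `|g x| <= M) -> m.-integrable D (EFin \o f) ->
  m.-integrable D (EFin \o (fun x => f x * g x)).
Proof.
move=> mD mg gM fi.
apply: (@integrable_le _ _ (fun x => M * `|f x|)) => //.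
- by apply: measurable_funM => //; exact: integrable_measurable.
- by move=> x Dx; rewrite normrM mulrC ler_wpM2r// gM.
- have := @integrableZl _ _ _ m D mD M _ (integrable_norm fi).
  by apply: eq_integrable => //= x _; rewrite EFinM.
Qed.

Lemma integrable_scale D f c : measurable D -> m.-integrable D (EFin \o f) ->
  m.-integrable D (EFin \o (fun x => c * f x)).
Proof.
move=> mD fi; have := @integrableZl _ _ _ m D mD c _ fi.
by apply: eq_integrable => //= x _; rewrite EFinM.
Qed.

Lemma integrable_add D f g : measurable D -> m.-integrable D (EFin \o f) ->
  m.-integrable D (EFin \o g) -> m.-integrable D (EFin \o (fun x => f x + g x)).
Proof.
move=> mD fi gi; have := @integrableD _ _ _ m D mD _ _ fi gi.
by apply: eq_integrable => //= x _; rewrite EFinD.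
Qed.

Lemma integrable_sub D f g : measurable D -> m.-integrable D (EFin \o f) ->
  m.-integrable D (EFin \o g) -> m.-integrable D (EFin \o (fun x => f x - g x)).
Proof.
move=> mD fi gi; have := @integrableB _ _ _ m D mD _ _ fi gi.
by apply: eq_integrable => //= x _; rewrite EFinB.
Qed.

Lemma Rintegral_cvg D (f_ : nat -> T -> R) f g : measurable D ->
  (forall n, measurable_fun D (f_ n)) -> measurable_fun D f ->
  (forall x, D x -> f_ n x @[n --> \oo] --> f x) ->
  m.-integrable D (EFin \o g) ->
  (forall n x, D x -> `|f_ n x| <= g x) ->
  \int[m]_(x in D) f_ n x @[n --> \oo] --> \int[m]_(x in D) f x.
Proof.
move=> mD mf_ mf fcv gi fg.
have fi : m.-integrable D (EFin \o f).
  apply: (integrable_le mD mf _ gi) => x Dx.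
  have h : `|f_ n x| @[n --> \oo] --> `|f x| by apply: cvg_norm; exact: fcv.
  rewrite -(cvg_lim _ h)//; apply: limr_le; first by apply/cvg_ex; exists `|f x|.
  by near=> n; exact: fg.
have fni n : m.-integrable D (EFin \o f_ n) := integrable_le mD (mf_ n) (fg n) gi.
suff h : (\int[m]_(x in D) (f_ n x)%:E)%E @[n --> \oo] -->
    (\int[m]_(x in D) f x)%:E by apply: fine_cvg h.
rewrite EFin_Rintegral//.
apply: (@dominated_cvg _ _ _ m D mD _ _ (EFin \o g)) => //.
- by move=> n; apply/measurable_EFinP.
- by move=> x Dx; apply/cvg_EFin; [near=> n|exact: fcv].
Unshelve. all: by end_near. Qed.

(** Fatou's lemma in the form in which regularizations are removed: nothing dominates the sequence,
    but a common bound on its integrals survives in the limit. *)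
Lemma fatou_bound D (f_ : nat -> T -> R) f c : measurable D ->
  (forall n, measurable_fun D (f_ n)) -> (forall n x, D x -> 0 <= f_ n x) ->
  (forall x, D x -> f_ n x @[n --> \oo] --> f x) ->
  (forall n, (\int[m]_(x in D) (f_ n x)%:E <= c%:E)%E) ->
  (\int[m]_(x in D) (f x)%:E <= c%:E)%E.
Proof.
move=> mD mf_ f0 fcv fc.
rewrite (eq_integral (fun x => limn_einf (fun n => (f_ n x)%:E))); last first.
  move=> x; rewrite inE => Dx; apply/esym.
  have h : (f_ n x)%:E @[n --> \oo] --> (f x)%:E.
    by apply/cvg_EFin; [near=> n|exact: fcv].
  by rewrite is_cvg_limn_einfE ?(cvg_lim _ h)//; apply/cvg_ex; exists (f x)%:E.
apply: le_trans (fatou m mD _ _) _.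
- by move=> n; exact/measurable_EFinP.
- by move=> n x Dx; rewrite lee_fin f0.
- rewrite limn_einf_lim; apply: lime_le; first exact: is_cvg_einfs.
  near=> n; rewrite /einfs; apply: le_trans (fc n).
  by apply: ereal_inf_lbound; exists n => /=.
Unshelve. all: by end_near. Qed.

End real_integral.

(** * Fubini with one integrable weight per variable *)

Section real_fubini.
Context d1 d2 (T1 : measurableType d1) (T2 : measurableType d2) (R : realType).
Context (m1 : {sigma_finite_measure set T1 -> \bar R})
        (m2 : {sigma_finite_measure set T2 -> \bar R}).

Variables (a : T1 -> R) (b : T2 -> R) (c : T1 * T2 -> R) (M : R).
Hypotheses (ia : m1.-integrable setT (EFin \o a))
  (ib : m2.-integrable setT (EFin \o b)) (mc : measurable_fun setT c)
  (cM : forall z, `|c z| <= M).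

Let F (z : T1 * T2) := (a z.1 * b z.2 * c z)%:E.

Let mF : measurable_fun setT F.
Proof.
apply/measurable_EFinP; apply: measurable_funM => //; apply: measurable_funM.
  by apply: measurableT_comp => //; apply: (integrable_measurable ia).
by apply: measurableT_comp => //; apply: (integrable_measurable ib).
Qed.

Let iF : (m1 \x m2)%E.-integrable setT F.
Proof.
apply/integrable12ltyP => //.
have M0 : 0 <= M by apply: le_trans (normr_ge0 _) (cM (point, point)).
apply: (@le_lt_trans _ _ (\int[m1]_x ((`|a x| * (M * \int[m2]_y `|b y|))%:E))%E).
  apply: ge0_le_integral => //.
  - by move=> x _; apply: integral_ge0.
  - apply: (@measurable_fun_fubini_tonelli_F _ _ _ _ _ m2 (fun z => `|F z|%E)) => //.
    exact: measurableT_comp.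
  - apply/measurable_EFinP; apply: measurable_funM => //.
    by apply: measurableT_comp => //; apply: (integrable_measurable ia).
  - move=> x _.
    rewrite mulrA EFinM EFin_Rintegral//; last exact: integrable_norm.
    rewrite -ge0_integralZl//; last 2 first.
    + by apply/measurable_EFinP/measurableT_comp => //; apply: (integrable_measurable ib).
    + by rewrite lee_fin mulr_ge0.
    apply: ge0_le_integral => //.
    + by apply: measurableT_comp => //; apply: measurableT_comp mF _; exact: measurable_pair1.
    + apply/measurable_EFinP; apply: measurable_funM => //.
      by apply: measurableT_comp => //; apply: (integrable_measurable ib).
    + move=> y _; rewrite /F /= lee_fin !normrM -mulrA -[leRHS]mulrA ler_wpM2l//.
      by rewrite mulrC ler_wpM2r.
have /integrableP[_] : m1.-integrable setT
    (EFin \o (fun x => `|a x| * (M * \int[m2]_y `|b y|))).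
  apply: (@integrable_mulr _ _ _ m1 setT (fun x => `|a x|) (fun=> M * \int[m2]_y `|b y|)
    `|M * \int[m2]_y `|b y| |) => //; exact: integrable_norm.
apply: le_lt_trans; apply: ge0_le_integral => //=.
- by move=> x _; rewrite lee_fin !mulr_ge0//; exact: Rintegral_ge0.
- apply/measurable_EFinP; apply: measurable_funM => //.
  by apply: measurableT_comp => //; apply: (integrable_measurable ia).
- apply/measurable_EFinP; apply: measurableT_comp => //; apply: measurable_funM => //.
  by apply: measurableT_comp => //; apply: (integrable_measurable ia).
- by move=> x _; rewrite lee_fin ler_norm.
Qed.

Let inner1 x : m2.-integrable setT (EFin \o (fun y => b y * c (x, y))).
Proof.
apply: (@integrable_mulr _ _ _ m2 setT _ _ M) => //.
by apply: measurableT_comp => //; exact: measurable_pair1.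
Qed.

Let inner2 y : m1.-integrable setT (EFin \o (fun x => a x * c (x, y))).
Proof.
apply: (@integrable_mulr _ _ _ m1 setT _ _ M) => //.
by apply: measurableT_comp => //; exact: measurable_pair2.
Qed.

Let innerE x : (a x * \int[m2]_y (b y * c (x, y)))%:E = (\int[m2]_y F (x, y))%E.
Proof.
rewrite /F/= EFinM EFin_Rintegral// -integralZl//; last exact: inner1.
by apply: eq_integral => y _; rewrite -EFinM mulrA.
Qed.

Let innerE2 y : (b y * \int[m1]_x (a x * c (x, y)))%:E = (\int[m1]_x F (x, y))%E.
Proof.
rewrite /F/= EFinM EFin_Rintegral// -integralZl//; last exact: inner2.
by apply: eq_integral => x _; rewrite -EFinM mulrCA mulrA.
Qed.

(** Nearly all exchanges of integrals below have this shape: an integrable weight in each variable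
    and a bounded, jointly measurable kernel, so that [M * |a x| * |b y|] dominates. *)
Lemma Rfubini : \int[m1]_x (a x * \int[m2]_y (b y * c (x, y))) =
  \int[m2]_y (b y * \int[m1]_x (a x * c (x, y))).
Proof.
rewrite /Rintegral; congr fine.
under eq_integral do rewrite innerE.
under [RHS]eq_integral do rewrite innerE2.
exact: Fubini.
Qed.

Lemma Rfubini_integrable : m1.-integrable setT
  (EFin \o (fun x => a x * \int[m2]_y (b y * c (x, y)))).
Proof.
have := integrable_fubini_F iF; apply: eq_integrable => // x _.
exact/esym/innerE.
Qed.

End real_fubini.

Section lebesgue_reflection.
Context (R : realType).
Local Notation mu := (@lebesgue_measure R).
Implicit Types f g : R -> R.

Let phi (a : R) : measurableTypeR R -> measurableTypeR R := fun x => a - x.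
Let mphi a : measurable_fun setT (phi a).
Proof. by apply: measurable_funB => //; exact: measurable_cst. Qed.

(** The preimage of []x, y]] is [[a - y, a - x[], of the same length, and a measure on the line that
    has the right values on such intervals is Lebesgue measure. *)
Lemma lebesgue_measure_reflection (a : R) (A : set R) : measurable A ->
  mu ((fun x => a - x) @^-1` A) = mu A.
Proof.
pose nu : {measure set (measurableTypeR R) -> \bar R} := 
  measure_function_pushforward__canonical__measure_function_Measure mu (mphi a).
move=> mA; apply/esym.
apply: (@lebesgue_measure_unique R nu) mA => X [[x y] /= _ <-].
rewrite /nu /= /pushforward.
have -> : phi a @^-1` `]x, y] = `[a - y, a - x[%classic.
  by apply/seteqP; split => z; rewrite /phi /= !in_itv/= => /andP[h1 h2];
    apply/andP; split; lra.
rewrite !lebesgue_measure_itv/= !lte_fin.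
by rewrite ltrD2l ltrN2; case: ifP => // _; rewrite -!EFinB; congr EFin; ring.
Qed.

Lemma ge0_integral_reflection (a : R) (f : R -> R) : measurable_fun setT f ->
  (forall x, 0 <= f x) ->
  (\int[mu]_x (f (a - x))%:E = \int[mu]_x (f x)%:E)%E.
Proof.
move=> mf f0.
have /= := @ge0_integral_pushforward _ _ _ _ R _ (mphi a) mu setT (EFin \o f)
  measurableT _ _.
rewrite preimage_setT => <-.
- apply: eq_measure_integral => A mA _; exact: lebesgue_measure_reflection.
- exact/measurable_EFinP.
- by move=> y _; rewrite /= lee_fin.
Qed.

End lebesgue_reflection.

(** * Real trigonometric transforms and Plancherel *)

Lemma le_lipschitz_derive (R : realType) (f df : R -> R) (C : R) :
  (forall x : R, is_derive x 1 f (df x)) -> (forall x, `|df x| <= C) ->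
  forall x y, `|f x - f y| <= C * `|x - y|.
Proof.
move=> fd dfC.
suff H x y : x <= y -> `|f y - f x| <= C * `|y - x|.
  move=> x y; have [xy|yx] := leP x y; last exact/H/ltW.
  by rewrite distrC (distrC x); exact: H.
move=> xy; have cf : {within `[x, y], continuous f}.
  by apply: derivable_within_continuous => z _; exact: ex_derive.
have [z _ ->] := @MVT_segment R f df x y xy (fun z _ => fd z) cf.
by rewrite normrM ler_wpM2r.
Qed.

Section half_line.
Context (R : realType).
Local Notation mu := (@lebesgue_measure R).

Lemma cvg_expR_bounded (s M : R) (B : R -> R) : 0 < s ->
  (forall x, `|B x| <= M) -> expR (- (s * x)) * B x @[x --> +oo] --> (0 : R).
Proof.
move=> s0 BM.
have h : expR (- (s * x)) * M @[x --> +oo] --> (0 : R).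
  rewrite -[X in _ --> X](mul0r M); apply: cvgMr_tmp.
  have := @cvg_comp _ _ _ (fun x : R => s * x) (fun x => expR (- x)) _ _ _ _ (@cvgr_expR R).
  by apply; exact: gt0_cvgMry.
apply/cvgr0Pnorm_lt => e e0.
have /cvgr0Pnorm_lt/(_ _ e0) := h; apply: filterS => x.
apply: le_lt_trans; rewrite !normrM; apply: ler_wpM2l => //.
exact: le_trans (BM x) (ler_norm _).
Qed.

Lemma is_derive1E (f : R -> R) (x df : R) : is_derive x 1 f df ->
  derivable f x 1 /\ derive1 f x = df.
Proof. by move=> h; split; [exact: ex_derive|rewrite derive1E derive_val]. Qed.

Lemma is_derive_continuous (f : R -> R) (x df : R) : is_derive x 1 f df ->
  {for x, continuous f}.
Proof.
by move=> h; apply: differentiable_continuous; apply/derivable1_diffP; exact: ex_derive.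
Qed.

(** The relation between [F] and [f] is asked only for positive [x]: an even integrand built on
    [|x|] agrees with the derivative of an explicit primitive on one side only. *)
Lemma integral_even (f F : R -> R) (l : R) : (forall x, 0 <= f x) ->
  continuous f -> (forall x, f (- x) = f x) ->
  (forall x : R, 0 < x -> derivable F x 1 /\ derive1 F x = f x) -> {for 0, continuous F} ->
  F x @[x --> +oo] --> l -> (\int[mu]_x (f x)%:E = (2 * (l - F 0))%:E)%E.
Proof.
move=> f0 cf fe dF cF0 Fl; rewrite ge0_symfun_integralT//; last by move=> x /=; rewrite fe.
rewrite -set_itvcy (@ge0_continuous_FTC2y _ f F 0 l)//.
- exact: continuous_subspaceT.
- by move=> x x0; have [] := dF x x0.
- exact: cvg_at_right_filter.
- move=> x; rewrite in_itv/= andbT => x0.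
  by have [] := dF x x0.
Qed.

End half_line.

(** * The exponential weight and the Poisson kernel *)

Section poisson.
Context (R : realType).
Local Notation mu := (@lebesgue_measure R).

(** Cosine transform of the weight [expabs s], hence an approximate identity of total mass [2 * pi]
    as [s] tends to 0. *)
Definition poisson (s y : R) : R := 2 * s / (s ^+ 2 + y ^+ 2).

Definition expabs (s x : R) : R := expR (- (s * `|x|)).

Lemma poisson_ge0 s y : 0 < s -> 0 <= poisson s y.
Proof. by move=> s0; rewrite /poisson; apply: divr_ge0; nra. Qed.

Lemma poisson_le s y : 0 < s -> `|poisson s y| <= 2 / s.
Proof.
move=> s0; rewrite ger0_norm ?poisson_ge0// /poisson.
have h : 0 < s ^+ 2 + y ^+ 2 by nra.
by rewrite ler_pdivrMr// mulrAC ler_pdivlMr//; nra.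
Qed.

Lemma continuous_poisson s : 0 < s -> continuous (poisson s).
Proof.
move=> s0 x; have h : 0 < s ^+ 2 + x ^+ 2 by nra.
apply: cvgM; first exact: cvg_cst.
apply: cvgV; first by rewrite gt_eqF.
by apply: cvgD; [exact: cvg_cst|exact: exprn_continuous].
Qed.

Lemma expabs_ge0 s x : 0 <= expabs s x.
Proof. exact: expR_ge0. Qed.

Lemma expabs_le1 s x : 0 < s -> expabs s x <= 1.
Proof. by move=> s0; rewrite /expabs -expR0 ler_expR; have := normr_ge0 x; nra. Qed.

Lemma continuous_expabs s : continuous (expabs s).
Proof.
move=> x; apply: continuous_comp; last exact: continuous_expR.
by apply: (@cvgN _ _ _ (nbhs x)); apply: cvgM; [exact: cvg_cst|exact: norm_continuous].
Qed.

Lemma is_derive_poisson_primitive (s y : R) : 0 < s ->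
  is_derive y 1 (fun y : R => 2 * atan (y / s)) (poisson s y).
Proof.
move=> s0; have h : 0 < s ^+ 2 + y ^+ 2 by nra.
apply: is_derive_eq; rewrite /poisson /GRing.scale/=; field.
by rewrite !gt_eqF//; nra.
Qed.

Lemma integral_poisson (s : R) : 0 < s ->
  (\int[mu]_y (poisson s y)%:E = (2 * pi)%:E)%E.
Proof.
move=> s0; rewrite (@integral_even R (poisson s) (fun y : R => 2 * atan (y / s)) pi).
- by rewrite mul0r atan0 mulr0 subr0.
- by move=> x; exact: poisson_ge0.
- exact: continuous_poisson.
- by move=> x; rewrite /poisson sqrrN.
- by move=> x _; apply: is_derive1E; exact: is_derive_poisson_primitive.
- exact: is_derive_continuous (is_derive_poisson_primitive 0 s0).
- have -> : pi = 2 * (pi / 2) :> R by field.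
  apply: cvgM; first exact: cvg_cst.
  apply: (@cvg_comp _ _ _ (fun x : R => x / s) atan _ _ _ _ (@cvgy_atan R)).
  apply: gt0_cvgMly; rewrite ?invr_gt0 //; exact: cvg_id.
Qed.

Lemma integral_inv1Dsqr : (\int[mu]_y ((1 + y ^+ 2)^-1)%:E = (pi : R)%:E)%E.
Proof.
rewrite (@integral_even R (fun y => (1 + y ^+ 2)^-1) atan (pi / 2)).
- by rewrite atan0; congr EFin; field.
- by move=> x; rewrite invr_ge0; nra.
- move=> x; apply: cvgV; first by rewrite gt_eqF//; nra.
  by apply: cvgD; [exact: cvg_cst|exact: exprn_continuous].
- by move=> x; rewrite sqrrN.
- by move=> x _; apply: is_derive1E; exact: is_derive1_atan.
- exact: continuous_atan.
- exact: cvgy_atan.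
Qed.

(** Antiderivative of [expR (- (s * x)) * (1 + cos (y * x))], which coincides with the weighted
    integrand on the right half-line. *)
Let prim (s y x : R) := expR (- (s * x)) *
  (- s^-1 + (y * sin (y * x) - s * cos (y * x)) / (s ^+ 2 + y ^+ 2)).

(** The summand [1] makes the integrand nonnegative, so that the value is found before integrability
    is known. Taking [y = 0], where the integrand is twice the weight, then yields the integrability
    of [expabs s] and its mass [2 / s]. *)
Lemma integral_expabs_1Dcos (s y : R) : 0 < s ->
  (\int[mu]_x (expabs s x * (1 + cos (y * x)))%:E =
   (2 / s + poisson s y)%:E)%E.
Proof.
move=> s0; have h : 0 < s ^+ 2 + y ^+ 2 by nra.
have dp (x : R) : is_derive x 1 (prim s y) (expR (- (s * x)) * (1 + cos (y * x))).
  apply: is_derive_eq; rewrite /GRing.scale/=; field.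
  by rewrite !gt_eqF.
rewrite (@integral_even R (fun x => expabs s x * (1 + cos (y * x))) (prim s y) 0).
- rewrite /prim !mulr0 oppr0 expR0 sin0 cos0 /poisson; congr EFin; field.
  by rewrite !gt_eqF.
- by move=> x; rewrite mulr_ge0 ?expabs_ge0//; have := cos_geN1 (y * x); lra.
- move=> x; apply: cvgM; first exact: continuous_expabs.
  apply: cvgD; first exact: cvg_cst.
  apply: continuous_comp; last exact: continuous_cos.
  by apply: cvgM; [exact: cvg_cst|exact: cvg_id].
- by move=> x; rewrite /expabs normrN mulrN cosN.
- by move=> x x0; rewrite /expabs gtr0_norm//; apply: is_derive1E; exact: dp.
- exact: is_derive_continuous (dp 0).
- apply: (@cvg_expR_bounded _ _ (s^-1 + (`|y| + s) / (s ^+ 2 + y ^+ 2))) => // x.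
  apply: le_trans (ler_normD _ _) _; rewrite normrN ger0_norm ?invr_ge0 ?(ltW s0)//.
  rewrite lerD2l normrM [X in _ * X]ger0_norm ?invr_ge0 ?(ltW h)//.
  rewrite ler_pM2r ?invr_gt0//; apply: le_trans (ler_normB _ _) _.
  rewrite !normrM; apply: lerD; first by rewrite ler_piMr// sin_max.
  by rewrite (gtr0_norm s0) ler_piMr ?(ltW s0)// cos_max.
Qed.

Lemma poisson0 s : 0 < s -> poisson s 0 = 2 / s.
Proof. by move=> s0; rewrite /poisson; field; rewrite gt_eqF. Qed.

Lemma integrable_expabs s : 0 < s -> mu.-integrable setT (EFin \o expabs s).
Proof.
move=> s0; have := @integral_expabs_1Dcos s 0 s0.
rewrite poisson0// => h.
have [|||i _] := @ge0_integrable_of_le _ _ _ mu setT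
  (fun x => expabs s x * (1 + cos (0 * x))) (2 / s + 2 / s) measurableT.
- apply: continuous_measurable_fun => x.
  by under eq_fun do rewrite mul0r; apply: cvgM; [exact: continuous_expabs|exact: cvg_cst].
- by move=> x _; rewrite mul0r cos0 mulr_ge0 ?expabs_ge0.
- by rewrite h.
have := integrable_scale 2^-1 measurableT i.
by apply: eq_integrable => //= x _; rewrite mul0r cos0; congr EFin; field.
Qed.

Lemma integrable_expabs_mul s (g : R -> R) (M : R) : 0 < s ->
  measurable_fun setT g -> (forall x, `|g x| <= M) ->
  mu.-integrable setT (EFin \o (fun x => expabs s x * g x)).
Proof.
move=> s0 mg gM.
exact: (@integrable_mulr _ _ R mu setT (expabs s) g M measurableT mg
  (fun x _ => gM x) (integrable_expabs s0)).
Qed.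

Lemma measurable_cosM (y : R) : measurable_fun setT (fun x : R => cos (y * x)).
Proof.
apply: continuous_measurable_fun => x.
apply: continuous_comp; last exact: continuous_cos.
by apply: cvgM; [exact: cvg_cst|exact: cvg_id].
Qed.

Lemma Rintegral_expabs_cos s y : 0 < s ->
  \int[mu]_x (expabs s x * cos (y * x)) = poisson s y.
Proof.
move=> s0.
have h z : \int[mu]_x (expabs s x * (1 + cos (z * x))) = 2 / s + poisson s z.
  by rewrite /Rintegral integral_expabs_1Dcos.
have ic z : mu.-integrable setT (EFin \o (fun x => expabs s x * cos (z * x))).
  by apply: (@integrable_expabs_mul _ _ 1) => // [|x]; [exact: measurable_cosM|exact: cos_max].
have e z : \int[mu]_x (expabs s x * (1 + cos (z * x))) =
   \int[mu]_x (expabs s x) + \int[mu]_x (expabs s x * cos (z * x)).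
  rewrite -RintegralD//; last exact: integrable_expabs.
  by apply: eq_Rintegral => x _; rewrite mulrDr mulr1.
have e0 : \int[mu]_x (expabs s x * cos (0 * x)) = \int[mu]_x (expabs s x).
  by apply: eq_Rintegral => x _; rewrite mul0r cos0 mulr1.
have := e 0; rewrite h e0 poisson0// => E0.
move: E0 (e y); rewrite h {h ic e e0}.
by move: (\int[mu]_x expabs s x) (\int[mu]_x (expabs s x * cos (y * x))) => A B; lra.
Qed.

End poisson.

(* Either of the two real trigonometric kernels; [cos] and [sin] are treated
   uniformly through their bounds and the bound on their Poisson means. *)
Record trig_kernel (R : realType) (e : R -> R) : Prop := TrigKernel {
  trig_le1 : forall x, `|e x| <= 1 ;
  trig_lip : forall x y, `|e x - e y| <= `|x - y| ;
  trig_poisson : forall s u v, 0 < s ->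
    `|\int[@lebesgue_measure R]_x (expabs s x * (e (u * x) * e (v * x)))| <=
    2^-1 * (poisson s (u - v) + poisson s (u + v)) }.

Section trig_kernels.
Context (R : realType).
Local Notation mu := (@lebesgue_measure R).

Let icos (s y : R) : 0 < s ->
  mu.-integrable setT (EFin \o (fun x => expabs s x * cos (y * x))).
Proof.
by move=> s0; apply: (@integrable_expabs_mul _ _ _ 1) => // [|x];
  [exact: measurable_cosM|exact: cos_max].
Qed.

Lemma trig_kernel_cos : trig_kernel (@cos R).
Proof.
split => [x|x y|s u v s0]; first exact: cos_max.
- rewrite -[leRHS]mul1r; apply: (@le_lipschitz_derive R cos (fun x => - sin x)).
  by move=> z; rewrite normrN sin_max.
- rewrite (_ : Rintegral _ _ _ = 2^-1 * (poisson s (u - v) + poisson s (u + v))).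
    by rewrite ger0_norm// mulr_ge0 ?invr_ge0// addr_ge0// poisson_ge0.
  rewrite -!Rintegral_expabs_cos// -RintegralD; [|by []|exact: icos..].
  rewrite -RintegralZl//; last by apply: integrable_add => //; exact: icos.
  apply: eq_Rintegral => x _; rewrite mulrBl mulrDl cosB cosD; by field.
Qed.

(** The product formula gives a difference of two Poisson kernels here and a sum for [cos]; bounding
    both by the sum lets one proof of Plancherel serve the two transforms. *)
Lemma trig_kernel_sin : trig_kernel (@sin R).
Proof.
split => [x|x y|s u v s0]; first exact: sin_max.
- rewrite -[leRHS]mul1r; apply: (@le_lipschitz_derive R sin (@cos R)).
  by move=> z; rewrite cos_max.
- rewrite (_ : Rintegral _ _ _ = 2^-1 * (poisson s (u - v) - poisson s (u + v))).
    rewrite normrM ger0_norm ?invr_ge0// ler_pM2l ?invr_gt0//.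
    apply: le_trans (ler_normB _ _) _.
    by rewrite !ger0_norm// poisson_ge0.
  rewrite -!Rintegral_expabs_cos// -RintegralB; [|by []|exact: icos..].
  rewrite -RintegralZl//; last by apply: integrable_sub => //; exact: icos.
  apply: eq_Rintegral => x _; rewrite mulrBl mulrDl cosB cosD; by field.
Qed.

Lemma trig_continuous (e : R -> R) : trig_kernel e -> continuous e.
Proof.
move=> te x; apply/cvgrPdist_le => eps eps0.
near=> y; apply: le_trans (trig_lip te _ _) _; near: y.
by apply: cvgr_dist_le.
Unshelve. all: by end_near. Qed.

End trig_kernels.

(** * Plancherel's inequality for the two real transforms *)

Section trig_transform.
Context (R : realType).
Local Notation mu := (@lebesgue_measure R).
Local Notation int1 g := (mu.-integrable setT (EFin \o g)).

(** With [cos] and [sin] for [e], these are the real and imaginary parts of the Fourier transform of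
    a real function; the estimates can then be made on real integrals. *)
Definition trigtr (e g : R -> R) (x : R) : R := \int[mu]_u (g u * e (u * x)).

Variables (e : R -> R) (te : trig_kernel e).

Let me : measurable_fun setT e.
Proof. by apply: continuous_measurable_fun; exact: trig_continuous te. Qed.

Lemma measurable_trigM (x : R) : measurable_fun setT (fun u : R => e (u * x)).
Proof. by apply: measurableT_comp => //; exact: measurable_funM. Qed.

Lemma measurable_trigM2 : measurable_fun setT (fun z : R * R => e (z.1 * z.2)).
Proof. by apply: measurableT_comp => //; exact: measurable_funM. Qed.

Lemma measurable_trigM2C : measurable_fun setT (fun z : R * R => e (z.2 * z.1)).
Proof. by apply: measurableT_comp => //; exact: measurable_funM. Qed.

Lemma integrable_trig g x : int1 g -> int1 (fun u => g u * e (u * x)).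
Proof.
move=> ig; apply: (@integrable_mulr _ _ R mu setT g (fun u => e (u * x)) 1) => //.
  exact: measurable_trigM.
by move=> u _; exact: trig_le1.
Qed.

Lemma normr_trigtr_le g x : int1 g -> `|trigtr e g x| <= \int[mu]_u `|g u|.
Proof.
move=> ig; apply: le_normr_Rintegral_le => //.
- by apply: (@integrable_measurable _ _ _ mu); exact: integrable_trig.
- by move=> u _; rewrite normrM ler_piMr// trig_le1.
- exact: integrable_norm.
Qed.

Lemma trigtr_lipschitz g x y : int1 g -> int1 (fun u => `|u| * `|g u|) ->
  `|trigtr e g x - trigtr e g y| <= (\int[mu]_u (`|u| * `|g u|)) * `|x - y|.
Proof.
move=> ig iug; rewrite /trigtr -RintegralB//; [|exact: integrable_trig..].
rewrite -RintegralZr//.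
apply: le_normr_Rintegral_le => //.
- by apply: (@integrable_measurable _ _ _ mu); apply: integrable_sub => //;
    exact: integrable_trig.
- move=> u _; rewrite -mulrBr normrM mulrAC mulrC ler_wpM2r//.
  by apply: le_trans (trig_lip te _ _) _; rewrite -mulrBr normrM.
- have := integrable_scale `|x - y| measurableT iug.
  by apply: eq_integrable => //= u _; rewrite mulrC.
Qed.

Lemma continuous_trigtr g : int1 g -> int1 (fun u => `|u| * `|g u|) ->
  continuous (trigtr e g).
Proof.
move=> ig iug x; apply/cvgrPdist_le => eps eps0.
have c0 : 0 <= \int[mu]_u (`|u| * `|g u|) by apply: Rintegral_ge0 => u _; rewrite mulr_ge0.
have d0 : 0 < eps / (1 + \int[mu]_u (`|u| * `|g u|)) by rewrite divr_gt0// ltr_wpDr.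
near=> y; apply: le_trans (trigtr_lipschitz _ _ ig iug) _.
have : `|x - y| <= eps / (1 + \int[mu]_u (`|u| * `|g u|)).
  by near: y; apply: cvgr_dist_le.
rewrite ler_pdivlMr ?ltr_wpDr//; apply: le_trans.
by rewrite mulrC ler_wpM2l// lerDr.
Unshelve. all: by end_near. Qed.

(** Majorant of the oscillatory integral given by [trig_poisson]. It is symmetric and has mass
    [2 * pi] in either variable, as Schur's test requires. *)
Let q (s u v : R) := 2^-1 * (poisson s (u - v) + poisson s (u + v)).

Let q_ge0 s u v : 0 < s -> 0 <= q s u v.
Proof. by move=> s0; rewrite mulr_ge0 ?invr_ge0// addr_ge0// poisson_ge0. Qed.

Let mpoisson (s : R) : 0 < s -> measurable_fun setT (poisson s).
Proof. by move=> s0; apply: continuous_measurable_fun; exact: continuous_poisson. Qed.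

Let mq s : 0 < s -> measurable_fun setT (fun z : R * R => q s z.1 z.2).
Proof.
move=> s0; apply: measurable_funM => //; apply: measurable_funD.
- by apply: (measurableT_comp (mpoisson s0)); exact: measurable_funB.
- by apply: (measurableT_comp (mpoisson s0)); exact: measurable_funD.
Qed.

Let mq1 s u : 0 < s -> measurable_fun setT (q s u).
Proof.
move=> s0; apply: measurable_funM => //; apply: measurable_funD.
- by apply: (measurableT_comp (mpoisson s0)); exact: measurable_funB.
- by apply: (measurableT_comp (mpoisson s0)); exact: measurable_funD.
Qed.

Let q_le s u v : 0 < s -> `|q s u v| <= 2 / s.
Proof.
move=> s0; rewrite ger0_norm ?q_ge0//.
have := poisson_le (u - v) s0; have := poisson_le (u + v) s0.
by rewrite /q !ger0_norm ?poisson_ge0//; move: (poisson s _) (poisson s _) => p1 p2; lra.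
Qed.

Let integral_q s u : 0 < s -> (\int[mu]_v (q s u v)%:E = (2 * pi)%:E)%E.
Proof.
move=> s0; have mp := mpoisson s0.
have e1 : (\int[mu]_v (poisson s (u - v))%:E = (2 * pi)%:E)%E.
  by rewrite (ge0_integral_reflection u mp) ?integral_poisson// => x; exact: poisson_ge0.
have e2 : (\int[mu]_v (poisson s (u + v))%:E = (2 * pi)%:E)%E.
  transitivity (\int[mu]_v (poisson s (- u - v))%:E)%E.
    by apply: eq_integral => v _; rewrite /poisson -opprD sqrrN.
  by rewrite (ge0_integral_reflection (- u) mp) ?integral_poisson// => x; exact: poisson_ge0.
under eq_integral do rewrite /q EFinM EFinD.
have m1 : measurable_fun setT (fun v : R => poisson s (u - v)).
  by apply: measurableT_comp => //; exact: measurable_funB.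
have m2 : measurable_fun setT (fun v : R => poisson s (u + v)).
  by apply: measurableT_comp => //; exact: measurable_funD.
rewrite ge0_integralZl//; last 2 first.
- by apply/emeasurable_funD; exact/measurable_EFinP.
- by move=> v _; rewrite -EFinD lee_fin addr_ge0// poisson_ge0.
rewrite ge0_integralD//; last 4 first.
- by move=> v _; rewrite lee_fin poisson_ge0.
- exact/measurable_EFinP.
- by move=> v _; rewrite lee_fin poisson_ge0.
- exact/measurable_EFinP.
rewrite [X in (_ * (X + _))%E]e1 [X in (_ * (_ + X))%E]e2 -EFinD -EFinM; congr EFin; by field.
Qed.

(* The weight turns the square into a double integral of [g u * g v] against
   Poisson kernels, which Schur's test bounds uniformly in [s]. *)
Lemma weighted_plancherel s g : 0 < s -> int1 g -> int1 (fun u => g u ^+ 2) ->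
  int1 (fun u => `|u| * `|g u|) ->
  \int[mu]_x (expabs s x * trigtr e g x ^+ 2) <= 2 * pi * \int[mu]_u (g u ^+ 2).
Proof.
move=> s0 ig ig2 iug; set T := trigtr e g.
have mT : measurable_fun setT T by apply: continuous_measurable_fun; exact: continuous_trigtr.
set N := \int[mu]_u `|g u|; have TN x : `|T x| <= N by exact: normr_trigtr_le.
pose Q u v := \int[mu]_x (expabs s x * (e (u * x) * e (v * x))).
have iw := integrable_expabs s0.
(* One factor [T x] is expanded into an integral over [u], and [E2] then expands the other one over
   [v]; the integrable weight makes both exchanges legitimate. *)
have E1 : \int[mu]_x (expabs s x * T x ^+ 2) =
    \int[mu]_u (g u * \int[mu]_x (expabs s x * (e (u * x) * T x))).
  rewrite -(@Rfubini _ _ _ _ R mu mu (expabs s) g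
     (fun z => e (z.2 * z.1) * T z.1) N)//.
  - apply: eq_Rintegral => x _; congr (_ * _); rewrite expr2 {1}/T /trigtr.
    rewrite -RintegralZr//; last exact: integrable_trig.
    by apply: eq_Rintegral => u _; rewrite mulrA.
  - apply: measurable_funM; first exact: measurable_trigM2C.
    exact: measurableT_comp.
  - by move=> z; rewrite normrM -[leRHS]mul1r; apply: ler_pM => //; exact: trig_le1.
have E2 u : \int[mu]_x (expabs s x * (e (u * x) * T x)) = \int[mu]_v (g v * Q u v).
  rewrite /Q -(@Rfubini _ _ _ _ R mu mu (expabs s) g
     (fun z => e (u * z.1) * e (z.2 * z.1)) 1 iw ig).
  - apply: eq_Rintegral => x _; congr (_ * _); rewrite {1}/T /trigtr.
    rewrite -RintegralZl//; last exact: integrable_trig.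
    by apply: eq_Rintegral => v _; rewrite mulrCA.
  - apply: measurable_funM; last exact: measurable_trigM2C.
    by apply: measurableT_comp => //; apply: measurable_funM.
  - by move=> z; rewrite normrM -[leRHS]mul1r; apply: ler_pM => //; exact: trig_le1.
rewrite E1; under eq_Rintegral do rewrite E2.
have Qq u v : `|Q u v| <= q s u v by exact: trig_poisson.
have ign : int1 (fun u => `|g u|) by exact: integrable_norm.
have iS u : int1 (fun v => `|g v| * q s u v).
  by apply: (@integrable_mulr _ _ R mu setT _ (q s u) (2 / s)) => // [|v _];
    [exact: mq1|exact: q_le].
have iSS : int1 (fun u => `|g u| * \int[mu]_v (`|g v| * q s u v)).
  exact: (@Rfubini_integrable _ _ _ _ R mu mu (fun u => `|g u|) (fun v => `|g v|)
     (fun z => q s z.1 z.2) (2 / s) ign ign (mq s0) (fun z => q_le _ _ s0)).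
have mg : measurable_fun setT g by exact: integrable_measurable ig.
have mg2 : measurable_fun setT (fun u => g u ^+ 2) by exact: integrable_measurable ig2.
have igQ u : int1 (fun v => g v * Q u v).
  apply: (@Rfubini_integrable _ _ _ _ R mu mu g (expabs s)
    (fun z => e (u * z.2) * e (z.1 * z.2)) 1 ig iw) => [|z].
    apply: measurable_funM; last exact: measurable_trigM2.
    by apply: measurableT_comp => //; apply: measurable_funM.
  by rewrite normrM -[leRHS]mul1r; apply: ler_pM => //; exact: trig_le1.
have igQQ : int1 (fun u => g u * \int[mu]_v (g v * Q u v)).
  have : int1 (fun u => g u * \int[mu]_x (expabs s x * (e (u * x) * T x))).
    apply: (@Rfubini_integrable _ _ _ _ R mu mu g (expabs s)
      (fun z => e (z.1 * z.2) * T z.2) N ig iw) => [|z].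
      by apply: measurable_funM; [exact: measurable_trigM2|exact: measurableT_comp].
    by rewrite normrM -[leRHS]mul1r; apply: ler_pM => //; exact: trig_le1.
  by apply: eq_integrable => //= u _; rewrite E2.
apply: le_trans (ler_norm _) _.
apply: (@le_trans _ _ (\int[mu]_u (`|g u| * \int[mu]_v (`|g v| * q s u v)))).
  apply: le_normr_Rintegral_le => //; first exact: integrable_measurable igQQ.
  move=> u _; rewrite normrM ler_wpM2l//.
  apply: le_normr_Rintegral_le => //; first exact: integrable_measurable (igQ u).
  by move=> v _; rewrite normrM ler_wpM2l.
have mq' := mq s0.
have c0 : 0 <= 2 * pi :> R by rewrite mulr_ge0// pi_ge0.
have mu1 u : measurable_fun setT (fun v => (g u ^+ 2 * q s u v)%:E).
  by apply/measurable_EFinP; apply: measurable_funM => //; exact: mq1.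
have mu2 u : measurable_fun setT (fun v => (g v ^+ 2 * q s u v)%:E).
  by apply/measurable_EFinP; apply: measurable_funM => //; exact: mq1.
have mgq1 : measurable_fun setT (fun z : R * R => (g z.1 ^+ 2 * q s z.1 z.2)%:E).
  by apply/measurable_EFinP; exact: measurable_funM (measurableT_comp mg2 measurable_fst) mq'.
have mgq2 : measurable_fun setT (fun z : R * R => (g z.2 ^+ 2 * q s z.1 z.2)%:E).
  by apply/measurable_EFinP; exact: measurable_funM (measurableT_comp mg2 measurable_snd) mq'.
have A1 : (\int[mu]_u \int[mu]_v (g u ^+ 2 * q s u v)%:E =
    (2 * pi * \int[mu]_u (g u ^+ 2))%:E)%E.
  rewrite EFinM EFin_Rintegral// -ge0_integralZl//; last 2 first.
  - by apply/measurable_EFinP.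
  - by move=> u _; rewrite lee_fin sqr_ge0.
  apply: eq_integral => u _; under eq_integral do rewrite EFinM.
  transitivity ((g u ^+ 2)%:E * (2 * pi)%:E)%E; last by rewrite muleC.
  rewrite ge0_integralZl//; first by rewrite integral_q.
  - by apply/measurable_EFinP; exact: mq1.
  - by move=> v _; rewrite lee_fin q_ge0.
  - by rewrite lee_fin sqr_ge0.
have A2 : (\int[mu]_u \int[mu]_v (g v ^+ 2 * q s u v)%:E =
    (2 * pi * \int[mu]_u (g u ^+ 2))%:E)%E.
  rewrite -A1 (@sfinite_Fubini _ _ _ _ R mu mu (fun z => (g z.2 ^+ 2 * q s z.1 z.2)%:E)).
  - apply: eq_integral => u _; apply: eq_integral => v _ /=.
    by rewrite /q /poisson -(sqrrN (u - v)) opprB (addrC u v).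
  - by move=> z; rewrite lee_fin mulr_ge0 ?sqr_ge0 ?q_ge0.
  - exact: mgq2.
(* Schur's test: [2 * |g u| * |g v| <= g u ^+ 2 + g v ^+ 2], and [A1] and [A2] integrate each square
   against [q]. *)
suff : ((2 * \int[mu]_u (`|g u| * \int[mu]_v (`|g v| * q s u v)))%:E <=
    (2 * (2 * pi * \int[mu]_u g u ^+ 2))%:E)%E by rewrite lee_fin ler_pM2l.
rewrite -[X in (X%:E <= _)%E]RintegralZl// EFin_Rintegral//; last first.
  exact: integrable_scale.
apply: (@le_trans _ _ (\int[mu]_u (\int[mu]_v (g u ^+ 2 * q s u v)%:E +
   \int[mu]_v (g v ^+ 2 * q s u v)%:E))%E); last first.
  rewrite ge0_integralD//; last 4 first.
  - by move=> u _; apply: integral_ge0 => v _; rewrite lee_fin mulr_ge0 ?sqr_ge0 ?q_ge0.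
  - apply: (@measurable_fun_fubini_tonelli_F _ _ _ _ _ mu
      (fun z => (g z.1 ^+ 2 * q s z.1 z.2)%:E)).
      exact: mgq1.
    by move=> z; rewrite lee_fin mulr_ge0 ?sqr_ge0 ?q_ge0.
  - by move=> u _; apply: integral_ge0 => v _; rewrite lee_fin mulr_ge0 ?sqr_ge0 ?q_ge0.
  - apply: (@measurable_fun_fubini_tonelli_F _ _ _ _ _ mu
      (fun z => (g z.2 ^+ 2 * q s z.1 z.2)%:E)).
      exact: mgq2.
    by move=> z; rewrite lee_fin mulr_ge0 ?sqr_ge0 ?q_ge0.
  rewrite [X in (X + _)%E]A1 [X in (_ + X)%E]A2 -EFinD lee_fin.
  by move: (\int[mu]_u (g u ^+ 2)) => I; lra.
apply: ge0_le_integral => //.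
- by move=> u _; rewrite lee_fin !mulr_ge0//; apply: Rintegral_ge0 => v _; rewrite mulr_ge0// q_ge0.
- by apply/measurable_EFinP; apply: measurable_funM => //; exact: integrable_measurable iSS.
- apply: emeasurable_funD.
    apply: (@measurable_fun_fubini_tonelli_F _ _ _ _ _ mu
      (fun z => (g z.1 ^+ 2 * q s z.1 z.2)%:E)).
      exact: mgq1.
    by move=> z; rewrite lee_fin mulr_ge0 ?sqr_ge0 ?q_ge0.
  apply: (@measurable_fun_fubini_tonelli_F _ _ _ _ _ mu
      (fun z => (g z.2 ^+ 2 * q s z.1 z.2)%:E)).
    exact: mgq2.
  by move=> z; rewrite lee_fin mulr_ge0 ?sqr_ge0 ?q_ge0.
move=> u _; rewrite mulrA EFinM EFin_Rintegral// -ge0_integralZl//; last 2 first.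
- by apply/measurable_EFinP; exact: integrable_measurable (iS u).
- by move=> v _; rewrite lee_fin mulr_ge0// q_ge0.
rewrite -ge0_integralD//; last 3 first.
- by move=> v _; rewrite lee_fin mulr_ge0 ?sqr_ge0 ?q_ge0.
- exact: mu1.
- by move=> v _; rewrite lee_fin mulr_ge0 ?sqr_ge0 ?q_ge0.
apply: ge0_le_integral => //.
- by move=> v _; rewrite -EFinM lee_fin; apply: mulr_ge0; apply: mulr_ge0 => //; exact: q_ge0.
- by apply: measurable_funeM; apply/measurable_EFinP; exact: integrable_measurable (iS u).
- by apply: emeasurable_funD; [exact: mu1|exact: mu2].
move=> v _; rewrite -!EFinM -EFinD lee_fin.
have := q_ge0 u v s0; rewrite -!(real_normK (num_real (g _))).
have := sqr_ge0 (`|g u| - `|g v|).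
by move: `|g u| `|g v| (q s u v) => a b c h1 h2; nra.
Qed.

(** An upper bound is all that is wanted, so the weight is removed by Fatou along [s = 1 / n.+1]. *)
Lemma plancherel_le g : int1 g -> int1 (fun u => g u ^+ 2) ->
  int1 (fun u => `|u| * `|g u|) ->
  (\int[mu]_x (trigtr e g x ^+ 2)%:E <= (2 * pi * \int[mu]_u (g u ^+ 2))%:E)%E.
Proof.
move=> ig ig2 iug; have cT := continuous_trigtr ig iug.
have mT2 : measurable_fun setT (fun x => trigtr e g x ^+ 2).
  by apply: measurable_funX; exact: continuous_measurable_fun.
have s0 n : 0 < n.+1%:R^-1 :> R by rewrite invr_gt0.
apply: (@fatou_bound _ _ R mu setT (fun n x => expabs n.+1%:R^-1 x * trigtr e g x ^+ 2)) => //.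
- move=> n; apply: measurable_funM => //.
  by apply: continuous_measurable_fun; exact: continuous_expabs.
- by move=> n x _; rewrite mulr_ge0 ?expabs_ge0 ?sqr_ge0.
- move=> x _; rewrite -[X in _ --> X]mul1r; apply: cvgM; last exact: cvg_cst.
  rewrite [X in _ --> X](_ : 1 = expR (- (0 * `|x|))); last by rewrite mul0r oppr0 expR0.
  apply: continuous_cvg; first exact: continuous_expR.
  by apply: cvgN; apply: cvgM; [exact: cvg_harmonic|exact: cvg_cst].
- move=> n; rewrite -EFin_Rintegral// ?lee_fin; first exact: weighted_plancherel.
  apply: (@integrable_expabs_mul _ _ _ ((\int[mu]_u `|g u|) ^+ 2)) => // x.
  by rewrite normrX lerXn2r ?nnegrE ?normr_trigtr_le//; apply: Rintegral_ge0.
Qed.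

End trig_transform.

(** * Translations and functions of bounded support *)

Section reflection.
Context (R : realType).
Local Notation mu := (@lebesgue_measure R).
Local Notation int1 g := (mu.-integrable setT (EFin \o g)).

Let phi (a : R) : measurableTypeR R -> measurableTypeR R := fun x => a - x.
Let mphi a : measurable_fun setT (phi a).
Proof. by apply: measurable_funB => //; exact: measurable_cst. Qed.

Lemma integrable_reflection (a : R) (f : R -> R) : int1 f ->
  int1 (fun x => f (a - x)).
Proof.
move=> fi; have mf : measurable_fun setT f by exact: integrable_measurable fi.
have mfa : measurable_fun setT (fun x : R => f (a - x)) by exact: (measurableT_comp mf (mphi a)).
apply/integrableP; split; first exact/measurable_EFinP.
case/integrableP: fi => _; apply: le_lt_trans.
rewrite -[X in (_ <= X)%E](@ge0_integral_reflection R a (fun x => `|f x|)) => //.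
exact: measurableT_comp.
Qed.

Lemma Rintegral_reflection (a : R) (f : R -> R) : int1 f ->
  \int[mu]_x f (a - x) = \int[mu]_x f x.
Proof.
move=> fi; rewrite /Rintegral; congr fine.
have mf : measurable_fun setT f by exact: integrable_measurable fi.
have := @integral_pushforward _ _ _ _ R _ (mphi a) mu setT (EFin \o f).
rewrite preimage_setT => h.
rewrite -[LHS]h//; first last.
- exact: integrable_reflection.
- exact/measurable_EFinP.
by apply: eq_measure_integral => A mA _; exact: lebesgue_measure_reflection.
Qed.

(** A translation is the composite of two reflections. *)
Lemma integrable_translation (a : R) (f : R -> R) : int1 f ->
  int1 (fun x => f (x + a)).
Proof.
move=> fi; have := integrable_reflection 0 (integrable_reflection a fi).
by apply: eq_integrable => //= x _; rewrite sub0r opprK addrC.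
Qed.

Lemma Rintegral_translation (a : R) (f : R -> R) : int1 f ->
  \int[mu]_x f (x + a) = \int[mu]_x f x.
Proof.
move=> fi; rewrite -(Rintegral_reflection a fi).
rewrite -(Rintegral_reflection 0 (integrable_reflection a fi)).
by apply: eq_Rintegral => x _; rewrite sub0r opprK addrC.
Qed.

Lemma integrable_itv_cst (a b c : R) :
  mu.-integrable setT (EFin \o (fun x => c * \1_(`[a, b]) x)).
Proof. by apply: integrable_scale => //; exact: integrable_indic_itv. Qed.

Lemma Rintegral_itv_cst (a b c : R) : a <= b ->
  \int[mu]_x (c * \1_(`[a, b]) x) = c * (b - a).
Proof.
move=> ab; rewrite RintegralZl//; last exact: integrable_indic_itv.
congr (_ * _); rewrite /Rintegral integral_indic// setIT.
have h := @lebesgue_measure_itv R `[a, b]; rewrite /= lte_fin in h.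
apply: etrans (congr1 fine h) _.
by move: ab; rewrite le_eqVlt => /orP[/eqP ->|->//]; rewrite ltxx subrr.
Qed.

Lemma support_integrable (A B : R) (g : R -> R) : 0 <= A ->
  measurable_fun setT g -> (forall u, A <= `|u| -> g u = 0) ->
  (forall u, `|g u| <= B) ->
  int1 g /\ \int[mu]_u g u <= 2 * A * B.
Proof.
move=> A0 mg g0 gB.
have B0 : 0 <= B by apply: le_trans (gB 0).
have le u : `|g u| <= B * \1_(`[- A, A]) u.
  rewrite indicE; case: (boolP (u \in _)) => [_|]; first by rewrite mulr1.
  rewrite notin_setE/= in_itv/= -ler_norml => /negP; rewrite -ltNge => Au.
  by rewrite g0 ?normr0 ?mulr0// ltW.
split; first exact: (@integrable_le _ _ R mu setT g _ measurableT mg (fun u _ => le u) (integrable_itv_cst _ _ _)).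
apply: le_trans (ler_norm _) _.
apply: le_trans (@le_normr_Rintegral_le _ _ R mu setT g _ measurableT mg (fun u _ => le u) (integrable_itv_cst _ _ _)) _.
rewrite Rintegral_itv_cst; first by rewrite le_eqVlt; apply/orP; left; apply/eqP; ring.
by rewrite -subr_ge0 opprK addr_ge0.
Qed.

End reflection.

Section lip_support.
Context (R : realType).
Local Notation mu := (@lebesgue_measure R).
Local Notation int1 g := (mu.-integrable setT (EFin \o g)).

(** The class to which the symbols belong. Vanishing already at [|u| = A] permits the comparison
    with [g A = 0] that bounds [g] by [2 * A * C]; bounded support then gives every integrability
    condition of the transforms. *)
Definition lip_support (A C : R) (g : R -> R) : Prop :=
  (forall u v, `|g u - g v| <= C * `|u - v|) /\
  (forall u, A <= `|u| -> g u = 0).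

Lemma lipschitz_continuous (C : R) (g : R -> R) :
  (forall u v, `|g u - g v| <= C * `|u - v|) -> continuous g.
Proof.
move=> gC x; apply/cvgrPdist_le => eps eps0.
have c0 : 0 <= `|C| by [].
near=> y; apply: le_trans (gC _ _) _.
have : `|x - y| <= eps / (1 + `|C|).
  by near: y; apply: cvgr_dist_le => //; rewrite divr_gt0// ltr_wpDr.
rewrite ler_pdivlMr ?ltr_wpDr//; apply: le_trans.
rewrite mulrC; apply: ler_wpM2l => //.
by rewrite (le_trans (ler_norm _))// lerDr.
Unshelve. all: by end_near. Qed.

Variables (A C : R) (g : R -> R).
Hypotheses (A0 : 0 < A) (C0 : 0 <= C) (gs : lip_support A C g).

Lemma lip_support_measurable : measurable_fun setT g.
Proof.
by apply: continuous_measurable_fun; apply: lipschitz_continuous; exact: gs.1.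
Qed.
Let mg := lip_support_measurable.

Lemma lip_support_le u : `|g u| <= 2 * A * C.
Proof.
have [Au|uA] := leP A `|u|.
  by rewrite gs.2// normr0 !mulr_ge0// ltW.
have gA : g A = 0 by apply: gs.2; rewrite gtr0_norm.
rewrite -[g u]subr0 -gA; apply: le_trans (gs.1 _ _) _.
rewrite mulrC ler_wpM2r// (le_trans (ler_normB _ _))//.
by rewrite (gtr0_norm A0); lra.
Qed.

Let Amax u : A <= `|u| -> g u = 0 := @proj2 _ _ gs u.

Lemma lip_support_integrable : int1 g.
Proof. by have [] := support_integrable (ltW A0) mg gs.2 lip_support_le. Qed.

Lemma lip_support_integrable_sqr : int1 (fun u => g u ^+ 2).
Proof.
have [] := @support_integrable R A ((2 * A * C) ^+ 2) (fun u => g u ^+ 2) (ltW A0).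
- exact: measurable_funX.
- by move=> u Au; rewrite Amax// expr0n.
- by move=> u; rewrite normrX lerXn2r ?nnegrE ?lip_support_le// !mulr_ge0// ltW.
by [].
Qed.

Lemma lip_support_integrable_moment : int1 (fun u => `|u| * `|g u|).
Proof.
have [] := @support_integrable R A (A * (2 * A * C)) (fun u => `|u| * `|g u|) (ltW A0).
- by apply: measurable_funM; [exact: normr_measurable|exact: (measurableT_comp (@normr_measurable R setT) mg)].
- by move=> u Au; rewrite Amax// normr0 mulr0.
- move=> u; rewrite normrM !normr_id; have [Au|uA] := leP A `|u|.
    by rewrite Amax// normr0 mulr0 !mulr_ge0// ltW.
  by apply: ler_pM => //; [exact: ltW|exact: lip_support_le].
by [].
Qed.

(** The uniform bound [2 * d * C] vanishes with the step, which later pays for a division by [d],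
    while the support grows only by [d]. *)
Lemma lip_support_shift d : 0 <= d ->
  int1 (fun u => g (u + d) - g (u - d)) /\
  lip_support (A + d) (2 * C) (fun u => g (u + d) - g (u - d)) /\
  forall u, `|g (u + d) - g (u - d)| <= 2 * d * C.
Proof.
move=> d0; split; last split; last first.
- move=> u; apply: le_trans (gs.1 _ _) _.
  rewrite (_ : u + d - (u - d) = 2 * d); last by ring.
  by rewrite ger0_norm ?mulr_ge0// mulrC.
- split=> [u v|u Adu].
    have -> : g (u + d) - g (u - d) - (g (v + d) - g (v - d)) =
      (g (u + d) - g (v + d)) - (g (u - d) - g (v - d)) by ring.
    apply: le_trans (ler_normB _ _) _.
    have := lerD (gs.1 (u + d) (v + d)) (gs.1 (u - d) (v - d)).
    have -> : u + d - (v + d) = u - v by ring.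
    have -> : u - d - (v - d) = u - v by ring.
    by rewrite mulr_natl mulr2n mulrDl.
  rewrite !Amax ?subr0//.
    have : `|u| <= `|u - d| + `|d| by rewrite -{1}(subrK d u) ler_normD.
    by rewrite (ger0_norm d0); lra.
  have : `|u| <= `|u + d| + `|d|.
    by rewrite -{1}(addrK d u); apply: le_trans (ler_normB _ _) _.
  by rewrite (ger0_norm d0); lra.
- by apply: integrable_sub => //; [exact: integrable_translation lip_support_integrable|
    exact: (integrable_translation (- d)) lip_support_integrable].
Qed.

End lip_support.

(** * Decay of the transform of a Lipschitz function *)

Section trig_transform_lipschitz.
Context (R : realType).
Local Notation mu := (@lebesgue_measure R).
Local Notation int1 g := (mu.-integrable setT (EFin \o g)).

Lemma sin_quotient_cvg (A x : R) : 0 < A ->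
  sin (A / n.+1%:R * x) / (A / n.+1%:R) @[n --> \oo] --> x.
Proof.
move=> A0; have dx : is_derive (0 : R) 1 (fun t : R => sin (t * x)) x.
  by apply: is_derive_eq; rewrite mul0r cos0 /GRing.scale/=; ring.
have := @ex_derive _ _ _ _ _ _ _ dx; rewrite /derivable => /cvg_ex[/= l hl].
have xl : x = l by rewrite -(@derive_val _ _ _ _ _ _ _ dx); apply: cvg_lim.
rewrite [X in _ --> X]xl.
have d0 n : A / n.+1%:R != 0 :> R by rewrite mulf_neq0 ?gt_eqF// invr_gt0.
have dcv : A / n.+1%:R @[n --> \oo] --> (0 : R).
  by rewrite -[X in _ --> X](mulr0 A); apply: cvgM; [exact: cvg_cst|exact: cvg_harmonic].
move/cvgr_dnbhsP : hl => /(_ (fun n => A / n.+1%:R) (conj d0 dcv)).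
apply: cvg_trans; apply: near_eq_cvg; near=> n.
by rewrite /= /GRing.scale/= mulr1 addr0 mul0r sin0 subr0 mulrC.
Unshelve. all: by end_near. Qed.

Variables (e e' : R -> R) (s : R).
Hypotheses (te : trig_kernel e) (te' : trig_kernel e') (s1 : `|s| = 1)
  (conj : forall a b, e' (a - b) - e' (a + b) = s * 2 * e a * sin b).
Variables (A C : R) (g : R -> R).
Hypotheses (A0 : 0 < A) (C0 : 0 <= C) (gs : lip_support A C g).

Let ig := lip_support_integrable A0 C0 gs.
Let ig2 := lip_support_integrable_sqr A0 C0 gs.
Let iug := lip_support_integrable_moment A0 C0 gs.
Local Notation T := (trigtr e g).

(** The difference of two shifts of the symbol multiplies the transform by a sine and exchanges
    [cos] and [sin]; hence the two kernels [e] and [e'] related by [conj] up to a sign [s]. *)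
Lemma trigtr_shift d x : 
  trigtr e' (fun u => g (u + d) - g (u - d)) x = s * 2 * sin (d * x) * T x.
Proof.
have me' : measurable_fun setT e' by apply: continuous_measurable_fun; exact: trig_continuous te'.
have iF c : int1 (fun u => g u * e' ((u - c) * x)).
  apply: (@integrable_mulr _ _ R mu setT g (fun u => e' ((u - c) * x)) 1) => //.
    by apply: (measurableT_comp me'); apply: measurable_funM => //; exact: measurable_funB.
  by move=> u _; exact: trig_le1.
have tr c : \int[mu]_u (g (u + c) * e' (u * x)) = \int[mu]_u (g u * e' ((u - c) * x)).
  rewrite -(Rintegral_translation c (iF c)).
  by apply: eq_Rintegral => u _; rewrite addrK.
transitivity (\int[mu]_u (g (u + d) * e' (u * x) - g (u - d) * e' (u * x))).
  by apply: eq_Rintegral => u _; rewrite mulrBl.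
rewrite RintegralB//; last 2 first.
- by apply: integrable_trig => //; exact: integrable_translation.
- by apply: integrable_trig => //; exact: (integrable_translation (- d)).
rewrite tr (tr (- d)) -RintegralB// -RintegralZl//; last exact: integrable_trig.
apply: eq_Rintegral => u _.
by rewrite -mulrBr opprK mulrBl mulrDl conj; ring.
Qed.

Let sh d (d0 : 0 <= d) := lip_support_shift A0 C0 gs d0.

(* The increments [g (. + h) - g (. - h)] have a transform of modulus
   [2 |sin (h x) T x|]; divide Plancherel by [h ^ 2] and apply Fatou. *)
Lemma trigtr_moment2 :
  (\int[mu]_x (x ^+ 2 * T x ^+ 2)%:E <= (8 * pi * A * C ^+ 2)%:E)%E.
Proof.
have cT := continuous_trigtr te ig iug.
have mT : measurable_fun setT T by exact: continuous_measurable_fun.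
(* Steps of length at most [A] keep the support of the increments within [2 * A]; this is the origin
   of the constant [8]. *)
have Ad n : 0 < A / n.+1%:R by rewrite divr_gt0.
have Ad1 n : A / n.+1%:R <= A.
  by rewrite ler_pdivrMr// ler_peMr ?(ltW A0)// ler1n.
apply: (@fatou_bound _ _ R mu setT
  (fun n x => (sin (A / n.+1%:R * x) / (A / n.+1%:R)) ^+ 2 * T x ^+ 2)) => //.
- move=> n; apply: measurable_funM; last exact: measurable_funX.
  apply: measurable_funX; apply: measurable_funM => //.
  apply: measurableT_comp; last exact: measurable_funM.
  by apply: continuous_measurable_fun; exact: continuous_sin.
- by move=> n x _; rewrite mulr_ge0 ?sqr_ge0.
- move=> x _; apply: cvgM; last exact: cvg_cst.
  by rewrite expr2; under eq_fun do rewrite expr2; apply: cvgM; exact: sin_quotient_cvg.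
- move=> n; have d0 := Ad n; have dA := Ad1 n; set d := A / n.+1%:R in d0 dA *; clearbody d.
  have [ish [lsh bsh]] := sh (ltW d0).
  have Adp : 0 < A + d by rewrite addr_gt0.
  have C20 : 0 <= 2 * C by rewrite mulr_ge0.
  have ish2 := lip_support_integrable_sqr Adp C20 lsh.
  have ishu := lip_support_integrable_moment Adp C20 lsh.
  have -> : (\int[mu]_x ((sin (d * x) / d) ^+ 2 * T x ^+ 2)%:E =
     \int[mu]_x (((2 * d) ^- 2)%:E *
     (trigtr e' (fun u => g (u + d) - g (u - d)) x ^+ 2)%:E))%E.
    apply: eq_integral => x _; rewrite -EFinM; congr EFin; rewrite trigtr_shift.
    rewrite !exprMn (_ : s ^+ 2 = 1); last by rewrite -(real_normK (num_real s)) s1 expr1n.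
    by field; rewrite gt_eqF.
  rewrite ge0_integralZl//; last 3 first.
  + apply/measurable_EFinP; apply: measurable_funX; apply: continuous_measurable_fun.
    exact: continuous_trigtr.
  + by move=> x _; rewrite lee_fin sqr_ge0.
  + by rewrite lee_fin invr_ge0 sqr_ge0.
  apply: (@le_trans _ _ (((2 * d) ^- 2)%:E * (2 * pi * (2 * (A + d) * (2 * d * C) ^+ 2))%:E)%E).
    apply: lee_wpmul2l; first by rewrite lee_fin invr_ge0 sqr_ge0.
    apply: le_trans (plancherel_le te' ish ish2 ishu) _.
    rewrite lee_fin ler_wpM2l ?mulr_ge0 ?pi_ge0//.
    have [] := @support_integrable R (A + d) ((2 * d * C) ^+ 2)
      (fun u => (g (u + d) - g (u - d)) ^+ 2) (ltW Adp) => //.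
    * by apply: measurable_funX; exact: integrable_measurable ish.
    * by move=> u /lsh.2 ->; rewrite expr0n.
    * by move=> u; rewrite normrX lerXn2r ?nnegrE// !mulr_ge0// ltW.
  rewrite -EFinM lee_fin.
  have -> : (2 * d) ^- 2 * (2 * pi * (2 * (A + d) * (2 * d * C) ^+ 2)) =
    4 * pi * (A + d) * C ^+ 2 by field; rewrite gt_eqF.
  rewrite ler_wpM2r ?sqr_ge0//; have -> : 8 * pi * A = 4 * pi * (2 * A) by ring.
  by rewrite ler_wpM2l ?mulr_ge0 ?pi_ge0//; lra.
Qed.

(** The step [d] is a quarter period, [d * |x| = pi / 2], so that the sine in [trigtr_shift] has
    modulus 1; the increments of [g] are then of size [2 * d * C], and [pi <= 2 * A * |x|] ensures
    [d <= A]. *)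
Lemma trigtr_decay x : x != 0 -> pi <= 2 * A * `|x| ->
  `|T x| <= 2 * pi * A * C / `|x|.
Proof.
move=> x0 xA; have nx0 : 0 < `|x| by rewrite normr_gt0.
set d := pi / (2 * `|x|).
have d0 : 0 < d by rewrite divr_gt0 ?pi_gt0 ?mulr_gt0.
have dA : d <= A by rewrite /d ler_pdivrMr ?mulr_gt0//; apply: le_trans xA _; rewrite le_eqVlt; apply/orP; left; apply/eqP; ring.
have [ish [lsh bsh]] := sh (ltW d0).
have Adp : 0 < A + d by rewrite addr_gt0.
have sd : `|sin (d * x)| = 1.
  have -> : d * x = pi / 2 * (x / `|x|) by rewrite /d; field; rewrite gt_eqF.
  have [xp|xn|xe] := ltrgt0P x; last by rewrite xe eqxx in x0.
    by rewrite divff ?gt_eqF// mulr1 sin_pihalf normr1.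
  by rewrite invrN mulrN divff ?lt_eqF// mulrN1 sinN sin_pihalf normrN normr1.
have : 2 * `|T x| <= 2 * (A + d) * (2 * d * C).
  have -> : 2 * `|T x| = `|trigtr e' (fun u => g (u + d) - g (u - d)) x|.
    by rewrite trigtr_shift !normrM s1 sd mul1r mulr1 ger0_norm.
  apply: le_trans (normr_trigtr_le te' x ish) _.
  have [] := @support_integrable R (A + d) (2 * d * C)
      (fun u => `|g (u + d) - g (u - d)|) (ltW Adp) => //.
  - by apply: measurableT_comp => //; exact: integrable_measurable ish.
  - by move=> u /lsh.2 ->; rewrite normr0.
  - by move=> u; rewrite normr_id.
rewrite -[leLHS]mulr1 => h.
have -> : 2 * pi * A * C / `|x| = 2 * A * (2 * d * C).
  by rewrite /d; field; rewrite gt_eqF.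
have : 2 * (A + d) * (2 * d * C) <= 2 * (2 * A) * (2 * d * C).
  apply: ler_wpM2r; first by apply: mulr_ge0 => //; apply: mulr_ge0 => //; exact: ltW.
  by apply: ler_wpM2l => //; lra.
by move: (2 * d * C) h => D; rewrite mulr1; move: `|T x| => t h1 h2; nra.
Qed.

End trig_transform_lipschitz.

(** * Integrability and decay of inverse transforms *)

Section inverse_transform.
Context (R : realType).
Local Notation mu := (@lebesgue_measure R).
Local Notation int1 g := (mu.-integrable setT (EFin \o g)).

(* The real part of the inverse Fourier transform of [a + i c]. *)
Definition ftr (a c : R -> R) (x : R) : R :=
  (2 * pi)^-1 * (trigtr cos a x + trigtr sin c x).

Let conj_cos (a b : R) : sin (a - b) - sin (a + b) = -1 * 2 * cos a * sin b.
Proof. by rewrite sinB sinD; ring. Qed.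

Let conj_sin (a b : R) : cos (a - b) - cos (a + b) = 1 * 2 * sin a * sin b.
Proof. by rewrite cosB cosD; ring. Qed.

Let tc := @trig_kernel_cos R.
Let ts := @trig_kernel_sin R.

Let pi2 : 2 <= pi :> R. Proof. exact: pi_ge2. Qed.

(** The weight is 1 for Plancherel and [x ^+ 2] for the second moment. The constant is
    [(2 * pi) ^- 2] times the 2 lost in squaring a sum. *)
Lemma ftr_weighted (w a c : R -> R) (B1 B2 : R) :
  measurable_fun setT w -> (forall x, 0 <= w x) ->
  measurable_fun setT (trigtr cos a) -> measurable_fun setT (trigtr sin c) ->
  (\int[mu]_x (w x * trigtr cos a x ^+ 2)%:E <= B1%:E)%E ->
  (\int[mu]_x (w x * trigtr sin c x ^+ 2)%:E <= B2%:E)%E ->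
  (\int[mu]_x (w x * ftr a c x ^+ 2)%:E <= ((2 * pi ^+ 2)^-1 * (B1 + B2))%:E)%E.
Proof.
move=> mw w0 m1 m2 h1 h2.
have p0 : 0 < pi :> R by exact: pi_gt0.
have k0 : 0 <= (2 * pi ^+ 2)^-1 :> R by rewrite invr_ge0 mulr_ge0// sqr_ge0.
have n1 : measurable_fun setT (fun x => w x * trigtr cos a x ^+ 2).
  by apply: measurable_funM => //; exact: measurable_funX.
have n2 : measurable_fun setT (fun x => w x * trigtr sin c x ^+ 2).
  by apply: measurable_funM => //; exact: measurable_funX.
have g1 x : 0 <= w x * trigtr cos a x ^+ 2 by rewrite mulr_ge0// sqr_ge0.
have g2 x : 0 <= w x * trigtr sin c x ^+ 2 by rewrite mulr_ge0// sqr_ge0.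
have [i1 l1] := @ge0_integrable_of_le _ _ R mu setT _ B1 measurableT n1 (fun x _ => g1 x) h1.
have [i2 l2] := @ge0_integrable_of_le _ _ R mu setT _ B2 measurableT n2 (fun x _ => g2 x) h2.
have i := integrable_scale (2 * pi ^+ 2)^-1 measurableT (integrable_add measurableT i1 i2).
have mf : measurable_fun setT (ftr a c).
  by apply: measurable_funM => //; exact: measurable_funD.
apply: (@le_trans _ _ (\int[mu]_x ((2 * pi ^+ 2)^-1 *
  (w x * trigtr cos a x ^+ 2 + w x * trigtr sin c x ^+ 2))%:E)%E).
  apply: ge0_le_integral => //.
  - by move=> x _; rewrite lee_fin mulr_ge0// sqr_ge0.
  - by apply/measurable_EFinP; apply: measurable_funM => //; exact: measurable_funX.
  - by apply/measurable_EFinP; exact: integrable_measurable i.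
  - move=> x _; rewrite lee_fin /ftr exprMn; move: (trigtr cos a x) (trigtr sin c x) => t1 t2.
    move: (pi : R) p0 => p p0.
    have -> : (2 * p ^+ 2)^-1 * (w x * t1 ^+ 2 + w x * t2 ^+ 2) =
       w x * ((2 * p)^-1 ^+ 2 * (2 * (t1 ^+ 2 + t2 ^+ 2))) by field; rewrite gt_eqF.
    by rewrite ler_wpM2l// ler_wpM2l ?sqr_ge0//; have := sqr_ge0 (t1 - t2); nra.
rewrite -[X in (X <= _)%E]EFin_Rintegral// lee_fin RintegralZl//; last exact: integrable_add.
by rewrite RintegralD//; apply: ler_wpM2l => //; exact: lerD.
Qed.

Variables (A C : R) (a c : R -> R).
Hypotheses (A0 : 0 < A) (C0 : 0 <= C) (sa : lip_support A C a) (sc : lip_support A C c).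

Let ia := lip_support_integrable A0 C0 sa.
Let ia2 := lip_support_integrable_sqr A0 C0 sa.
Let iua := lip_support_integrable_moment A0 C0 sa.
Let ic := lip_support_integrable A0 C0 sc.
Let ic2 := lip_support_integrable_sqr A0 C0 sc.
Let iuc := lip_support_integrable_moment A0 C0 sc.

Lemma continuous_ftr : continuous (ftr a c).
Proof.
move=> x; apply: cvgM; first exact: cvg_cst.
by apply: cvgD; apply: continuous_trigtr.
Qed.

Lemma measurable_ftr : measurable_fun setT (ftr a c).
Proof. by apply: continuous_measurable_fun; exact: continuous_ftr. Qed.

Let m1 : measurable_fun setT (trigtr cos a).
Proof. by apply: continuous_measurable_fun; exact: continuous_trigtr. Qed.

Let m2 : measurable_fun setT (trigtr sin c).
Proof. by apply: continuous_measurable_fun; exact: continuous_trigtr. Qed.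

Lemma ftr_sqr_le :
  (\int[mu]_x (ftr a c x ^+ 2)%:E <= (\int[mu]_u (a u ^+ 2) + \int[mu]_u (c u ^+ 2))%:E)%E.
Proof.
have e (f : R -> R) : (\int[mu]_x (f x ^+ 2)%:E = \int[mu]_x (1 * f x ^+ 2)%:E)%E.
  by apply: eq_integral => x _; rewrite mul1r.
have h1 := plancherel_le tc ia ia2 iua; rewrite e in h1.
have h2 := plancherel_le ts ic ic2 iuc; rewrite e in h2.
rewrite e; apply: le_trans (ftr_weighted _ _ m1 m2 h1 h2) _ => //.
rewrite lee_fin -mulrDr mulrA ler_piMl//.
  by apply: addr_ge0; apply: Rintegral_ge0 => u _; exact: sqr_ge0.
move: (pi : R) pi2 (pi_gt0 R) => p p2 p0.
have -> : (2 * p ^+ 2)^-1 * (2 * p) = p^-1 by field; rewrite gt_eqF.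
by rewrite invf_le1//; lra.
Qed.

Lemma ftr_moment2 : (\int[mu]_x (x ^+ 2 * ftr a c x ^+ 2)%:E <= (8 * A * C ^+ 2)%:E)%E.
Proof.
have h1 := trigtr_moment2 tc ts (normrN1 R) conj_cos A0 C0 sa.
have h2 := trigtr_moment2 ts tc (normr1 R) conj_sin A0 C0 sc.
apply: le_trans (ftr_weighted _ _ m1 m2 h1 h2) _ => //.
  by move=> x; exact: sqr_ge0.
rewrite lee_fin; move: (pi : R) pi2 (pi_gt0 R) => p p2 p0.
have -> : (2 * p ^+ 2)^-1 * (8 * p * A * C ^+ 2 + 8 * p * A * C ^+ 2) =
  p^-1 * (8 * A * C ^+ 2) by field; rewrite gt_eqF.
rewrite ler_piMl ?mulr_ge0 ?sqr_ge0 ?(ltW A0)//.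
by rewrite invf_le1//; lra.
Qed.

(** Cauchy-Schwarz against [(1 + x ^+ 2)^-1], in the additive form [t <= (1 + x ^+ 2) * t ^+ 2 + (1
    + x ^+ 2)^-1]; the integral of the last term is [pi]. *)
Lemma ftr_integrable : int1 (ftr a c) /\
  \int[mu]_x `|ftr a c x| <=
    \int[mu]_u (a u ^+ 2) + \int[mu]_u (c u ^+ 2) + 8 * A * C ^+ 2 + pi.
Proof.
have mf := measurable_ftr.
have [i1 l1] := @ge0_integrable_of_le _ _ R mu setT _ _ measurableT
  (measurable_funX 2 mf) (fun x _ => sqr_ge0 _) ftr_sqr_le.
have mx2 : measurable_fun setT (fun x : R => x ^+ 2 * ftr a c x ^+ 2).
  by apply: measurable_funM; exact: measurable_funX.
have gx2 x : 0 <= x ^+ 2 * ftr a c x ^+ 2 by rewrite mulr_ge0 ?sqr_ge0.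
have [i2 l2] := @ge0_integrable_of_le _ _ R mu setT _ _ measurableT mx2
  (fun x _ => gx2 x) ftr_moment2.
have m3 : measurable_fun setT (fun x : R => (1 + x ^+ 2)^-1).
  apply: continuous_measurable_fun => x; apply: cvgV; first by rewrite gt_eqF//; nra.
  by apply: cvgD; [exact: cvg_cst|exact: exprn_continuous].
have g3 (x : R) : 0 <= (1 + x ^+ 2)^-1 by rewrite invr_ge0; nra.
have l3' : (\int[mu]_x ((1 + x ^+ 2)^-1)%:E <= (pi : R)%:E)%E by rewrite integral_inv1Dsqr.
have [i3 l3] := @ge0_integrable_of_le _ _ R mu setT _ _ measurableT m3
  (fun x _ => g3 x) l3'.
have i12 := integrable_add measurableT i1 i2.
have i123 := integrable_add measurableT i12 i3.
have le x : `|ftr a c x| <= ftr a c x ^+ 2 + x ^+ 2 * ftr a c x ^+ 2 + (1 + x ^+ 2)^-1.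
  have y0 : 0 < 1 + x ^+ 2 by nra.
  rewrite -(real_normK (num_real (ftr a c x))); move: `|ftr a c x| (normr_ge0 (ftr a c x)) => t t0.
  have -> : t ^+ 2 + x ^+ 2 * t ^+ 2 + (1 + x ^+ 2)^-1 =
    (1 + x ^+ 2)^-1 * (((1 + x ^+ 2) * t) ^+ 2 + 1) by field; rewrite gt_eqF.
  by rewrite ler_pdivlMl//; nra.
have li : int1 (ftr a c) by exact: (@integrable_le _ _ R mu setT (ftr a c) _ measurableT mf (fun x _ => le x) i123).
split => //.
apply: (@le_trans _ _ (\int[mu]_x (ftr a c x ^+ 2 + x ^+ 2 * ftr a c x ^+ 2 + (1 + x ^+ 2)^-1))).
  by apply: le_Rintegral => //; exact: integrable_norm.
by rewrite RintegralD// RintegralD//; apply: lerD => //; exact: lerD.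
Qed.

Lemma normr_ftr_le x : `|ftr a c x| <= \int[mu]_u `|a u| + \int[mu]_u `|c u|.
Proof.
have p0 : 0 < 2 * pi :> R by rewrite mulr_gt0// pi_gt0.
rewrite /ftr normrM ger0_norm ?invr_ge0 ?(ltW p0)//.
rewrite ler_pdivrMl//; apply: le_trans (ler_normD _ _) _.
apply: le_trans (lerD (normr_trigtr_le tc x ia) (normr_trigtr_le ts x ic)) _.
rewrite ler_peMl//; last by have := pi2; lra.
by apply: addr_ge0; apply: Rintegral_ge0.
Qed.

Lemma ftr_cvgNy : ftr a c x @[x --> -oo] --> 0.
Proof.
apply/cvgr0Pnorm_le => eps eps0; near=> x.
have xA : pi <= 2 * A * `|x|.
  rewrite mulrC -ler_pdivrMr ?mulr_gt0//.
  rewrite -normrN; apply: le_trans (ler_norm _); rewrite lerNr.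
  by near: x; apply: nbhs_ninfty_le; exact: num_real.
have xe : 2 * (2 * pi * A * C) / eps <= `|x|.
  rewrite -normrN; apply: le_trans (ler_norm _); rewrite lerNr.
  by near: x; apply: nbhs_ninfty_le; exact: num_real.
have nx : 0 < `|x|.
  rewrite normr_gt0; apply: contraTneq xA => ->.
  by rewrite normr0 mulr0 -ltNge pi_gt0.
have x0 : x != 0 by rewrite -normr_gt0.
have p0 : 0 < 2 * pi :> R by rewrite mulr_gt0// pi_gt0.
rewrite /ftr normrM ger0_norm ?invr_ge0 ?(ltW p0)//.
have h1 := trigtr_decay tc ts (normrN1 R) conj_cos A0 C0 sa x0 xA.
have h2 := trigtr_decay ts tc (normr1 R) conj_sin A0 C0 sc x0 xA.
rewrite ler_pdivrMl//; apply: le_trans (ler_normD _ _) _.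
apply: le_trans (lerD h1 h2) _.
apply: (@le_trans _ _ eps); last by rewrite ler_peMl ?(ltW eps0)//; have := pi2; lra.
rewrite -mulrDl ler_pdivrMr//; move: xe; rewrite ler_pdivrMr//.
by rewrite [`|x| * _]mulrC mulr_natl mulr2n.
Unshelve. all: by end_near. Qed.

End inverse_transform.

Section transform_primitive.
Context (R : realType).
Local Notation mu := (@lebesgue_measure R).
Local Notation int1 g := (mu.-integrable setT (EFin \o g)).

Lemma is_derive_trigtr (e de : R -> R) (g : R -> R) (x : R) :
  trig_kernel e -> (forall y : R, is_derive y 1 e (de y)) -> (forall y, `|de y| <= 1) ->
  int1 g -> int1 (fun u => `|u| * `|g u|) ->
  is_derive x 1 (trigtr e g) (\int[mu]_u (g u * u * de (u * x))).
Proof.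
move=> te ede de1 ig iug.
have dg (u y : R) : is_derive y 1 (fun y : R => g u * e (u * y)) (g u * u * de (u * y)).
  have h := ede (u * y).
  by apply: is_derive_eq; rewrite /GRing.scale/=; ring.
have Ix : `](x - 1), (x + 1)[%classic x by rewrite /= in_itv/=; apply/andP; split; lra.
have p1 : partial1of2 (fun y u => g u * e (u * y)) = fun y u => g u * u * de (u * y).
  apply/funext => y; apply/funext => u; rewrite partial1of2E.
  by have h := dg u y; rewrite derive_val.
have ub (y u : R) : `|(partial1of2 (fun y u => g u * e (u * y))) y u| <= `|u| * `|g u|.
  by rewrite p1 /= !normrM [`|u| * _]mulrC ler_piMr.
have := @derivable_under_integral R _ _ mu (fun y u => g u * e (u * y)) setT measurableT
  x (x - 1) (x + 1) Ix (fun y _ => integrable_trig te y ig)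
  (fun y u _ _ => @ex_derive _ _ _ _ _ _ _ (dg u y)) (fun u => `|u| * `|g u|)
  (fun u => mulr_ge0 (normr_ge0 _) (normr_ge0 _)) iug (fun y u _ _ => ub y u).
have := @differentiation_under_integral R _ _ mu (fun y u => g u * e (u * y)) setT measurableT
  x (x - 1) (x + 1) Ix (fun y _ => integrable_trig te y ig)
  (fun y u _ _ => @ex_derive _ _ _ _ _ _ _ (dg u y)) (fun u => `|u| * `|g u|)
  (fun u => mulr_ge0 (normr_ge0 _) (normr_ge0 _)) iug (fun y u _ _ => ub y u).
rewrite p1 derive1E => E D.
by apply: DeriveDef.
Qed.

(** In complex notation the symbol on the left is [i (a + i c)], and differentiating an inverse
    transform multiplies its symbol by [- i u], whence [u (a + i c)]. *)
Lemma is_derive_ftr (a c : R -> R) (x : R) :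
  int1 a -> int1 (fun u => `|u| * `|a u|) ->
  int1 c -> int1 (fun u => `|u| * `|c u|) ->
  is_derive x 1 (ftr (fun u => - c u) a) (ftr (fun u => u * a u) (fun u => u * c u) x).
Proof.
move=> ia iua ic iuc.
have inc : int1 (fun u => - c u).
  have := integrable_scale (-1) measurableT ic.
  by apply: eq_integrable => //= u _; rewrite mulN1r.
have iunc : int1 (fun u => `|u| * `|- c u|).
  by apply: eq_integrable iuc => //= u _; rewrite normrN.
have dc (y : R) : is_derive y 1 (@cos R) (- sin y) by exact: is_derive_cos.
have ds (y : R) : is_derive y 1 (@sin R) (cos y) by exact: is_derive_sin.
have lc (y : R) : `|- sin y| <= 1 by rewrite normrN sin_max.
have ls (y : R) : `|cos y| <= 1 by exact: cos_max.
have d1 := is_derive_trigtr x (trig_kernel_cos R) dc lc inc iunc.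
have d2 := is_derive_trigtr x (trig_kernel_sin R) ds ls ia iua.
have d12 := is_deriveD d1 d2.
have h := is_deriveZ (2 * pi)^-1 d12.
suff -> : ftr (fun u => u * a u) (fun u => u * c u) x = (2 * pi)^-1 *:
     (\int[mu]_u (- c u * u * - sin (u * x)) + \int[mu]_u (a u * u * cos (u * x))).
  exact: h.
rewrite /ftr /GRing.scale/=; congr (_ * _); rewrite addrC; congr (_ + _);
  by apply: eq_Rintegral => u _; ring.
Qed.

End transform_primitive.

(** * Fourier inversion for integrals over segments *)

Section inversion.
Context (R : realType).
Local Notation mu := (@lebesgue_measure R).
Local Notation int1 g := (mu.-integrable setT (EFin \o g)).

Lemma cvg_atan_scale (c : R) : atan (n.+1%:R * c) @[n --> \oo] --> pi / 2 * Num.sg c.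
Proof.
have natoo : (n.+1%:R : R) @[n --> \oo] --> +oo.
  by rewrite (cvg_shiftS (fun n => n%:R : R)); exact: cvgr_idn.
have pos (x : R) : 0 < x -> atan (n.+1%:R * x) @[n --> \oo] --> pi / 2.
  move=> x0.
  have h : n.+1%:R * x @[n --> \oo] --> +oo.
    apply/cvgryPge => A; move/cvgryPge : natoo => /(_ (A / x)).
    by apply: filterS => n; rewrite ler_pdivrMr.
  exact: (cvg_comp (fun n => n.+1%:R * x) atan h (@cvgy_atan R)).
have [c0|c0|->] := ltrgt0P c.
- by rewrite gtr0_sg// mulr1; exact: pos.
- rewrite ltr0_sg// mulrN1.
  rewrite (_ : (fun n => _) = fun n => - atan (n.+1%:R * - c)); last first.
    by apply/funext => n; rewrite mulrN atanN opprK.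
  by apply: cvgN; apply: pos; rewrite oppr_gt0.
- rewrite sgr0 mulr0 (_ : (fun n => _) = fun=> 0); first exact: cvg_cst.
  by apply/funext => n; rewrite mulr0 atan0.
Qed.

Lemma Rintegral_indic_itv (a t : R) (f : R -> R) :
  \int[mu]_y (\1_(`[a, t]) y * f y) = \int[mu]_(y in `[a, t]) f y.
Proof.
rewrite [RHS]Rintegral_mkcond; apply: eq_Rintegral => y _.
by rewrite patchE indicE; case: ifPn => yi; rewrite ?mul1r ?mul0r.
Qed.

Lemma Rintegral_poisson_itv (s a t z : R) : 0 < s -> a < t ->
  \int[mu]_y (\1_(`[a, t]) y * poisson s (y - z)) =
  2 * (atan ((t - z) / s) - atan ((a - z) / s)).
Proof.
move=> s0 at_; rewrite Rintegral_indic_itv /Rintegral.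
have dP (y : R) : is_derive y 1 (fun y : R => 2 * atan ((y - z) / s)) (poisson s (y - z)).
  have h : 0 < s ^+ 2 + (y - z) ^+ 2 by have := sqr_ge0 (y - z); nra.
  apply: is_derive_eq; rewrite /poisson /GRing.scale/=; field.
  by rewrite !gt_eqF//; have := sqr_ge0 (y - z); nra.
rewrite (@continuous_FTC2 _ _ (fun y : R => 2 * atan ((y - z) / s)))//=.
- by rewrite mulrBr.
- apply: continuous_subspaceT => y; apply: (@continuous_comp _ _ _ (fun y => y - z)).
    by apply: cvgB; [exact: cvg_id|exact: cvg_cst].
  exact: continuous_poisson.
- split.
  + by move=> y _; have h := dP y; exact: ex_derive.
  + by apply: cvg_at_right_filter; exact: is_derive_continuous (dP a).
  + by apply: cvg_at_left_filter; exact: is_derive_continuous (dP t).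
- by move=> y _; have [_] := is_derive1E (dP y).
Qed.

Variables (K : R -> R) (C b : R).
Hypotheses (iK : int1 K) (C0 : 0 <= C) (b0 : 0 < b).
Hypotheses (sc : lip_support 1 C (trigtr cos K)) (ss : lip_support 1 C (trigtr sin K)).

Local Notation kc := (fun u => trigtr cos K (b * u)).
Local Notation ks := (fun u => trigtr sin K (b * u)).

Lemma lip_support_dilate (g : R -> R) : lip_support 1 C g ->
  lip_support b^-1 (b * C) (fun u => g (b * u)).
Proof.
move=> [g1 g2]; split => [u v|u bu].
  apply: le_trans (g1 _ _) _.
  by rewrite -mulrBr normrM (gtr0_norm b0) mulrCA mulrA.
by apply: g2; rewrite normrM (gtr0_norm b0) mulrC -ler_pdivrMr// div1r.
Qed.

Let A0 : 0 < b^-1. Proof. by rewrite invr_gt0. Qed.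
Let bC0 : 0 <= b * C. Proof. by rewrite mulr_ge0// ltW. Qed.
Let sc' := lip_support_dilate sc.
Let ss' := lip_support_dilate ss.
Let ic := lip_support_integrable A0 bC0 sc'.
Let is_ := lip_support_integrable A0 bC0 ss'.

(** Abel summation: with the weight [expabs s] in the frequency integral, [ftr kc ks] becomes an
    average of Poisson kernels centred at [b * x]; over [[a, t]] each of them integrates to a
    difference of arctangents, and [s] tends to 0 on both sides. This identifies [ftr kc ks] with
    the kernel [K] rescaled by [b], tested against segments. *)
Lemma inversion_segment (a t : R) : a < t ->
  \int[mu]_y (\1_(`[a, t]) y * ftr kc ks y) =
  \int[mu]_x (K x * \1_(`[a, t]) (b * x)).
Proof.
move=> at_.
pose N s y := \int[mu]_u (expabs s u * (kc u * cos (u * y) + ks u * sin (u * y))).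
have mK : measurable_fun setT K by exact: integrable_measurable iK.
have N1 s y : 0 < s -> N s y = \int[mu]_x (K x * poisson s (y - b * x)).
  move=> s0; have iw := integrable_expabs s0.
  transitivity (\int[mu]_u (expabs s u * \int[mu]_x (K x * cos (u * (y - b * x))))).
    apply: eq_Rintegral => u _; congr (_ * _).
    rewrite /trigtr -RintegralZr//; last exact: (integrable_trig (trig_kernel_cos R)).
    rewrite -RintegralZr//; last exact: (integrable_trig (trig_kernel_sin R)).
    rewrite -RintegralD//.
    - apply: eq_Rintegral => x _; rewrite mulrBr cosB.
      by rewrite (_ : u * (b * x) = x * (b * u)); [ring|ring].
    - have := integrable_scale (cos (u * y)) measurableT (integrable_trig (trig_kernel_cos R) (b * u) iK).
      by apply: eq_integrable => //= x _; rewrite mulrC.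
    - have := integrable_scale (sin (u * y)) measurableT (integrable_trig (trig_kernel_sin R) (b * u) iK).
      by apply: eq_integrable => //= x _; rewrite mulrC.
  rewrite (@Rfubini _ _ _ _ R mu mu (expabs s) K (fun z => cos (z.1 * (y - b * z.2))) 1 iw iK).
  - apply: eq_Rintegral => x _; congr (_ * _).
    rewrite -Rintegral_expabs_cos//; apply: eq_Rintegral => u _; congr (_ * cos _); exact: mulrC.
  - apply: (measurableT_comp (continuous_measurable_fun (@continuous_cos R))).
    apply: measurable_funM => //; apply: measurable_funB => //; exact: measurable_funM.
  - by move=> z; exact: cos_max.
have i1 : int1 (\1_(`[a, t]) : R -> R) by exact: integrable_indic_itv.
have E s : 0 < s -> \int[mu]_y (\1_(`[a, t]) y * N s y) =
    \int[mu]_x (K x * (2 * (atan ((t - b * x) / s) - atan ((a - b * x) / s)))).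
  move=> s0; have mp : measurable_fun setT (poisson s).
    by apply: continuous_measurable_fun; exact: continuous_poisson.
  transitivity (\int[mu]_y (\1_(`[a, t]) y * \int[mu]_x (K x * poisson s (y - b * x)))).
    by apply: eq_Rintegral => y _; rewrite N1.
  rewrite (@Rfubini _ _ _ _ R mu mu (\1_(`[a, t]) : R -> R) K
    (fun z => poisson s (z.1 - b * z.2)) (2 / s) i1 iK).
  - by apply: eq_Rintegral => x _; rewrite -Rintegral_poisson_itv.
  - by apply: (measurableT_comp mp); apply: measurable_funB => //; exact: measurable_funM.
  - by move=> z; exact: poisson_le.
pose s_ n : R := n.+1%:R^-1; have s0 n : 0 < s_ n by rewrite invr_gt0.
(* The limit of the arctangent differences: [2 * pi] inside the segment, 0 outside and [pi] at the
   endpoints. *)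
pose J z : R := pi * (Num.sg (t - z) - Num.sg (a - z)).
have msg (c : R) : measurable_fun setT (fun x : R => Num.sg (c - b * x)).
  have ms : measurable_fun setT (@Num.sg R).
    have -> : @Num.sg R = fun x => \1_(`]0, +oo[) x - \1_(`]-oo, 0[) x.
      apply/funext => x; rewrite !indicE !mem_setE !in_itv/= andbT.
      by case: sgrP; rewrite ?subr0 ?sub0r ?subrr.
    by apply: measurable_funB; exact: measurable_indic.
  by apply: (measurableT_comp ms); apply: measurable_funB => //; exact: measurable_funM.
have R1 : \int[mu]_x (K x * (2 * (atan ((t - b * x) / s_ n) - atan ((a - b * x) / s_ n))))
    @[n --> \oo] --> \int[mu]_x (K x * J (b * x)).
  have mat (c : R) n : measurable_fun setT (fun x : R => atan ((c - b * x) / s_ n)).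
    apply: (measurableT_comp (continuous_measurable_fun (@continuous_atan R))).
    by apply: measurable_funM => //; apply: measurable_funB => //; exact: measurable_funM.
  apply: (@Rintegral_cvg _ _ R mu setT _ _ (fun x => 2 * pi * `|K x|)) => //.
  - move=> n; apply: measurable_funM => //; apply: measurable_funM => //.
    by apply: measurable_funB; exact: mat.
  - apply: measurable_funM => //; apply: measurable_funM => //.
    by apply: measurable_funB; exact: msg.
  - move=> x _; apply: cvgM; first exact: cvg_cst.
    rewrite /J (_ : pi * _ = 2 * (pi / 2 * Num.sg (t - b * x) - pi / 2 * Num.sg (a - b * x))); last first.
      by move: (pi : R) => p; field.
    apply: cvgM; first exact: cvg_cst.
    have hh c : atan (c / s_ n) @[n --> \oo] --> pi / 2 * Num.sg c.
      rewrite (_ : (fun n => _) = fun n => atan (n.+1%:R * c)); first exact: cvg_atan_scale.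
      by apply/funext => n; rewrite /s_ invrK mulrC.
    by apply: cvgB; exact: hh.
  - by apply: integrable_scale => //; exact: integrable_norm.
  - move=> n x _; rewrite normrM mulrC ler_wpM2r//.
    have := atan_gtNpi2 ((t - b * x) / s_ n); have := atan_ltpi2 ((t - b * x) / s_ n).
    have := atan_gtNpi2 ((a - b * x) / s_ n); have := atan_ltpi2 ((a - b * x) / s_ n).
    move: (atan _) (atan _) (pi : R) => u v p h1 h2 h3 h4.
    by rewrite ler_norml; apply/andP; split; lra.
have R2 : \int[mu]_y (\1_(`[a, t]) y * N (s_ n) y) @[n --> \oo] -->
    \int[mu]_y (\1_(`[a, t]) y * (2 * pi * ftr kc ks y)).
  have itg : int1 (fun u => `|kc u| + `|ks u|).
    by apply: integrable_add => //; apply: integrable_norm.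
  have mk : measurable_fun setT kc by exact: integrable_measurable ic.
  have mk' : measurable_fun setT ks by exact: integrable_measurable is_.
  have mh y : measurable_fun setT (fun u => kc u * cos (u * y) + ks u * sin (u * y)).
    apply: measurable_funD; apply: measurable_funM => //.
      exact: (measurable_trigM (trig_kernel_cos R)).
    exact: (measurable_trigM (trig_kernel_sin R)).
  have mw (s : R) : measurable_fun setT (expabs s).
    by apply: continuous_measurable_fun; exact: continuous_expabs.
  have bd n y u : `|expabs (s_ n) u * (kc u * cos (u * y) + ks u * sin (u * y))| <= `|kc u| + `|ks u|.
    rewrite normrM (ger0_norm (expabs_ge0 _ _)).
    apply: (@le_trans _ _ (1 * `|kc u * cos (u * y) + ks u * sin (u * y)|)).
      by rewrite ler_wpM2r// expabs_le1.
    rewrite mul1r; apply: le_trans (ler_normD _ _) _.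
    by apply: lerD; rewrite normrM ler_piMr// ?cos_max ?sin_max.
  apply: (@Rintegral_cvg _ _ R mu setT _ _
     (fun y => (\int[mu]_u (`|kc u| + `|ks u|)) * \1_(`[a, t]) y)) => //.
  - move=> n.
    have : int1 (fun y => \1_(`[a, t]) y * \int[mu]_x (K x * poisson (s_ n) (y - b * x))).
      apply: (@Rfubini_integrable _ _ _ _ R mu mu (\1_(`[a, t]) : R -> R) K
        (fun z => poisson (s_ n) (z.1 - b * z.2)) (2 / s_ n) i1 iK).
        have mp : measurable_fun setT (poisson (s_ n)).
          by apply: continuous_measurable_fun; exact: continuous_poisson.
        by apply: (measurableT_comp mp); apply: measurable_funB => //; exact: measurable_funM.
      by move=> z; exact: poisson_le.
    move/integrable_measurable; congr (measurable_fun _ _).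
    by apply/funext => y; rewrite N1.
  - apply: measurable_funM; first exact: measurable_indic.
    by apply: measurable_funM => //; exact: (measurable_ftr A0 bC0 sc' ss').
  - move=> y _; apply: cvgM; first exact: cvg_cst.
    have -> : 2 * pi * ftr kc ks y =
        \int[mu]_u (kc u * cos (u * y) + ks u * sin (u * y)).
      rewrite /ftr mulrA divff ?mul1r; last by rewrite mulf_neq0// gt_eqF// pi_gt0.
      rewrite RintegralD//; [exact: (integrable_trig (trig_kernel_cos R))|
        exact: (integrable_trig (trig_kernel_sin R))].
    apply: (@Rintegral_cvg _ _ R mu setT _ _ (fun u => `|kc u| + `|ks u|)) => //.
    + by move=> n; apply: measurable_funM; [exact: mw|exact: mh].
    + exact: mh.
    + move=> u _; rewrite -[X in _ --> X]mul1r; apply: cvgM; last exact: cvg_cst.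
      rewrite [X in _ --> X](_ : 1 = expR (- (0 * `|u|))); last by rewrite mul0r oppr0 expR0.
      apply: continuous_cvg; first exact: continuous_expR.
      by apply: cvgN; apply: cvgM; [exact: cvg_harmonic|exact: cvg_cst].
  - by apply: integrable_scale.
  - move=> n y _; rewrite normrM [leRHS]mulrC ger0_norm; last by rewrite indicE.
    apply: ler_wpM2l; first by rewrite indicE.
    apply: le_normr_Rintegral_le => //.
      by apply: measurable_funM; [exact: mw|exact: mh].
have H : \int[mu]_x (K x * J (b * x)) =
    \int[mu]_y (\1_(`[a, t]) y * (2 * pi * ftr kc ks y)).
  apply: cvg_unique R1 _ => //.
  rewrite (_ : (fun n => _) = fun n => \int[mu]_y (\1_(`[a, t]) y * N (s_ n) y)) //.
  by apply/funext => n; rewrite E.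
have mJ : measurable_fun setT (fun x => K x * J (b * x)).
  apply: measurable_funM => //; apply: measurable_funM => //.
  by apply: measurable_funB; exact: msg.
have mI : measurable_fun setT (fun x => K x * \1_(`[a, t]) (b * x)).
  apply: measurable_funM => //.
  apply: (@measurableT_comp _ _ _ _ _ _ (\1_(`[a, t]) : R -> R)); first exact: measurable_indic.
  exact: measurable_funM.
have E2 : \int[mu]_x (K x * J (b * x)) = \int[mu]_x (2 * pi * (K x * \1_(`[a, t]) (b * x))).
  rewrite /Rintegral; congr fine; apply: ae_eq_integral => //.
  - exact/measurable_EFinP.
  - by apply/measurable_EFinP; exact: measurable_funM.
  (* [J (b * x)] differs from [2 * pi] times the indicator only where [b * x] is an endpoint. *)
  exists [set a / b; t / b]; split.
  - by apply: measurableU; exact: measurable_set1.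
  - exact: (countable_lebesgue_measure0 (finite_set_countable (finite_set2 _ _))).
  move=> x /=; apply: contra_notP => /not_orP[xa xt] _; congr EFin.
  rewrite [RHS]mulrCA; congr (_ * _).
  have ba : b * x != a by apply: contra_notN xa => /eqP <-; rewrite mulrC mulKf// gt_eqF.
  have bt : b * x != t by apply: contra_notN xt => /eqP <-; rewrite mulrC mulKf// gt_eqF.
  move: (b * x) ba bt => z za zt; rewrite /J indicE mem_setE in_itv/=.
  have [az|za'|E'] := ltrgtP a z; last by rewrite E' eqxx in za.
    have [zt'|tz|E'] := ltrgtP z t; last by rewrite E' eqxx in zt.
      by rewrite gtr0_sg ?subr_gt0// ltr0_sg ?subr_lt0//= opprK mulr1 mulrC.
    by rewrite ltr0_sg ?subr_lt0// ltr0_sg ?subr_lt0// subrr/= !mulr0.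
  have zt' : z < t by exact: lt_trans za' at_.
  by rewrite gtr0_sg ?subr_gt0// gtr0_sg ?subr_gt0// subrr/= !mulr0.
have i2 : int1 (fun x => K x * \1_(`[a, t]) (b * x)).
  apply: (@integrable_mulr _ _ R mu setT K (fun x => \1_(`[a, t]) (b * x)) 1) => //.
    apply: (@measurableT_comp _ _ _ _ _ _ (\1_(`[a, t]) : R -> R)); first exact: measurable_indic.
    exact: measurable_funM.
  by move=> x _; rewrite ger0_norm ?indicE//; case: (_ \in _).
have i3 : int1 (fun y => \1_(`[a, t]) y * ftr kc ks y).
  apply: (@integrable_mulr _ _ R mu setT (\1_(`[a, t])) (ftr kc ks)
    (\int[mu]_u `|kc u| + \int[mu]_u `|ks u|)) => //.
    exact: (measurable_ftr A0 bC0 sc' ss').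
  by move=> x _; exact: (normr_ftr_le A0 bC0 sc' ss').
move: H; rewrite E2 RintegralZl//.
have -> : \int[mu]_y (\1_(`[a, t]) y * (2 * pi * ftr kc ks y)) =
  \int[mu]_y (2 * pi * (\1_(`[a, t]) y * ftr kc ks y)).
  by apply: eq_Rintegral => y _; ring.
rewrite RintegralZl// => /mulfI ->//.
by rewrite mulf_neq0// gt_eqF// pi_gt0.
Qed.

End inversion.

(** * The deconvolution kernel and its primitive *)

Section lipschitz_algebra.
Context (R : realType).

(** The factor [p] is controlled only on [[- A, A]]: it may be the inverse of [sqmod], which has no
    global bound. Outside, [g] vanishes, and a pair with one point outside is covered by the
    Lipschitz bound of [g] alone. *)
Lemma lip_support_mul (A C B P Q : R) (g p : R -> R) : 0 <= C -> 0 <= B -> 0 <= P -> 0 <= Q ->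
  lip_support A C g -> (forall u, `|g u| <= B) ->
  (forall u v, `|u| <= A -> `|v| <= A -> `|p u - p v| <= P * `|u - v|) ->
  (forall u, `|u| <= A -> `|p u| <= Q) ->
  lip_support A (C * Q + B * P) (fun u => g u * p u).
Proof.
move=> C0 B0 P0 Q0 [g1 g2] gB pP pQ.
have key u v : `|u| <= A -> `|g u * p u - g v * p v| <= (C * Q + B * P) * `|u - v|.
  move=> uA; have [vA|Av] := leP `|v| A.
    have -> : g u * p u - g v * p v = (g u - g v) * p u + g v * (p u - p v) by ring.
    apply: le_trans (ler_normD _ _) _; rewrite [leRHS]mulrDl; apply: lerD; rewrite normrM.
      by rewrite mulrAC; apply: ler_pM => //; exact: pQ.
    by rewrite -mulrA; apply: ler_pM => //; exact: pP.
  rewrite (g2 v (ltW Av)) mul0r subr0 normrM [leRHS]mulrDl.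
  apply: (@le_trans _ _ (C * Q * `|u - v|)); last by rewrite lerDl !mulr_ge0.
  rewrite mulrAC; apply: ler_pM => //; last exact: pQ.
  by rewrite -[g u]subr0 -(g2 v (ltW Av)).
split => [u v|u Au]; last by rewrite g2// mul0r.
have [uA|Au] := leP `|u| A; first exact: key.
have [vA|Av] := leP `|v| A; first by rewrite distrC (distrC u); exact: key.
rewrite (g2 v (ltW Av)) (g2 u (ltW Au)) !mul0r subrr normr0.
by rewrite mulr_ge0// addr_ge0// mulr_ge0.
Qed.

Lemma lip_support_add (A C1 C2 : R) (g1 g2 : R -> R) :
  lip_support A C1 g1 -> lip_support A C2 g2 ->
  lip_support A (C1 + C2) (fun u => g1 u + g2 u).
Proof.
move=> [h1 k1] [h2 k2]; split => [u v|u Au]; last by rewrite k1// k2// addr0.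
have -> : g1 u + g2 u - (g1 v + g2 v) = (g1 u - g1 v) + (g2 u - g2 v) by ring.
by apply: le_trans (ler_normD _ _) _; rewrite [leRHS]mulrDl; exact: lerD.
Qed.

Lemma lip_support_opp (A C : R) (g : R -> R) :
  lip_support A C g -> lip_support A C (fun u => - g u).
Proof.
move=> [h k]; split => [u v|u Au]; last by rewrite k// oppr0.
by rewrite -opprD normrN.
Qed.

Definition clip (u : R) : R := Num.max (-1) (Num.min 1 u).

(* [1 - cutoff u = u * pseudo_inv u]: dividing the high frequencies by [u] passes
   to a primitive, without a singularity at 0. *)
Definition cutoff (u : R) : R := 1 - clip u ^+ 2.

Definition pseudo_inv (u : R) : R := clip u / Num.max 1 `|u|.

Lemma clip_le1 u : `|clip u| <= 1.
Proof.
rewrite /clip ler_norml le_max lexx /= ge_max; apply/andP; split; first lra.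
by rewrite ge_min lexx.
Qed.

Lemma clipP u : [\/ u <= -1 /\ clip u = -1, -1 <= u <= 1 /\ clip u = u | 1 <= u /\ clip u = 1].
Proof.
rewrite /clip; have [u1|u1] := leP 1 u.
  by apply: Or33; split => //; rewrite (max_idPr _)//; lra.
have [u2|u2] := leP u (-1).
  by apply: Or31; split => //; rewrite (max_idPl _).
by apply: Or32; split => //; apply/andP; split; lra.
Qed.

Lemma clip_lip u v : `|clip u - clip v| <= `|u - v|.
Proof.
rewrite ler_norml.
have := ler_norm (u - v); have := ler_norm (v - u); rewrite (distrC v u).
move: `|u - v| => w h1 h2.
by case: (clipP u) => -[hu ->]; case: (clipP v) => -[hv ->]; apply/andP; split; lra.
Qed.

Lemma cutoff_lip_support : lip_support 1 2 cutoff.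
Proof.
split => [u v|u u1].
  have -> : cutoff u - cutoff v = (clip v - clip u) * (clip v + clip u) by rewrite /cutoff; ring.
  rewrite normrM mulrC; apply: ler_pM => //.
    apply: le_trans (ler_normD _ _) _.
    by have := clip_le1 u; have := clip_le1 v; lra.
  by rewrite distrC; exact: clip_lip.
rewrite /cutoff; suff -> : clip u ^+ 2 = 1 by rewrite subrr.
move: u1; rewrite /clip ler_normr => /orP[u1|u1].
  by rewrite (min_idPl u1) (max_idPr _) ?expr1n//; lra.
by rewrite (min_idPr _) ?(max_idPl _) ?sqrrN ?expr1n//; lra.
Qed.

Lemma cutoff_le1 u : `|cutoff u| <= 1.
Proof.
have h : clip u ^+ 2 <= 1.
  by rewrite -(real_normK (num_real _)) -(expr1n _ 2) lerXn2r ?nnegrE//; exact: clip_le1.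
rewrite /cutoff ger0_norm ?subr_ge0//; have := sqr_ge0 (clip u); lra.
Qed.

(** [pseudo_inv] is [u] on [[-1, 1]] and [1 / u] outside, so the product is [clip u ^+ 2]. *)
Lemma mul_pseudo_inv u : u * pseudo_inv u = 1 - cutoff u.
Proof.
rewrite /pseudo_inv /cutoff subKr expr2 mulrCA; congr (_ * _).
have [u1|u1] := leP `|u| 1.
  rewrite divr1; move: u1; rewrite ler_norml => /andP[h1 h2].
  by case: (clipP u) => -[h ->] //; lra.
case: (clipP u) => -[h ->].
- by rewrite ltr0_norm ?invrN ?mulrN ?divff ?lt_eqF//; lra.
- by move: u1; rewrite ltNge ler_norml h.
- by rewrite gtr0_norm ?divff ?gt_eqF//; lra.
Qed.

Lemma inv_max_lip (u v : R) : `|(Num.max 1 `|u|)^-1 - (Num.max 1 `|v|)^-1| <= `|u - v|.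
Proof.
have m (w : R) : 1 <= Num.max 1 `|w| by rewrite le_max lexx.
have mp (w : R) : 0 < Num.max 1 `|w| by apply: lt_le_trans (m w).
have -> : (Num.max 1 `|u|)^-1 - (Num.max 1 `|v|)^-1 =
  (Num.max 1 `|u|)^-1 * (Num.max 1 `|v|)^-1 * (Num.max 1 `|v| - Num.max 1 `|u|).
  by field; rewrite !gt_eqF.
have i1 (w : R) : 0 <= (Num.max 1 `|w|)^-1 <= 1.
  by rewrite invr_ge0 (ltW (mp w)) /= invf_le1.
have : `|Num.max 1 `|v| - Num.max 1 `|u| | <= `|u - v|.
  rewrite distrC; apply: le_trans (ler_dist_dist u v).
  have := ler_norm (`|u| - `|v|); have := ler_norm (`|v| - `|u|).
  rewrite (distrC `|v|); move: `| `|u| - `|v| | `|u| `|v| => d x y h1 h2.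
  by rewrite ler_norml; have [h3|h3] := leP 1 x; have [h4|h4] := leP 1 y;
    apply/andP; split; lra.
move=> h; rewrite normrM; apply: le_trans h; rewrite ler_piMl//.
case/andP: (i1 u) => u0 u1; case/andP: (i1 v) => v0 v1.
by rewrite ger0_norm ?mulr_ge0// mulr_ile1.
Qed.

Lemma pseudo_inv_lip u v : `|pseudo_inv u - pseudo_inv v| <= 2 * `|u - v|.
Proof.
have i1 (w : R) : `|(Num.max 1 `|w|)^-1| <= 1.
  have m : 1 <= Num.max 1 `|w| by rewrite le_max lexx.
  by rewrite normfV ger0_norm ?invf_le1// (le_trans _ m)// (lt_le_trans _ m).
have -> : pseudo_inv u - pseudo_inv v = (clip u - clip v) * (Num.max 1 `|u|)^-1 +
  clip v * ((Num.max 1 `|u|)^-1 - (Num.max 1 `|v|)^-1) by rewrite /pseudo_inv; ring.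
apply: le_trans (ler_normD _ _) _; rewrite mulr_natl mulr2n; apply: lerD; rewrite normrM.
  by rewrite -[leRHS]mulr1; apply: ler_pM => //; exact: clip_lip.
by rewrite -[leRHS]mul1r; apply: ler_pM => //; [exact: clip_le1|exact: inv_max_lip].
Qed.

Lemma pseudo_inv_le u : `|pseudo_inv u| <= 2 / (1 + `|u|).
Proof.
have m : 1 <= Num.max 1 `|u| by rewrite le_max lexx.
have m2 : `|u| <= Num.max 1 `|u| by rewrite le_max lexx orbT.
have p : 0 < Num.max 1 `|u| by apply: lt_le_trans m.
have q : 0 < 1 + `|u| by rewrite ltr_wpDr.
rewrite /pseudo_inv normrM normfV (gtr0_norm p) ler_pdivrMr// mulrAC ler_pdivlMr//.
apply: (@le_trans _ _ (1 * (1 + `|u|))); last by move: (Num.max _ _) m m2 => M; lra.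
by rewrite ler_wpM2r ?(ltW q)// clip_le1.
Qed.

Lemma pseudo_inv_le1 u : `|pseudo_inv u| <= 1.
Proof.
have m : 1 <= Num.max 1 `|u| by rewrite le_max lexx.
have p : 0 < Num.max 1 `|u| by apply: lt_le_trans m.
rewrite /pseudo_inv normrM normfV (gtr0_norm p) ler_pdivrMr// mul1r.
exact: le_trans (clip_le1 u) m.
Qed.

End lipschitz_algebra.

Section fourier_components.
Context (R : realType).
Local Notation mu := (@lebesgue_measure R).
Local Notation int1 g := (mu.-integrable setT (EFin \o g)).

Lemma density_integrable (f : R -> R) : is_density f -> int1 f /\ \int[mu]_x f x = 1.
Proof.
move=> [mf f0 f1]; have fi : int1 f.
  apply/integrableP; split; first exact/measurable_EFinP.
  have -> : (\int[mu]_x `|(EFin \o f) x| = \int[mu]_x (f x)%:E)%E.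
    by apply: eq_integral => x _ /=; rewrite ger0_norm.
  by rewrite f1 ltry.
by split => //; rewrite /Rintegral f1.
Qed.

Lemma fourier_trigtr (g : R -> R) (u : R) :
  fourier g u = (trigtr cos g u +i* trigtr sin g u)%C.
Proof.
rewrite /fourier /Cintegral /trigtr /expi; congr (_ +i* _)%C.
- by apply: eq_Rintegral => x _ /=; rewrite mulr0 subr0 mulrC (mulrC u).
- by apply: eq_Rintegral => x _ /=; rewrite mulr0 add0r mulrC (mulrC u).
Qed.

Lemma normc_ge_Re (z : R[i]) : `|complex.Re z| <= ComplexField.Normc.normc z.
Proof.
case: z => x y /=; rewrite -sqrtr_sqr ler_sqrt ?addr_ge0 ?sqr_ge0//.
by rewrite lerDl sqr_ge0.
Qed.

Lemma normc_ge_Im (z : R[i]) : `|complex.Im z| <= ComplexField.Normc.normc z.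
Proof.
case: z => x y /=; rewrite -sqrtr_sqr ler_sqrt ?addr_ge0 ?sqr_ge0//.
by rewrite lerDr sqr_ge0.
Qed.

End fourier_components.

(** * The symbol of the deconvolution kernel *)

Section deconvolution_symbol.
Context (R : realType).
Local Notation mu := (@lebesgue_measure R).
Local Notation int1 g := (mu.-integrable setT (EFin \o g)).
Variables (beta L gamma : R) (feps K : R -> R).
Hypotheses (b0 : 0 < beta) (L0 : 0 < L) (hf : error_class beta L gamma feps).
Hypotheses (iK : int1 K) (iuK : int1 (fun u => `|u| * `|K u|)).
Hypothesis suppK : closure [set u | fourier K u != 0] `<=` `[-1, 1].

Local Notation fc := (trigtr cos feps).
Local Notation fs := (trigtr sin feps).

(** Squared modulus of the characteristic function of the errors. *)
Definition sqmod u := fc u ^+ 2 + fs u ^+ 2.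

Let fd : is_density feps. Proof. by case: hf. Qed.
Let ifeps : int1 feps. Proof. by case: (density_integrable fd). Qed.

Let normcE u : ComplexField.Normc.normc (fourier feps u) = Num.sqrt (sqmod u).
Proof. by rewrite fourier_trigtr. Qed.

Lemma sqmod_ge0 u : 0 <= sqmod u.
Proof. by rewrite addr_ge0 ?sqr_ge0. Qed.

Lemma sqrt_sqmod_ge u : L^-1 * (1 + `|u|) `^ (- beta) <= Num.sqrt (sqmod u).
Proof. by case: hf => _ h _ _; have /andP[] := h u; rewrite normcE. Qed.

Let one (u : R) : 0 < 1 + `|u|. Proof. by rewrite ltr_wpDr. Qed.

Let low_gt0 (u : R) : 0 < L^-1 * (1 + `|u|) `^ (- beta).
Proof. by rewrite mulr_gt0 ?invr_gt0// powR_gt0. Qed.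

Lemma sqmod_gt0 u : 0 < sqmod u.
Proof.
by rewrite -sqrtr_gt0; apply: lt_le_trans (sqrt_sqmod_ge u); exact: low_gt0.
Qed.

Definition sqmod_low (A : R) : R := (L^-1 * (1 + A) `^ (- beta)) ^+ 2.

Lemma sqmod_low_gt0 A : 0 <= A -> 0 < sqmod_low A.
Proof.
by move=> A0; rewrite exprn_gt0// mulr_gt0 ?invr_gt0// powR_gt0// ltr_wpDr.
Qed.

Lemma sqmod_ge A u : `|u| <= A -> sqmod_low A <= sqmod u.
Proof.
move=> uA; rewrite -[leRHS]sqr_sqrtr ?sqmod_ge0// lerXn2r ?nnegrE//.
  by rewrite mulr_ge0 ?invr_ge0 ?(ltW L0)// powR_ge0.
apply: le_trans (sqrt_sqmod_ge u); rewrite ler_wpM2l ?invr_ge0 ?(ltW L0)//.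
have A1 : 0 < 1 + A by apply: lt_le_trans (one u) _; rewrite lerD2l.
rewrite !powRN lef_pV2 ?posrE ?powR_gt0//.
by apply: ge0_ler_powR; rewrite ?nnegrE ?(ltW b0) ?(ltW A1) ?(ltW (one u))// lerD2l.
Qed.

Let derbound (u : R) : L * (1 + `|u|) `^ (- 1 - beta) <= L.
Proof.
rewrite ler_piMr ?(ltW L0)// -[leRHS](powRr0 (1 + `|u|)).
by apply: ler_powR; rewrite ?lerDl//; have := b0; lra.
Qed.

Lemma fc_lip u v : `|fc u - fc v| <= L * `|u - v|.
Proof.
case: hf => _ _ hd _.
have E : (fun t => complex.Re (fourier feps t)) = fc by apply/funext => t; rewrite fourier_trigtr.
apply: (@le_lipschitz_derive R fc (derive1 fc)) => [x|x].
  by have [[d _] _] := hd x; rewrite E in d; rewrite derive1E; exact: derivableP.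
have [_ h] := hd x; apply: le_trans (derbound x); apply: le_trans h.
by apply: le_trans (normc_ge_Re _); rewrite /= E.
Qed.

Lemma fs_lip u v : `|fs u - fs v| <= L * `|u - v|.
Proof.
case: hf => _ _ hd _.
have E : (fun t => complex.Im (fourier feps t)) = fs by apply/funext => t; rewrite fourier_trigtr.
apply: (@le_lipschitz_derive R fs (derive1 fs)) => [x|x].
  by have [[_ d] _] := hd x; rewrite E in d; rewrite derive1E; exact: derivableP.
have [_ h] := hd x; apply: le_trans (derbound x); apply: le_trans h.
by apply: le_trans (normc_ge_Im _); rewrite /= E.
Qed.

Let feps1 : \int[mu]_x `|feps x| = 1.
Proof.
have [_ <-] := density_integrable fd; case: fd => _ f0 _.
by apply: eq_Rintegral => x _; rewrite ger0_norm.
Qed.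

Lemma fc_le1 u : `|fc u| <= 1.
Proof. by rewrite -feps1; exact: (normr_trigtr_le (trig_kernel_cos R)). Qed.

Lemma fs_le1 u : `|fs u| <= 1.
Proof. by rewrite -feps1; exact: (normr_trigtr_le (trig_kernel_sin R)). Qed.

Lemma sqmod_lip u v : `|sqmod u - sqmod v| <= 4 * L * `|u - v|.
Proof.
have sq (p q M : R) : `|p| <= 1 -> `|q| <= 1 -> `|p - q| <= M -> `|p ^+ 2 - q ^+ 2| <= 2 * M.
  move=> p1 q1 h; rewrite subr_sqr normrM mulrC; apply: ler_pM => //.
  by apply: le_trans (ler_normD _ _) _; lra.
have h1 := sq _ _ _ (fc_le1 u) (fc_le1 v) (fc_lip u v).
have h2 := sq _ _ _ (fs_le1 u) (fs_le1 v) (fs_lip u v).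
have -> : sqmod u - sqmod v = (fc u ^+ 2 - fc v ^+ 2) + (fs u ^+ 2 - fs v ^+ 2).
  by rewrite /sqmod; ring.
apply: le_trans (ler_normD _ _) _; apply: le_trans (lerD h1 h2) _.
by rewrite le_eqVlt; apply/orP; left; apply/eqP; ring.
Qed.

(** Product and quotient rules for [g * p / sqmod] on [[- A, A]]. The value blows up with [A], so
    its size matters only for [A = 1]; for [A = 1 / b] it merely certifies that a finite constant
    exists. *)
Definition quot_lip (A C B : R) : R :=
  (C + B * L) * (sqmod_low A)^-1 + B * (4 * L * (sqmod_low A)^-2).

Lemma quotient_lip_support (A C B : R) (g p : R -> R) : 0 < A -> 0 <= C -> 0 <= B ->
  lip_support A C g -> (forall u, `|g u| <= B) ->
  (forall u v, `|p u - p v| <= L * `|u - v|) -> (forall u, `|p u| <= 1) ->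
  lip_support A (quot_lip A C B) (fun u => g u * p u / sqmod u).
Proof.
move=> A0 C0 B0 sg gB pL p1.
have l0 := sqmod_low_gt0 (ltW A0).
have s1 : lip_support A (C * 1 + B * L) (fun u => g u * p u).
  by apply: lip_support_mul => //; exact: ltW.
rewrite /quot_lip -[C in (C + _) * _]mulr1.
apply: (@lip_support_mul _ _ _ _ _ _ _ (fun u => (sqmod u)^-1)) => //.
- by rewrite addr_ge0// mulr_ge0// ltW.
- by rewrite !mulr_ge0 ?(ltW L0)// invr_ge0 exprn_ge0// ltW.
- by rewrite invr_ge0 ltW.
- by move=> u; rewrite normrM -[leRHS]mulr1; apply: ler_pM.
- move=> u v uA vA; have hu := sqmod_gt0 u; have hv := sqmod_gt0 v.
  have -> : (sqmod u)^-1 - (sqmod v)^-1 = (sqmod v - sqmod u) * ((sqmod u)^-1 * (sqmod v)^-1).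
    by field; rewrite !gt_eqF.
  rewrite normrM mulrAC; apply: ler_pM => //; first by rewrite distrC; exact: sqmod_lip.
  rewrite ger0_norm ?mulr_ge0 ?invr_ge0 ?sqmod_ge0// -exprVn expr2.
  by apply: ler_pM; rewrite ?invr_ge0 ?sqmod_ge0// lef_pV2 ?posrE//; exact: sqmod_ge.
- move=> u uA; rewrite ger0_norm ?invr_ge0 ?sqmod_ge0//.
  by rewrite lef_pV2 ?posrE ?sqmod_gt0//; exact: sqmod_ge.
Qed.

Let CK := \int[mu]_u (`|u| * `|K u|).
Let BK := \int[mu]_u `|K u|.
Let CK0 : 0 <= CK. Proof. by apply: Rintegral_ge0 => u _; rewrite mulr_ge0. Qed.
Let BK0 : 0 <= BK. Proof. by apply: Rintegral_ge0. Qed.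

Lemma trigtr_kernel_lip_support (e : R -> R) : trig_kernel e ->
  (forall u, fourier K u = 0 -> trigtr e K u = 0) -> lip_support 1 CK (trigtr e K).
Proof.
move=> te eK; have lip u v : `|trigtr e K u - trigtr e K v| <= CK * `|u - v|.
  exact: trigtr_lipschitz.
have out u : 1 < `|u| -> trigtr e K u = 0.
  move=> u1; apply: eK; apply/eqP/negP => /negP h.
  have : closure [set u | fourier K u != 0] u by apply: subset_closure.
  by move/suppK; rewrite /= in_itv/= -ler_norml leNgt u1.
(* The support condition is silent at [|u| = 1]; the value there is compared with the vanishing one
   at [u * (1 + eps / (1 + CK))], just outside. *)
split => // u u1; apply/eqP; rewrite -normr_eq0 eq_le normr_ge0 andbT.
apply/ler_addgt0Pr => eps eps0; rewrite add0r.
have k0 : 0 < eps / (1 + CK) by rewrite divr_gt0// ltr_wpDr.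
case: (ltrgtP `|u| 1) u1 => // [u1 _|u1 _]; first by rewrite out// normr0 ltW.
have -> : trigtr e K u = trigtr e K u - trigtr e K (u * (1 + eps / (1 + CK))).
  rewrite [X in _ - X]out ?subr0// normrM u1 mul1r.
  by rewrite gtr0_norm ?ltrDl// addr_gt0.
apply: le_trans (lip _ _) _.
have -> : u - u * (1 + eps / (1 + CK)) = - (u * (eps / (1 + CK))) by ring.
rewrite normrN normrM u1 mul1r (gtr0_norm k0) mulrA ler_pdivrMr ?ltr_wpDr//.
by rewrite mulrC ler_wpM2l ?(ltW eps0)// lerDr.
Qed.

Lemma cos_kernel_lip_support : lip_support 1 CK (trigtr cos K).
Proof.
apply: trigtr_kernel_lip_support => [|u]; first exact: trig_kernel_cos.
by rewrite fourier_trigtr => -[].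
Qed.

Lemma sin_kernel_lip_support : lip_support 1 CK (trigtr sin K).
Proof.
apply: trigtr_kernel_lip_support => [|u]; first exact: trig_kernel_sin.
by rewrite fourier_trigtr => -[].
Qed.

(** With [symbol_im], the two parts of [phi_K (b u) / phi_eps (u)], the quotient being written as
    the numerator times the conjugate of [phi_eps] over [sqmod]. *)
Definition symbol_re (b u : R) : R :=
  (trigtr cos K (b * u) * fc u + trigtr sin K (b * u) * fs u) / sqmod u.

Definition symbol_im (b u : R) : R :=
  (trigtr sin K (b * u) * fc u - trigtr cos K (b * u) * fs u) / sqmod u.

Definition symbol_lip (A C B : R) : R := quot_lip A C B + quot_lip A C B.

Lemma quot_lip_ge0 A C B : 0 <= A -> 0 <= C -> 0 <= B -> 0 <= quot_lip A C B.
Proof.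
move=> A0 C0 B0; have l0 := ltW (sqmod_low_gt0 A0).
apply: addr_ge0; apply: mulr_ge0; rewrite ?invr_ge0//.
  by apply: addr_ge0 => //; apply: mulr_ge0 => //; exact: ltW.
by apply: mulr_ge0; [rewrite mulr_ge0// ltW|rewrite invr_ge0 exprn_ge0].
Qed.

Let kcB u : `|trigtr cos K u| <= BK. Proof. exact: (normr_trigtr_le (trig_kernel_cos R)). Qed.
Let ksB u : `|trigtr sin K u| <= BK. Proof. exact: (normr_trigtr_le (trig_kernel_sin R)). Qed.

Lemma symbol_lip_support b : 0 < b ->
  lip_support b^-1 (symbol_lip b^-1 (b * CK) BK) (symbol_re b) /\
  lip_support b^-1 (symbol_lip b^-1 (b * CK) BK) (symbol_im b).
Proof.
move=> bp; have b'0 : 0 < b^-1 by rewrite invr_gt0.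
have C0 : 0 <= b * CK by rewrite mulr_ge0// ltW.
have sc := lip_support_dilate bp cos_kernel_lip_support.
have ss := lip_support_dilate bp sin_kernel_lip_support.
have cB u : `|trigtr cos K (b * u)| <= BK by [].
have sB u : `|trigtr sin K (b * u)| <= BK by [].
split.
  have := lip_support_add (quotient_lip_support b'0 C0 BK0 sc cB fc_lip fc_le1)
    (quotient_lip_support b'0 C0 BK0 ss sB fs_lip fs_le1).
  by congr lip_support; apply/funext => u; rewrite /symbol_re mulrDl.
have := lip_support_add (quotient_lip_support b'0 C0 BK0 ss sB fc_lip fc_le1)
  (lip_support_opp (quotient_lip_support b'0 C0 BK0 sc cB fs_lip fs_le1)).
by congr lip_support; apply/funext => u; rewrite /symbol_im mulrBl.
Qed.

(** The cutoff confines frequencies to [[-1, 1]], where [sqmod] has a fixed positive lower bound,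
    and [b <= 1] keeps the dilated transform of [K] Lipschitz with constant [CK]: the resulting
    constant does not depend on [b]. *)
Lemma symbol_cutoff_lip_support b : 0 < b <= 1 ->
  lip_support 1 (symbol_lip 1 (2 * BK + CK) BK) (fun u => cutoff u * symbol_re b u) /\
  lip_support 1 (symbol_lip 1 (2 * BK + CK) BK) (fun u => cutoff u * symbol_im b u).
Proof.
move=> /andP[bp b1].
have C0 : 0 <= 2 * BK + CK by rewrite addr_ge0// mulr_ge0.
have lipb g : lip_support 1 CK g -> forall u v : R, `|u| <= 1 -> `|v| <= 1 ->
    `|g (b * u) - g (b * v)| <= CK * `|u - v|.
  move=> [h _] u v _ _; apply: le_trans (h _ _) _.
  by rewrite -mulrBr normrM (gtr0_norm bp) ler_wpM2l// ler_piMl.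
have mk g : lip_support 1 CK g -> (forall u, `|g u| <= BK) ->
    lip_support 1 (2 * BK + CK) (fun u => cutoff u * g (b * u)).
  move=> sg gB; rewrite -[CK in _ + CK]mul1r.
  apply: (@lip_support_mul _ _ _ _ _ _ _ (fun u => g (b * u))) => //.
  - exact: cutoff_lip_support.
  - exact: cutoff_le1.
  - exact: lipb.
have bd g : (forall u, `|g u| <= BK) -> forall u, `|cutoff u * g (b * u)| <= BK.
  by move=> gB u; rewrite normrM -[leRHS]mul1r; apply: ler_pM => //; exact: cutoff_le1.
have sc := mk _ cos_kernel_lip_support kcB.
have ss := mk _ sin_kernel_lip_support ksB.
split.
  have := lip_support_add (quotient_lip_support ltr01 C0 BK0 sc (bd _ kcB) fc_lip fc_le1)
    (quotient_lip_support ltr01 C0 BK0 ss (bd _ ksB) fs_lip fs_le1).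
  by congr lip_support; apply/funext => u; rewrite /symbol_re mulrA mulrDr mulrDl !mulrA.
have := lip_support_add (quotient_lip_support ltr01 C0 BK0 ss (bd _ ksB) fc_lip fc_le1)
  (lip_support_opp (quotient_lip_support ltr01 C0 BK0 sc (bd _ kcB) fs_lip fs_le1)).
by congr lip_support; apply/funext => u; rewrite /symbol_im; ring.
Qed.

(** Each product in the numerator carries a factor at most [|phi_eps|], which cancels one of the two
    in [sqmod]; the lower bound of the error class controls the other. *)
Lemma symbol_le b u : `|symbol_re b u| <= 2 * BK * L * (1 + `|u|) `^ beta /\
  `|symbol_im b u| <= 2 * BK * L * (1 + `|u|) `^ beta.
Proof.
set n := Num.sqrt (sqmod u).
have n0 : 0 < n by rewrite sqrtr_gt0 sqmod_gt0.
have nE : sqmod u = n ^+ 2 by rewrite sqr_sqrtr// sqmod_ge0.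
have cn : `|fc u| <= n by rewrite -sqrtr_sqr ler_sqrt ?sqmod_ge0// lerDl sqr_ge0.
have sn : `|fs u| <= n by rewrite -sqrtr_sqr ler_sqrt ?sqmod_ge0// lerDr sqr_ge0.
have ninv : n^-1 <= L * (1 + `|u|) `^ beta.
  rewrite -[leRHS]invrK lef_pV2 ?posrE ?invr_gt0 ?mulr_gt0 ?powR_gt0//.
  by apply: le_trans (sqrt_sqmod_ge u); rewrite invfM powRN.
have key (x y p q : R) : `|x| <= BK -> `|y| <= BK -> `|p| <= n -> `|q| <= n ->
    `|(x * p + y * q) / sqmod u| <= 2 * BK * L * (1 + `|u|) `^ beta.
  move=> x1 y1 p1 q1; rewrite nE normrM normfV (ger0_norm (sqr_ge0 n)).
  apply: (@le_trans _ _ (2 * BK * n^-1)); last first.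
    by rewrite -[leRHS]mulrA ler_wpM2l// mulr_ge0.
  have -> : 2 * BK * n^-1 = (BK * n + BK * n) / n ^+ 2 by field; rewrite gt_eqF.
  rewrite ler_wpM2r ?invr_ge0 ?sqr_ge0//; apply: le_trans (ler_normD _ _) _.
  by rewrite !normrM; apply: lerD; apply: ler_pM.
split; first exact: key.
by rewrite /symbol_im -mulrN; apply: key => //; rewrite normrN.
Qed.

End deconvolution_symbol.

(** * Primitives from minus infinity *)

Section rays.
Context (R : realType).
Local Notation mu := (@lebesgue_measure R).
Local Notation int1 g := (mu.-integrable setT (EFin \o g)).
Implicit Types f : R -> R.

Definition ray f (t : R) : R := \int[mu]_(x in `]-oo, t]) f x.

Lemma Rintegral_indic (D : set R) f : measurable D ->
  \int[mu]_x (f x * \1_D x) = \int[mu]_(x in D) f x.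
Proof.
move=> mD; rewrite [RHS]Rintegral_mkcond; apply: eq_Rintegral => x _.
by rewrite patchE indicE; case: ifPn => _; rewrite ?mulr1 ?mulr0.
Qed.

Lemma integrable_indicM (D : set R) f : measurable D -> int1 f ->
  int1 (fun x => f x * \1_D x).
Proof.
move=> mD fi; apply: (@integrable_mulr _ _ R mu setT f (\1_D) 1) => //.
by move=> x _; rewrite ger0_norm ?indicE//; case: (_ \in _).
Qed.

Lemma integrable_on (D : set R) f : measurable D -> int1 f ->
  mu.-integrable D (EFin \o f).
Proof. by move=> mD; apply: integrableS. Qed.

Lemma normr_Rintegral_on (D : set R) f : measurable D -> int1 f ->
  `|\int[mu]_(x in D) f x| <= \int[mu]_x `|f x|.
Proof.
move=> mD fi; rewrite -Rintegral_indic//.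
apply: le_normr_Rintegral_le => //.
- by apply: (@integrable_measurable _ _ _ mu); exact: integrable_indicM.
- move=> x _; rewrite normrM ler_piMr// ger0_norm ?indicE//; by case: (_ \in _).
- exact: integrable_norm.
Qed.

Lemma normr_ray_le f t : int1 f -> `|ray f t| <= \int[mu]_x `|f x|.
Proof. exact: normr_Rintegral_on. Qed.

Lemma ray_sub f a t : int1 f -> a <= t ->
  ray f t - ray f a = \int[mu]_(x in `[a, t]) f x.
Proof.
move=> fi at_; rewrite /ray (@Rintegral_itvB _ f (BInfty _ true) (BRight t) a).
- by rewrite Rintegral_itv_obnd_cbnd//; exact: integrable_on.
- exact: integrable_on.
- by [].
- by [].
Qed.

Let natoo (c M : R) : \forall n \near \oo, M <= n%:R - c.
Proof.
near=> n; rewrite lerBrDr; near: n.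
exact: nbhs_infty_ger.
Unshelve. all: by end_near. Qed.

Lemma ray_cvg0 f (c : R) : int1 f -> ray f (c - n%:R) @[n --> \oo] --> 0.
Proof.
move=> fi; rewrite /ray.
rewrite (_ : (fun n => _) = fun n => \int[mu]_x (f x * \1_(`]-oo, c - n%:R]) x)); last first.
  by apply/funext => n; rewrite Rintegral_indic.
rewrite [X in _ --> X](_ : 0 = \int[mu]_(x in [set: R]) (fun=> 0) x); last first.
  by rewrite Rintegral_cst// mul0r.
have mf : measurable_fun setT f by exact: integrable_measurable fi.
apply: (@Rintegral_cvg _ _ R mu setT _ _ (fun x => `|f x|)) => //.
- by move=> n; apply: measurable_funM => //; exact: measurable_indic.
- move=> x _; apply: (@cvg_trans _ ((fun=> 0 : R) @ \oo)); last exact: cvg_cst.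
  apply: near_eq_cvg; near=> n.
  apply/esym; rewrite indicE memNset ?mulr0//= in_itv/=; apply/negP; rewrite -ltNge.
  have : c - x + 1 <= n%:R - 0 by near: n; exact: natoo.
  by lra.
- exact: integrable_norm.
- by move=> n x _; rewrite normrM ler_piMr// ger0_norm ?indicE//; case: (_ \in _).
Unshelve. all: by end_near. Qed.

Lemma is_derive_ray f (t : R) : int1 f -> {for t, continuous f} ->
  is_derive t 1 (ray f) (f t).
Proof.
move=> fi ct.
have tt1 : t < t + 1 by rewrite ltrDl.
have [|d e] := @continuous_FTC1 R f (BInfty _ true) t (t + 1) tt1
  (integrable_on (measurable_itv _) fi) _ ct; first exact: ltNyr.
by rewrite -e derive1E; exact: derivableP.
Qed.

End rays.

(** * Integrals of powers over symmetric intervals *)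

Section power_integral.
Context (R : realType).
Local Notation mu := (@lebesgue_measure R).
Local Notation int1 g := (mu.-integrable setT (EFin \o g)).

Definition power_mass (e A : R) : R :=
  \int[mu]_u ((1 + `|u|) `^ e * \1_(`[- A, A]) u).

Let one (u : R) : 0 < 1 + `|u|. Proof. by rewrite ltr_wpDr. Qed.

Let cpow (e : R) : continuous (fun u : R => (1 + `|u|) `^ e).
Proof.
move=> u; apply: (@continuous_comp _ _ _ (fun u : R => 1 + `|u|) (fun x => x `^ e)).
  by apply: cvgD; [exact: cvg_cst|exact: norm_continuous].
by have h := is_derive1_powR e (one u); exact: is_derive_continuous h.
Qed.

Let mpow (e : R) : measurable_fun setT (fun u : R => (1 + `|u|) `^ e).
Proof. by apply: continuous_measurable_fun; exact: cpow. Qed.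

Lemma power_mass_integrable (e A : R) : 0 <= A ->
  int1 (fun u => (1 + `|u|) `^ e * \1_(`[- A, A]) u).
Proof.
move=> A0; apply: (@integrable_le _ _ R mu setT _ (fun u => (1 + A) `^ `|e| * \1_(`[- A, A]) u)) => //.
- by apply: measurable_funM; [exact: mpow|exact: measurable_indic].
- move=> u _; rewrite indicE; case: (boolP (u \in _)) => [|_]; last by rewrite !mulr0 normr0.
  rewrite mem_setE in_itv/= -ler_norml => uA; rewrite !mulr1 ger0_norm ?powR_ge0//.
  apply: (@le_trans _ _ ((1 + `|u|) `^ `|e|)).
    by apply: ler_powR; rewrite ?lerDl// ler_norm.
  by apply: ge0_ler_powR; rewrite ?nnegrE ?addr_ge0// lerD2l.
- exact: integrable_itv_cst.
Qed.

Lemma power_mass_le (e A : R) (F : R -> R) : 0 < A ->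
  (forall u : R, 0 <= u -> is_derive u 1 F ((1 + u) `^ e)) ->
  power_mass e A <= 2 * (F A - F 0).
Proof.
(* [[- A, A]] is covered by [[0, A]] and its reflection, so a primitive is needed only on the
   half-line, where [|u| = u]. The point 0 is counted twice, hence an inequality between the
   integrands. *)
move=> A0 dF; pose h u := (1 + `|u|) `^ e * \1_(`[0, A]) u.
have ih : int1 h.
  apply: (@integrable_le _ _ R mu setT _ (fun u => (1 + `|u|) `^ e * \1_(`[- A, A]) u)) => //.
  - by apply: measurable_funM; [exact: mpow|exact: measurable_indic].
  - move=> u _; rewrite /h normrM ger0_norm ?powR_ge0// ler_wpM2l ?powR_ge0// ger0_norm ?indicE//.
    rewrite !mem_setE !in_itv/=; case: (boolP (0 <= u <= A)) => // /andP[u0 uA].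
    by rewrite (le_trans _ u0) ?uA// oppr_le0 ltW.
  - by apply: power_mass_integrable; exact: ltW.
have ih' := integrable_reflection 0 ih.
have -> : 2 * (F A - F 0) = \int[mu]_u h u + \int[mu]_u h (0 - u).
  rewrite Rintegral_reflection// /h Rintegral_indic//.
  suff -> : \int[mu]_(u in `[0, A]) ((1 + `|u|) `^ e) = F A - F 0 by rewrite mulr_natl mulr2n.
  rewrite /Rintegral (@continuous_FTC2 _ _ F)//=.
  - by apply: continuous_subspaceT; exact: cpow.
  - split.
    + move=> y; rewrite in_itv/= => /andP[y0 _]; have h1 := dF y (ltW y0); exact: ex_derive.
    + apply: cvg_at_right_filter; exact: is_derive_continuous (dF 0 (lexx _)).
    + apply: cvg_at_left_filter; exact: is_derive_continuous (dF A (ltW A0)).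
  - move=> y; rewrite in_itv/= => /andP[y0 _].
    by have [_ ->] := is_derive1E (dF y (ltW y0)); rewrite gtr0_norm.
rewrite -RintegralD//; apply: le_Rintegral => //.
- by apply: power_mass_integrable; exact: ltW.
- exact: integrable_add.
- move=> u _; rewrite /h sub0r normrN -mulrDr ler_wpM2l ?powR_ge0//.
  rewrite !indicE !mem_setE !in_itv/= -natrD ler_nat oppr_ge0.
  case: (boolP (- A <= u <= A)) => [/andP[Au ->]|//]; rewrite lerNl Au !andbT.
  by case: (leP 0 u) => // /ltW ->.
Qed.

(** The exponent collects the squares of [(1 + |u|) ^ beta] from the symbol and of [1 / (1 + |u|)]
    from [pseudo_inv]. *)
Definition vmass (beta A : R) : R := power_mass (2 * beta - 2) A.

Let is_derive_1D (u : R) : is_derive u 1 (fun x : R => 1 + x) 1.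
Proof.
have -> : (fun x : R => 1 + x) = shift 1 by apply/funext => x; rewrite /shift addrC.
exact: is_derive_shift.
Qed.

Lemma is_derive_powR1 (p u : R) : 0 <= u ->
  is_derive u 1 (fun x : R => (1 + x) `^ p) (p * (1 + u) `^ (p - 1)).
Proof.
move=> u0; have h : is_derive (1 + u) 1 (fun x : R => x `^ p) (p * (1 + u) `^ (p - 1)).
  by apply: is_derive1_powR; rewrite ltr_pwDl.
have := @is_derive1_comp R (fun x => x `^ p) (fun x : R => 1 + x) u (p * (1 + u) `^ (p - 1)) 1 h.
by rewrite mulr1; apply; exact: is_derive_1D.
Qed.

Lemma vmass_large (beta A : R) : 2^-1 < beta -> 0 < A ->
  vmass beta A <= 2 / (2 * beta - 1) * (1 + A) `^ (2 * beta - 1).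
Proof.
move=> bb A0; have c0 : 0 < 2 * beta - 1 by lra.
apply: le_trans (@power_mass_le _ _ (fun x => (2 * beta - 1)^-1 * (1 + x) `^ (2 * beta - 1)) A0 _) _.
  move=> u u0; have h := is_derive_powR1 (2 * beta - 1) u0.
  apply: is_derive_eq; rewrite /GRing.scale/= mulrA mulVf ?gt_eqF// mul1r.
  by congr (_ `^ _); ring.
have : 0 <= (1 + 0 : R) `^ (2 * beta - 1) by exact: powR_ge0.
have ci : 0 < (2 * beta - 1)^-1 by rewrite invr_gt0.
by move: (_ `^ _) (_ `^ _) (2 * beta - 1)^-1 ci => x y z z0 y0; nra.
Qed.

Lemma vmass_small (beta A : R) : beta < 2^-1 -> 0 < A ->
  vmass beta A <= 2 / (1 - 2 * beta).
Proof.
move=> bb A0; have c0 : 0 < 1 - 2 * beta by lra.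
apply: le_trans (@power_mass_le _ _ (fun x => (2 * beta - 1)^-1 * (1 + x) `^ (2 * beta - 1)) A0 _) _.
  move=> u u0; have h := is_derive_powR1 (2 * beta - 1) u0.
  apply: is_derive_eq; rewrite /GRing.scale/= mulrA mulVf ?mul1r; last by rewrite lt_eqF//; lra.
  by congr (_ `^ _); ring.
rewrite addr0 powR1 -[2 * beta - 1]opprB invrN.
have : 0 <= (1 + A) `^ (- (1 - 2 * beta)) by exact: powR_ge0.
have ci : 0 < (1 - 2 * beta)^-1 by rewrite invr_gt0.
by move: (_ `^ _) (1 - 2 * beta)^-1 ci => x z z0 y0; nra.
Qed.

Lemma vmass_half (A : R) : 0 < A -> vmass 2^-1 A <= 2 * ln (1 + A).
Proof.
move=> A0; have -> : ln (1 + A) = ln (1 + A) - ln (1 + 0) by rewrite addr0 ln1 subr0.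
apply: (@power_mass_le _ _ (fun x => ln (1 + x)) A0) => u u0.
have u1 : 0 < 1 + u by rewrite ltr_pwDl.
have h : is_derive (1 + u) 1 (@ln R) (1 + u)^-1 by exact: is_derive1_ln.
have := @is_derive1_comp R (@ln R) (fun x : R => 1 + x) u (1 + u)^-1 1 h.
have -> : (1 + u) `^ (2 * 2^-1 - 2) = (1 + u)^-1.
  by rewrite mulfV// (_ : 1 - 2 = -1 :> R) ?powR_inv1 ?(ltW u1)//; ring.
by rewrite mulr1; apply; exact: is_derive_1D.
Qed.

End power_integral.

(** * The kernel and its low and high frequencies *)

Section deconvolution_kernel.
Context (R : realType).
Local Notation mu := (@lebesgue_measure R).
Local Notation int1 g := (mu.-integrable setT (EFin \o g)).
Variables (beta L gamma : R) (feps K : R -> R).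
Hypotheses (b0 : 0 < beta) (L0 : 0 < L) (hf : error_class beta L gamma feps).
Hypotheses (iK : int1 K) (iuK : int1 (fun u => `|u| * `|K u|)).
Hypothesis suppK : closure [set u | fourier K u != 0] `<=` `[-1, 1].

Definition dkernel (b : R) : R -> R := ftr (symbol_re feps K b) (symbol_im feps K b).

Definition dprim (b : R) : R -> R := ray (dkernel b).

Definition dlow (b : R) : R -> R :=
  ftr (fun u => cutoff u * symbol_re feps K b u) (fun u => cutoff u * symbol_im feps K b u).

(** The symbol is [i * pseudo_inv u] times that of [dkernel], so that by [is_derive_ftr] the
    derivative has the symbol of [dkernel] multiplied by [1 - cutoff]. *)
Definition dhigh_prim (b : R) : R -> R :=
  ftr (fun u => - (symbol_im feps K b u * pseudo_inv u))
      (fun u => symbol_re feps K b u * pseudo_inv u).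

Let CK := \int[mu]_u (`|u| * `|K u|).
Let BK := \int[mu]_u `|K u|.
Let CK0 : 0 <= CK. Proof. by apply: Rintegral_ge0 => u _; rewrite mulr_ge0. Qed.
Let BK0 : 0 <= BK. Proof. by apply: Rintegral_ge0. Qed.

Let Cb b := symbol_lip beta L b^-1 (b * CK) BK.
Let Cb0 b : 0 < b -> 0 <= Cb b.
Proof.
by move=> bp; apply: addr_ge0; apply: quot_lip_ge0; rewrite ?invr_ge0 ?mulr_ge0 ?(ltW bp).
Qed.

Let Clow := symbol_lip beta L 1 (2 * BK + CK) BK.
Let Clow0 : 0 <= Clow.
Proof.
by apply: addr_ge0; apply: quot_lip_ge0; rewrite ?addr_ge0 ?mulr_ge0.
Qed.

Section fixed_bandwidth.
Variables (b : R) (bp : 0 < b) (b1 : b <= 1).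

Let A0 : 0 < b^-1. Proof. by rewrite invr_gt0. Qed.
Let C0 : 0 <= Cb b. Proof. exact: Cb0. Qed.
Let sre : lip_support b^-1 (Cb b) (symbol_re feps K b).
Proof. exact: (symbol_lip_support b0 L0 hf iK iuK suppK bp).1. Qed.
Let sim : lip_support b^-1 (Cb b) (symbol_im feps K b).
Proof. exact: (symbol_lip_support b0 L0 hf iK iuK suppK bp).2. Qed.
Let lre : lip_support 1 Clow (fun u => cutoff u * symbol_re feps K b u).
Proof. by apply: (symbol_cutoff_lip_support b0 L0 hf iK iuK suppK _).1; rewrite bp. Qed.
Let lim_ : lip_support 1 Clow (fun u => cutoff u * symbol_im feps K b u).
Proof. by apply: (symbol_cutoff_lip_support b0 L0 hf iK iuK suppK _).2; rewrite bp. Qed.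

Let Ch := Cb b * 1 + (2 * b^-1 * Cb b) * 2.
Let Ch0 : 0 <= Ch.
Proof. by rewrite addr_ge0 ?mulr_ge0// ltW. Qed.

Let high_lip g : lip_support b^-1 (Cb b) g -> lip_support b^-1 Ch (fun u => g u * pseudo_inv u).
Proof.
move=> sg; apply: lip_support_mul => //.
- by rewrite !mulr_ge0// ltW.
- exact: lip_support_le.
- by move=> u v _ _; exact: pseudo_inv_lip.
- by move=> u _; exact: pseudo_inv_le1.
Qed.
Let hre := high_lip sre.
Let him := high_lip sim.

Lemma continuous_dkernel : continuous (dkernel b).
Proof. exact: (continuous_ftr A0 C0 sre sim). Qed.

Lemma integrable_dkernel : int1 (dkernel b).
Proof. exact: (ftr_integrable A0 C0 sre sim).1. Qed.

Lemma dkernel_bounded x : `|dkernel b x| <=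
  \int[mu]_u `|symbol_re feps K b u| + \int[mu]_u `|symbol_im feps K b u|.
Proof. exact: (normr_ftr_le A0 C0 sre sim). Qed.

Lemma is_derive_dprim (t : R) : is_derive t 1 (dprim b) (dkernel b t).
Proof. by apply: is_derive_ray; [exact: integrable_dkernel|exact: continuous_dkernel]. Qed.

Lemma continuous_dprim : continuous (dprim b).
Proof. by move=> t; exact: is_derive_continuous (is_derive_dprim t). Qed.

Let integrable_dlow : int1 (dlow b).
Proof. exact: (ftr_integrable ltr01 Clow0 lre lim_).1. Qed.

Lemma is_derive_dhigh_prim (t : R) :
  is_derive t 1 (dhigh_prim b) (dkernel b t - dlow b t).
Proof.
have := is_derive_ftr t (lip_support_integrable A0 Ch0 hre)
  (lip_support_integrable_moment A0 Ch0 hre) (lip_support_integrable A0 Ch0 him)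
  (lip_support_integrable_moment A0 Ch0 him).
rewrite -/(dhigh_prim b) => h.
suff <- : ftr (fun u => u * (symbol_re feps K b u * pseudo_inv u))
  (fun u => u * (symbol_im feps K b u * pseudo_inv u)) t = dkernel b t - dlow b t by exact: h.
rewrite /dkernel /dlow /ftr -mulrBr; congr (_ * _).
have tr e g : trig_kernel e -> lip_support b^-1 (Cb b) g ->
   lip_support 1 Clow (fun u => cutoff u * g u) ->
   trigtr e (fun u => u * (g u * pseudo_inv u)) t =
   trigtr e g t - trigtr e (fun u => cutoff u * g u) t.
  move=> te sg sl; rewrite /trigtr -RintegralB//.
  - by apply: eq_Rintegral => u _; rewrite mulrCA mul_pseudo_inv; ring.
  - by apply: integrable_trig => //; exact: (lip_support_integrable A0 C0 sg).
  - by apply: integrable_trig => //; exact: (lip_support_integrable ltr01 Clow0 sl).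
rewrite (tr cos)//; last exact: trig_kernel_cos.
by rewrite (tr sin)//; [ring|exact: trig_kernel_sin].
Qed.

(** Both sides have the same increments over segments. The constant is fixed at [-oo], where a ray
    integral vanishes by dominated convergence and [dhigh_prim] by the decay of transforms of
    Lipschitz functions. *)
Lemma dprim_decomposition t : dprim b t = ray (dlow b) t + dhigh_prim b t.
Proof.
have id := integrable_sub measurableT integrable_dkernel integrable_dlow.
have seg n : ray (fun x => dkernel b x - dlow b x) t - ray (fun x => dkernel b x - dlow b x) (t - n.+1%:R)
    = dhigh_prim b t - dhigh_prim b (t - n.+1%:R).
  have lt_ : t - n.+1%:R < t by rewrite ltrBlDr ltrDl.
  rewrite ray_sub//; last exact: ltW.
  rewrite /Rintegral (@continuous_FTC2 _ _ (dhigh_prim b))//=.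
  - apply: continuous_subspaceT => x; apply: cvgB; first exact: continuous_dkernel.
    exact: (continuous_ftr ltr01 Clow0 lre lim_).
  - split.
    + by move=> y _; have h := is_derive_dhigh_prim y; exact: ex_derive.
    + by apply: cvg_at_right_filter; exact: is_derive_continuous (is_derive_dhigh_prim _).
    + by apply: cvg_at_left_filter; exact: is_derive_continuous (is_derive_dhigh_prim _).
  - by move=> y _; have [_] := is_derive1E (is_derive_dhigh_prim y).
have l1 : ray (fun x => dkernel b x - dlow b x) t - ray (fun x => dkernel b x - dlow b x) (t - n.+1%:R)
    @[n --> \oo] --> ray (fun x => dkernel b x - dlow b x) t - 0.
  apply: cvgB; first exact: cvg_cst.
  have := ray_cvg0 t id; rewrite -(cvg_shiftS (fun n => ray _ (t - n%:R))); exact.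
have l2 : dhigh_prim b t - dhigh_prim b (t - n.+1%:R) @[n --> \oo] --> dhigh_prim b t - 0.
  apply: cvgB; first exact: cvg_cst.
  have h := ftr_cvgNy A0 Ch0 (lip_support_opp him) hre.
  have hn : t - n.+1%:R @[n --> \oo] --> -oo.
    rewrite (cvg_shiftS (fun n => t - n%:R)).
    apply/cvgrNyPle => M; near=> n; rewrite lerBlDr -lerBlDl; near: n; exact: nbhs_infty_ger.
  exact: (cvg_comp (fun n => t - n.+1%:R) (dhigh_prim b) hn h).
rewrite (funext seg) in l1; have := cvg_unique _ l1 l2; rewrite !subr0 => <- //.
rewrite /dprim /ray RintegralB//; [|exact: integrable_on integrable_dkernel|exact: integrable_on integrable_dlow].
by rewrite addrC subrK.
Unshelve. all: by end_near. Qed.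

(** Bound on the integral of [|dlow b|] from [ftr_integrable] with [A = 1]: a term [8 * Clow ^+ 2]
    from each of the two squared symbols and one more from the second moment. *)
Definition low_bound : R := 24 * Clow ^+ 2 + pi.

Lemma normr_ray_dlow_le t : `|ray (dlow b) t| <= low_bound.
Proof.
apply: le_trans (normr_ray_le _ integrable_dlow) _.
have [_ h] := ftr_integrable ltr01 Clow0 lre lim_; apply: le_trans h _.
have sq g : lip_support 1 Clow g -> \int[mu]_u (g u ^+ 2) <= 8 * Clow ^+ 2.
  move=> sg; have le u := lip_support_le ltr01 Clow0 sg u.
  have [] := @support_integrable R 1 ((2 * 1 * Clow) ^+ 2) (fun u => g u ^+ 2) ler01.
  - by apply: measurable_funX; exact: lip_support_measurable sg.
  - by move=> u u1; rewrite sg.2// expr0n.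
  - by move=> u; rewrite normrX lerXn2r ?nnegrE ?le// !mulr_ge0.
  by move=> _ /le_trans; apply; rewrite le_eqVlt; apply/orP; left; apply/eqP; ring.
have h1 := sq _ lre; have h2 := sq _ lim_; move: h1 h2; rewrite /low_bound.
move: (\int[mu]_u _) (\int[mu]_u _) => I1 I2 h1 h2.
by rewrite lerD2r; move: (Clow ^+ 2) h1 h2 => c; lra.
Qed.

Lemma dprim_sqr_le t : dprim b t ^+ 2 <= 2 * low_bound ^+ 2 + 2 * dhigh_prim b t ^+ 2.
Proof.
rewrite dprim_decomposition.
have : ray (dlow b) t ^+ 2 <= low_bound ^+ 2.
  rewrite -(real_normK (num_real (ray _ _))) lerXn2r ?nnegrE ?normr_ray_dlow_le//.
  by apply: le_trans (normr_ray_dlow_le t).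
move: (ray _ _) (dhigh_prim _ _) (low_bound ^+ 2) => x y z h.
by have := sqr_ge0 (x - y); nra.
Qed.

Let H := 2 * BK * L.
Let H0 : 0 <= H. Proof. by rewrite !mulr_ge0// ltW. Qed.

(** The supremum of each squared symbol times the length [2 / b] of the support: as [b] tends to 0,
    a bound of order [b ^ (- 2 beta - 1)]. *)
Lemma dkernel_sqr_le :
  (\int[mu]_x (dkernel b x ^+ 2)%:E <= (4 * H ^+ 2 * (1 + b^-1) `^ (2 * beta) / b)%:E)%E.
Proof.
apply: le_trans (ftr_sqr_le A0 C0 sre sim) _; rewrite lee_fin.
have one (u : R) : 0 < 1 + `|u| by rewrite ltr_wpDr.
have sq g : lip_support b^-1 (Cb b) g -> (forall u, `|g u| <= H * (1 + `|u|) `^ beta) ->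
    \int[mu]_u (g u ^+ 2) <= 2 * H ^+ 2 * (1 + b^-1) `^ (2 * beta) / b.
  move=> sg gH; have B0 : 0 <= H ^+ 2 * (1 + b^-1) `^ (2 * beta).
    by rewrite mulr_ge0 ?sqr_ge0 ?powR_ge0.
  have [] := @support_integrable R b^-1 (H ^+ 2 * (1 + b^-1) `^ (2 * beta)) (fun u => g u ^+ 2) (ltW A0).
  - by apply: measurable_funX; exact: lip_support_measurable sg.
  - by move=> u u1; rewrite sg.2// expr0n.
  - move=> u; have [bu|ub] := leP b^-1 `|u|; first by rewrite sg.2// expr0n normr0.
    rewrite normrX; apply: (@le_trans _ _ ((H * (1 + `|u|) `^ beta) ^+ 2)).
      by rewrite lerXn2r ?nnegrE// mulr_ge0// powR_ge0.
    rewrite exprMn ler_wpM2l ?sqr_ge0// -powR_mulrn ?powR_ge0// -powRrM (mulrC beta).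
    by apply: ge0_ler_powR; rewrite ?nnegrE ?mulr_ge0 ?addr_ge0 ?(ltW b0) ?(ltW A0)// lerD2l ltW.
  by move=> _ /le_trans; apply; rewrite le_eqVlt; apply/orP; left; apply/eqP; ring.
have h1 := sq _ sre (fun u => (symbol_le L0 hf iK b u).1).
have h2 := sq _ sim (fun u => (symbol_le L0 hf iK b u).2).
apply: le_trans (lerD h1 h2) _.
by rewrite le_eqVlt; apply/orP; left; apply/eqP; field; rewrite gt_eqF.
Qed.

Lemma dhigh_prim_sqr_le :
  (\int[mu]_x (dhigh_prim b x ^+ 2)%:E <= (8 * H ^+ 2 * vmass beta b^-1)%:E)%E.
Proof.
apply: le_trans (ftr_sqr_le A0 Ch0 (lip_support_opp him) hre) _; rewrite lee_fin.
have one (u : R) : 0 < 1 + `|u| by rewrite ltr_wpDr.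
have iv := power_mass_integrable (2 * beta - 2) (ltW A0).
have sq g : lip_support b^-1 (Cb b) g -> (forall u, `|g u| <= H * (1 + `|u|) `^ beta) ->
    \int[mu]_u ((g u * pseudo_inv u) ^+ 2) <= 4 * H ^+ 2 * vmass beta b^-1.
  move=> sg gH; rewrite /vmass /power_mass -RintegralZl//.
  apply: ge0_le_Rintegral => //.
  - apply: measurable_funX; exact: lip_support_measurable (high_lip sg).
  - by move=> u _; exact: sqr_ge0.
  - move=> u _; rewrite indicE; case: (boolP (u \in _)) => [_|]; last first.
      rewrite notin_setE/= in_itv/= -ler_norml => /negP; rewrite -ltNge => Au.
      by rewrite sg.2 ?mul0r ?expr0n ?mulr0// ltW.
    rewrite mulr1 -(real_normK (num_real _)) normrM.
    apply: (@le_trans _ _ ((H * (1 + `|u|) `^ beta * (2 / (1 + `|u|))) ^+ 2)).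
      rewrite lerXn2r ?nnegrE ?mulr_ge0 ?powR_ge0 ?invr_ge0 ?(ltW (one u)) ?(ltW L0)//.
      by apply: ler_pM => //; exact: pseudo_inv_le.
    rewrite powRB; last by apply/implyP => _; rewrite gt_eqF.
    rewrite (mulrC 2 beta) powRrM !powR_mulrn ?powR_ge0 ?(ltW (one u))//.
    by rewrite le_eqVlt; apply/orP; left; apply/eqP; field; rewrite gt_eqF.
  - exact: integrable_scale.
have e : \int[mu]_u ((- (symbol_im feps K b u * pseudo_inv u)) ^+ 2) =
  \int[mu]_u ((symbol_im feps K b u * pseudo_inv u) ^+ 2).
  by apply: eq_Rintegral => u _; rewrite sqrrN.
have h1 := sq _ sre (fun u => (symbol_le L0 hf iK b u).1).
have h2 := sq _ sim (fun u => (symbol_le L0 hf iK b u).2).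
by rewrite e; apply: le_trans (lerD h2 h1) _; rewrite le_eqVlt; apply/orP; left; apply/eqP; ring.
Qed.

End fixed_bandwidth.
End deconvolution_kernel.

(** * Averaging over the errors *)

Section mean_of_primitive.
Context (R : realType).
Local Notation mu := (@lebesgue_measure R).
Local Notation int1 g := (mu.-integrable setT (EFin \o g)).
Variables (beta L gamma : R) (feps K : R -> R).
Hypotheses (b0 : 0 < beta) (L0 : 0 < L) (hf : error_class beta L gamma feps).
Hypotheses (iK : int1 K) (iuK : int1 (fun u => `|u| * `|K u|)).
Hypothesis suppK : closure [set u | fourier K u != 0] `<=` `[-1, 1].
Variables (b : R) (bp : 0 < b).

Local Notation kc := (fun u => trigtr cos K (b * u)).
Local Notation ks := (fun u => trigtr sin K (b * u)).
Local Notation hr := (symbol_re feps K b).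
Local Notation hi := (symbol_im feps K b).
Local Notation fc := (trigtr cos feps).
Local Notation fs := (trigtr sin feps).

Let ifeps : int1 feps.
Proof. by case: hf => /density_integrable[]. Qed.

Let A0 : 0 < b^-1. Proof. by rewrite invr_gt0. Qed.
Let CK := \int[mu]_u (`|u| * `|K u|).
Let BK := \int[mu]_u `|K u|.
Let C0 : 0 <= symbol_lip beta L b^-1 (b * CK) BK.
Proof.
apply: addr_ge0; apply: quot_lip_ge0; rewrite ?invr_ge0 ?mulr_ge0 ?(ltW bp)//; 
  by apply: Rintegral_ge0 => u _; rewrite ?mulr_ge0.
Qed.
Let sre := (symbol_lip_support b0 L0 hf iK iuK suppK bp).1.
Let sim := (symbol_lip_support b0 L0 hf iK iuK suppK bp).2.
Let ire : int1 hr := lip_support_integrable A0 C0 sre.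
Let iim : int1 hi := lip_support_integrable A0 C0 sim.

Let trig_fubini (e : R -> R) (h : R -> R) (x : R) : trig_kernel e -> int1 h ->
  \int[mu]_z (feps z * trigtr e h (x - z)) =
  \int[mu]_u (h u * \int[mu]_z (feps z * e (u * (x - z)))).
Proof.
move=> te ih; have me : measurable_fun setT e.
  by apply: continuous_measurable_fun; exact: trig_continuous te.
apply: (@Rfubini _ _ _ _ R mu mu feps h (fun z => e (z.2 * (x - z.1))) 1 ifeps ih).
  by apply: (measurableT_comp me); apply: measurable_funM => //; exact: measurable_funB.
by move=> z; exact: trig_le1.
Qed.

Let int_cos u : int1 (fun z => feps z * cos (u * z)).
Proof.
have := integrable_trig (trig_kernel_cos R) u ifeps.
by apply: eq_integrable => //= z _; rewrite mulrC (mulrC u) mulrC.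
Qed.

Let int_sin u : int1 (fun z => feps z * sin (u * z)).
Proof.
have := integrable_trig (trig_kernel_sin R) u ifeps.
by apply: eq_integrable => //= z _; rewrite mulrC (mulrC u) mulrC.
Qed.

Let fcE u : \int[mu]_z (feps z * cos (u * z)) = fc u.
Proof. by apply: eq_Rintegral => z _; rewrite (mulrC u). Qed.

Let fsE u : \int[mu]_z (feps z * sin (u * z)) = fs u.
Proof. by apply: eq_Rintegral => z _; rewrite (mulrC u). Qed.

Let cos_shift u x : \int[mu]_z (feps z * cos (u * (x - z))) =
  cos (u * x) * fc u + sin (u * x) * fs u.
Proof.
rewrite -fcE -fsE -!RintegralZl// -RintegralD//; [|exact: integrable_scale..].
by apply: eq_Rintegral => z _; rewrite mulrBr cosB; ring.
Qed.

Let sin_shift u x : \int[mu]_z (feps z * sin (u * (x - z))) =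
  sin (u * x) * fc u - cos (u * x) * fs u.
Proof.
rewrite -fcE -fsE -!RintegralZl// -RintegralB//; [|exact: integrable_scale..].
by apply: eq_Rintegral => z _; rewrite mulrBr sinB; ring.
Qed.

(** Averaging over the error multiplies the symbol by [phi_eps], which cancels the denominator and
    leaves [phi_K (b u)]. *)
Lemma convolution_dkernel (x : R) :
  \int[mu]_z (feps z * dkernel feps K b (x - z)) = ftr kc ks x.
Proof.
have kb (e h : R -> R) : trig_kernel e -> int1 h -> int1 (fun u => `|u| * `|h u|) ->
    int1 (fun z => feps z * trigtr e h (x - z)).
  move=> te ih iuh.
  apply: (@integrable_mulr _ _ R mu setT feps (fun z => trigtr e h (x - z)) (\int[mu]_u `|h u|)) => //.
    have mt : measurable_fun setT (trigtr e h).
      by apply: continuous_measurable_fun; exact: continuous_trigtr.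
    by apply: (measurableT_comp mt); exact: measurable_funB.
  by move=> z _; exact: normr_trigtr_le.
have k1 := kb _ _ (trig_kernel_cos R) ire (lip_support_integrable_moment A0 C0 sre).
have k2 := kb _ _ (trig_kernel_sin R) iim (lip_support_integrable_moment A0 C0 sim).
transitivity ((2 * pi)^-1 * (\int[mu]_z (feps z * trigtr cos hr (x - z)) +
    \int[mu]_z (feps z * trigtr sin hi (x - z)))).
  rewrite -RintegralD// -RintegralZl//; last exact: integrable_add.
  by apply: eq_Rintegral => z _; rewrite /dkernel /ftr -mulrDr mulrCA.
rewrite /ftr; congr (_ * _).
rewrite trig_fubini ?trig_fubini//; [|exact: trig_kernel_sin|exact: trig_kernel_cos].
have lc := lip_support_dilate bp (cos_kernel_lip_support iK iuK suppK).
have ls := lip_support_dilate bp (sin_kernel_lip_support iK iuK suppK).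
have bC0 : 0 <= b * CK.
  by rewrite mulr_ge0 ?(ltW bp)//; apply: Rintegral_ge0 => u _; rewrite mulr_ge0.
have ikc := lip_support_integrable A0 bC0 lc.
have iks := lip_support_integrable A0 bC0 ls.
have bnd (e e' : R -> R) : trig_kernel e -> trig_kernel e' ->
  forall u, `|e (u * x) * trigtr e' feps u| <= \int[mu]_z `|feps z|.
  move=> te te' u; rewrite normrM -[leRHS]mul1r; apply: ler_pM => //; first exact: trig_le1.
  exact: normr_trigtr_le.
have cfc : continuous fc by apply: lipschitz_continuous; exact: (fc_lip b0 L0 hf).
have cfs : continuous fs by apply: lipschitz_continuous; exact: (fs_lip b0 L0 hf).
have mfc : measurable_fun setT fc by exact: continuous_measurable_fun.
have mfs : measurable_fun setT fs by exact: continuous_measurable_fun.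
have mm (e f : R -> R) : trig_kernel e -> measurable_fun setT f -> measurable_fun setT (fun u : R => e (u * x) * f u).
  by move=> te mf; apply: measurable_funM => //; exact: (measurable_trigM te).
have tc := trig_kernel_cos R; have ts := trig_kernel_sin R.
have J (h : R -> R) (e f : R -> R) : int1 h -> trig_kernel e -> (f = cos \/ f = sin) ->
   int1 (fun u => h u * (e (u * x) * trigtr f feps u)).
  move=> ih te ff; have tf : trig_kernel f by case: ff => ->.
  apply: (@integrable_mulr _ _ R mu setT h (fun u => e (u * x) * trigtr f feps u) (\int[mu]_z `|feps z|)) => //.
    by apply: mm => //; case: ff => ->.
  by move=> u _; exact: bnd.
rewrite -!RintegralD//; last 4 first.
- exact: (integrable_trig tc).
- exact: (integrable_trig ts).
- have := integrable_add measurableT (J hr cos cos ire tc (or_introl erefl))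
    (J hr sin sin ire ts (or_intror erefl)).
  by apply: eq_integrable => //= u _; rewrite cos_shift mulrDr.
- have := integrable_sub measurableT (J hi sin cos iim ts (or_introl erefl))
    (J hi cos sin iim tc (or_intror erefl)).
  by apply: eq_integrable => //= u _; rewrite sin_shift mulrBr.
apply: eq_Rintegral => u _; rewrite cos_shift sin_shift /symbol_re /symbol_im /sqmod.
have := sqmod_gt0 L0 hf u; rewrite /sqmod.
move: (fc u) (fs u) (cos (u * x)) (sin (u * x)) (trigtr cos K (b * u)) (trigtr sin K (b * u)).
move=> c s cx sx k1' k2' h; field; by rewrite gt_eqF.
Qed.

Let ik : int1 (dkernel feps K b) := (ftr_integrable A0 C0 sre sim).1.
Let ck : continuous (dkernel feps K b) := continuous_ftr A0 C0 sre sim.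
Let mk : measurable_fun setT (dkernel feps K b).
Proof. exact: continuous_measurable_fun. Qed.

Let i1 (a t : R) : int1 (\1_(`[a, t]) : R -> R).
Proof. exact: integrable_indic_itv. Qed.

Lemma mean_dprim_increment (a t : R) : a < t ->
  \int[mu]_z (feps z * (dprim feps K b (t - z) - dprim feps K b (a - z))) =
  \int[mu]_x (K x * \1_(`[a, t]) (b * x)).
Proof.
move=> at_; rewrite -(inversion_segment iK _ bp
  (cos_kernel_lip_support iK iuK suppK) (sin_kernel_lip_support iK iuK suppK) at_); last first.
  by apply: Rintegral_ge0 => u _; rewrite mulr_ge0.
transitivity (\int[mu]_z (feps z * \int[mu]_y (\1_(`[a, t]) y * dkernel feps K b (y - z)))).
  apply: eq_Rintegral => z _; congr (_ * _); rewrite /dprim ray_sub//; last by rewrite lerD2r ltW.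
  rewrite -Rintegral_indic_itv -(Rintegral_translation (- z)); last first.
    have := integrable_indicM (measurable_itv `[a - z, t - z]) ik.
    by apply: eq_integrable => //= y _; rewrite mulrC.
  by apply: eq_Rintegral => y _; congr (_ * _); rewrite !indicE !mem_setE !in_itv/= !lerD2r.
rewrite (@Rfubini _ _ _ _ R mu mu feps (\1_(`[a, t])) (fun z => dkernel feps K b (z.2 - z.1))
  (\int[mu]_u `|hr u| + \int[mu]_u `|hi u|) ifeps (i1 a t)).
- by apply: eq_Rintegral => y _; rewrite -convolution_dkernel.
- by apply: (measurableT_comp mk); exact: measurable_funB.
- by move=> z; exact: (normr_ftr_le A0 C0 sre sim).
Qed.

(** The left endpoint of [mean_dprim_increment] goes to [-oo], with dominating functions
    proportional to [|feps|] and [|K|]. *)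
Lemma mean_dprim (t : R) : \int[mu]_z (feps z * dprim feps K b (t - z)) =
  \int[mu]_x (K x * \1_(`]-oo, t]) (b * x)).
Proof.
have mK : measurable_fun setT K by exact: integrable_measurable iK.
have mfeps : measurable_fun setT feps by exact: integrable_measurable ifeps.
have md : measurable_fun setT (dprim feps K b).
  apply: continuous_measurable_fun; exact: (continuous_dprim b0 L0 hf iK iuK suppK bp).
have mds (c : R) : measurable_fun setT (fun z : R => dprim feps K b (c - z)).
  by apply: (measurableT_comp md); exact: measurable_funB.
set N := \int[mu]_x `|dkernel feps K b x|.
have dN x : `|dprim feps K b x| <= N by exact: normr_ray_le.
have l1 : \int[mu]_z (feps z * (dprim feps K b (t - z) - dprim feps K b (t - n.+1%:R - z)))
   @[n --> \oo] --> \int[mu]_z (feps z * dprim feps K b (t - z)).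
  apply: (@Rintegral_cvg _ _ R mu setT _ _ (fun z => (N + N) * `|feps z|)) => //.
  - by move=> n; apply: measurable_funM => //; apply: measurable_funB; exact: mds.
  - by apply: measurable_funM; last exact: mds.
  - move=> z _; apply: cvgM; first exact: cvg_cst.
    rewrite -[X in _ --> X]subr0; apply: cvgB; first exact: cvg_cst.
    have := ray_cvg0 (t - z) ik; rewrite -(cvg_shiftS (fun n => ray _ (t - z - n%:R))).
    by under eq_fun do rewrite addrAC.
  - by apply: integrable_scale => //; exact: integrable_norm.
  - move=> n z _; rewrite normrM mulrC ler_wpM2r//; apply: le_trans (ler_normB _ _) _.
    exact: lerD.
have l2 : \int[mu]_x (K x * \1_(`[t - n.+1%:R, t]) (b * x)) @[n --> \oo] -->
    \int[mu]_x (K x * \1_(`]-oo, t]) (b * x)).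
  have mb (D : set R) : measurable D -> measurable_fun setT (fun x : R => \1_D (b * x) : R).
    move=> mD; apply: (@measurableT_comp _ _ _ _ _ _ (\1_D : R -> R)); first exact: measurable_indic.
    exact: measurable_funM.
  apply: (@Rintegral_cvg _ _ R mu setT _ _ (fun x => `|K x|)) => //.
  - by move=> n; apply: measurable_funM => //; exact: mb.
  - by apply: measurable_funM => //; exact: mb.
  - move=> x _; apply: cvgM; first exact: cvg_cst.
    apply: (@cvg_trans _ ((fun=> \1_(`]-oo, t]) (b * x) : R) @ \oo)); last exact: cvg_cst.
    apply: near_eq_cvg; near=> n.
    rewrite !indicE !mem_setE !in_itv/= (_ : t - n.+1%:R <= b * x)//.
    rewrite lerBlDr -lerBlDl; apply: (@le_trans _ _ n%:R); last by rewrite ler_nat.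
    near: n; exact: nbhs_infty_ger.
  - exact: integrable_norm.
  - by move=> n x _; rewrite normrM ler_piMr// ger0_norm ?indicE//; case: (_ \in _).
rewrite (_ : (fun n => _) = fun n => \int[mu]_x (K x * \1_(`[t - n.+1%:R, t]) (b * x))) in l1.
  exact: cvg_unique l1 l2.
by apply/funext => n; rewrite mean_dprim_increment// ltrBlDr ltrDl.
Unshelve. all: by end_near. Qed.

End mean_of_primitive.

(** * Independent samples *)

Section independence.
Context (R : realType) d (T : measurableType d) (P : probability T R).
Implicit Types U V : {mfun T >-> R}.

Lemma integrable_bounded d' (T' : measurableType d') (Q : probability T' R) (h : T' -> R) (M : R) :
  measurable_fun setT h -> (forall x, `|h x| <= M) -> Q.-integrable setT (EFin \o h).
Proof.
move=> mh hM; apply: (@integrable_le _ _ R Q setT h (fun=> M)) => //.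
by apply: finite_measure_integrable_cst.
Qed.

Let pr U V (w : T) : R * R := (U w, V w).
Let mpr U V : measurable_fun setT (pr U V).
Proof. by apply: measurable_fun_pair; exact: measurable_funPT. Qed.

(** A Dynkin argument: independence from [E], known on rectangles, passes to all Borel sets of the
    plane, in particular to events on a sum [U + V]. *)
Lemma indep_extend (E : set T) U V : measurable E ->
  (forall A B : set R, measurable A -> measurable B ->
    P (E `&` (U @^-1` A `&` V @^-1` B)) = (P E * P (U @^-1` A `&` V @^-1` B))%E) ->
  forall C : set (R * R), measurable C ->
    P (E `&` (fun w => (U w, V w)) @^-1` C) = (P E * P ((fun w => (U w, V w)) @^-1` C))%E.
Proof.
move=> mE h C mC.
have mp S : measurable S -> measurable (pr U V @^-1` S).
  by move=> mS; rewrite -[X in measurable X]setTI; exact: mpr.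
pose G : set (set (R * R)) := [set A `*` B | A in measurable & B in measurable].
pose Q : set (set (R * R)) := [set S | P (E `&` pr U V @^-1` S) = (P E * P (pr U V @^-1` S))%E].
have mG := @measurable_prod_measurableType _ _ (measurableTypeR R) (measurableTypeR R).
apply: (@dynkin_induction _ _ G Q mG) => //.
- move=> _ _ [A1 mA1 [B1 mB1 <-]] [A2 mA2 [B2 mB2 <-]].
  exists (A1 `&` A2); first exact: measurableI.
  by exists (B1 `&` B2); [exact: measurableI|rewrite setXI].
- by rewrite /Q /= preimage_setT setIT probability_setT mule1.
- move=> _ [A mA [B mB <-]]; rewrite /Q /=; exact: h.
- move=> S mS; rewrite /Q /= preimage_setC => hS.
  have mpS := mp _ mS.
  rewrite probability_setC//.
  rewrite (_ : E `&` ~` _ = E `\` (E `&` pr U V @^-1` S)); last first.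
    by rewrite setDIr setDv set0U setDE.
  rewrite measureD//; last 2 first.
  + exact: measurableI.
  + by rewrite (le_lt_trans (probability_le1 _ _))// ltry.
  rewrite (setIidr (@subIsetl _ _ _)) [X in (_ - X)%E]hS.
  have fE := fin_num_measure P _ mE; have fS := fin_num_measure P _ mpS.
  by rewrite muleBr ?mule1 ?fin_num_adde_defr// fin_num_adde_defl.
- move=> F mF tF hF; rewrite /Q /= preimage_bigcup setI_bigcupr.
  have tF1 : trivIset setT (fun k => pr U V @^-1` F k).
    by move=> i j _ _ [w [Fi Fj]]; apply: tF => //; exists (pr U V w).
  have tF2 : trivIset setT (fun k => E `&` pr U V @^-1` F k).
    by move=> i j _ _ [w [[_ Fi] [_ Fj]]]; apply: tF => //; exists (pr U V w).
  rewrite !measure_bigcup//; last 2 first.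
  + by move=> k _; exact: mp.
  + by move=> k _; apply: measurableI => //; exact: mp.
  rewrite -[P E in RHS](fineK (fin_num_measure P _ mE)) -nneseriesZl//.
  by apply: eq_eseriesr => k _; rewrite fineK ?fin_num_measure//; exact: hF.
by rewrite -mG.
Qed.

(** The law of an independent pair agrees with the product measure on rectangles, hence everywhere,
    and Fubini applies to the latter. *)
Lemma indep_Rintegral U V (c : R * R -> R) (M : R) :
  (forall A B : set R, measurable A -> measurable B ->
    P (U @^-1` A `&` V @^-1` B) = (P (U @^-1` A) * P (V @^-1` B))%E) ->
  measurable_fun setT c -> (forall z, `|c z| <= M) ->
  \int[P]_w c (U w, V w) =
  \int[distribution P U]_x \int[distribution P V]_y c (x, y).
Proof.
move=> h mc cM; rewrite /Rintegral; congr fine.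
have mec : measurable_fun setT (EFin \o c) by exact/measurable_EFinP.
have ic : P.-integrable setT ((EFin \o c) \o pr U V).
  have := @integrable_bounded _ _ P (c \o pr U V) M.
  apply; last by move=> w; exact: cM.
  exact: (measurableT_comp mc (mpr U V)).
pose prodm := (distribution P U \x distribution P V)%E.
transitivity (\int[prodm]_z (c z)%:E)%E.
  have := @integral_pushforward _ _ _ _ R _ (mpr U V) P setT (EFin \o c) mec.
  rewrite preimage_setT => /(_ ic measurableT) <-.
  apply: eq_measure_integral => A mA _.
  apply/esym; apply: (@product_measure_unique _ _ _ _ R (distribution P U) (distribution P V)
    (measure_function_pushforward__canonical__measure_function_Measure P (mpr U V))) => //.
have ipr : prodm.-integrable setT (EFin \o c).
  have pT : (prodm setT < +oo)%E.
    rewrite -setXTT /prodm product_measure1E//.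
    have pe (Z : {mfun T >-> R}) : distribution P Z setT = 1%E by exact: probability_setT.
    by rewrite [X in (X * _)%E](pe U) [X in (_ * X)%E](pe V) mule1 ltry.
  apply: (measurable_bounded_integrable measurableT pT mc).
  by exists M; split; [exact: num_real|move=> x Mx z _ /=; exact: le_trans (cM z) (ltW Mx)].
rewrite -(integral12_prod_meas1 ipr); apply: eq_integral => x _.
rewrite /fubini_F EFin_Rintegral//.
by apply: (@integrable_bounded _ _ _ _ M) => // y; apply: measurableT_comp => //; exact: measurable_pair1.
Qed.

(** [has_density] speaks of sets only. The law is dominated by Lebesgue measure and its
    Radon-Nikodym derivative has the same integrals over sets as [f], so the two agree almost
    everywhere and the change of variables applies. *)
Lemma density_Rintegral (X : {mfun T >-> R}) (f h : R -> R) (M : R) :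
  @has_density R d T P X f -> is_density f -> measurable_fun setT h -> (forall x, `|h x| <= M) ->
  \int[distribution P X]_x h x = \int[@lebesgue_measure R]_x (f x * h x).
Proof.
move=> hX df mh hM.
pose mu : {sigma_finite_measure set (measurableTypeR R) -> \bar R} := @lebesgue_measure R.
have [fi _] := density_integrable df.
(* [X'] is [X] with the codomain on which [mu] is defined, so that its law and [mu] are measures on
   the same type. *)
have mX : measurable_fun setT (X : T -> measurableTypeR R) by exact: (measurable_funPT X).
pose X' : {mfun T >-> measurableTypeR R} :=
  HB.pack (X : T -> measurableTypeR R) (isMeasurableFun.Build _ _ _ _ _ mX).
pose nu : {finite_measure set (measurableTypeR R) -> \bar R} := distribution P X'.
have iP : P.-integrable setT ((EFin \o h) \o X).
  have := @integrable_bounded _ _ P (h \o X) M.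
  apply; last by move=> w; exact: hM.
  exact: (measurableT_comp mh (measurable_funPT X)).
have meh : measurable_fun setT (EFin \o h) by exact/measurable_EFinP.
have -> : \int[distribution P X]_x h x = \int[nu]_x h x.
  rewrite /Rintegral; congr fine; transitivity (\int[P]_w (h (X w))%:E)%E.
    exact: (integral_distribution meh iP).
  by apply/esym; exact: (@integral_distribution _ _ _ _ _ P X' (EFin \o h) meh iP).
have dom : nu `<< mu.
  apply/null_content_dominatesP => A mA A0.
  have -> : nu A = (\int[mu]_(x in A) (f x)%:E)%E by exact: hX.
  apply: null_set_integral => //; exact: (measurable_int _ (integrable_on mA fi)).
have ih : nu.-integrable setT (EFin \o h).
  by apply: (@integrable_bounded _ _ (distribution P X') h M).
rewrite /Rintegral -(Radon_Nikodym_change_of_variables dom measurableT ih); congr fine.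
pose cnu : {charge set (measurableTypeR R) -> \bar R} := charge_of_finite_measure nu.
have iRN := @Radon_Nikodym_integrable _ _ _ cnu mu dom.
have mRN := measurable_int _ iRN.
have e : ae_eq mu setT (Radon_Nikodym (charge_of_finite_measure nu) mu) (EFin \o f).
  apply: (integral_ae_eq measurableT iRN); first exact: measurable_int fi.
  move=> E _ mE; rewrite -(@Radon_Nikodym_integral _ _ _ cnu mu E dom mE); exact: hX.
apply: ae_eq_integral => //.
- exact: emeasurable_funM.
- apply/measurable_EFinP; apply: measurable_funM => //; exact: integrable_measurable fi.
- by apply: filterS e => x ex _; rewrite ex//= -EFinM mulrC.
Qed.

End independence.

Section mutual_independence.
Context (R : realType) d (T : measurableType d) (P : probability T R).

Lemma Rintegral_probability_cst (c : R) : \int[P]_w c = c.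
Proof.
have h : fine (P setT) = 1 := congr1 fine (probability_setT P).
by rewrite Rintegral_cst// [fine _]h mulr1.
Qed.

Lemma mutually_independent_seq (I : finType) (Z : I -> {mfun T >-> R}) (s : seq I)
    (B : I -> set R) :
  @mutually_independent R d T P I Z -> uniq s -> (forall i, measurable (B i)) ->
  P (\bigcap_(i in [set` s]) (Z i @^-1` B i)) = (\prod_(i <- s) P (Z i @^-1` B i))%E.
Proof.
move=> hZ us mB; pose A i := if i \in s then B i else setT.
have := hZ A; rewrite (_ : \bigcap_i _ = \bigcap_(i in [set` s]) (Z i @^-1` B i)); last first.
  apply/seteqP; split => w h i.
    by move=> si; have := h i Logic.I; rewrite /A /= (_ : i \in s = true).
  by move=> _; rewrite /A /=; case: ifPn => // si; exact: h.
move=> ->; last by move=> i; rewrite /A; case: ifP.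
rewrite [RHS]big_uniq// [RHS]big_mkcond; apply: eq_bigr => i _.
by rewrite /A; case: ifPn => // _; rewrite preimage_setT probability_setT.
Qed.

End mutual_independence.

Section finite_sums.
Context (R : realType) d (T : measurableType d) (m : {measure set T -> \bar R}).

Lemma Rintegral_sum (I : Type) (s : seq I) (h : I -> T -> R) :
  (forall i, m.-integrable setT (EFin \o h i)) ->
  m.-integrable setT (EFin \o (fun w => \sum_(i <- s) h i w)) /\
  \int[m]_w (\sum_(i <- s) h i w) = \sum_(i <- s) \int[m]_w h i w.
Proof.
move=> ih; elim: s => [|i s [IH1 IH2]].
  split; last by rewrite big_nil; under eq_Rintegral do rewrite big_nil;
    rewrite /Rintegral integral0.
  by rewrite (_ : _ \o _ = cst 0%E); [exact: integrable0|apply/funext => w /=; rewrite big_nil].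
have E w : \sum_(j <- i :: s) h j w = h i w + \sum_(j <- s) h j w by rewrite big_cons.
split.
  rewrite (_ : _ \o _ = EFin \o (fun w => h i w + \sum_(j <- s) h j w)).
    exact: integrable_add.
  by apply/funext => w /=; rewrite E.
under eq_Rintegral do rewrite E.
by rewrite big_cons RintegralD// IH2.
Qed.

End finite_sums.

(** * Moments of functions of the observations *)

Section observations.
Context (R : realType) d (T : measurableType d) (P : probability T R).
Local Notation mu := (@lebesgue_measure R).
Variables (n : nat) (X eps : 'I_n -> {mfun T >-> R}) (f feps : R -> R).
Hypotheses (hm : @deconvolution_model R d T P n X eps f feps)
  (df : is_density f) (de : is_density feps).

Let mobs j : measurable_fun setT (fun w => X j w + eps j w).
Proof. by apply: measurable_funD; exact: measurable_funPT. Qed.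

Definition obs j : {mfun T >-> R} :=
  HB.pack (fun w => X j w + eps j w) (isMeasurableFun.Build _ _ _ _ _ (mobs j)).

Let Z (k : 'I_n + 'I_n) : {mfun T >-> R} :=
  match k with inl j => X j | inr j => eps j end.
Let hZ : @mutually_independent R d T P _ Z. Proof. by case: hm. Qed.

Let two j (A B : set R) : measurable A -> measurable B ->
  P (X j @^-1` A `&` eps j @^-1` B) = (P (X j @^-1` A) * P (eps j @^-1` B))%E.
Proof.
move=> mA mB; pose C (k : 'I_n + 'I_n) := match k with inl _ => A | inr _ => B end.
have := @mutually_independent_seq R d T P _ Z [:: inl j; inr j] C hZ.
rewrite !big_cons big_nil mule1 => <- //; last by case.
congr (P _); apply/seteqP; split => w.
  by move=> [h1 h2] k /=; rewrite !inE => /orP[] /eqP ->.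
by move=> h; split; [apply: (h (inl j))|apply: (h (inr j))]; rewrite /= !inE eqxx ?orbT.
Qed.

Let four i j (A B A' B' : set R) : i != j ->
  measurable A -> measurable B -> measurable A' -> measurable B' ->
  P ((X i @^-1` A `&` eps i @^-1` B) `&` (X j @^-1` A' `&` eps j @^-1` B')) =
  (P (X i @^-1` A `&` eps i @^-1` B) * P (X j @^-1` A' `&` eps j @^-1` B'))%E.
Proof.
move=> ij mA mB mA' mB'.
pose C (k : 'I_n + 'I_n) := match k with
  | inl k => if k == i then A else A' | inr k => if k == i then B else B' end.
have ji : (j == i) = false by apply/negbTE; rewrite eq_sym.
have := @mutually_independent_seq R d T P _ Z [:: inl i; inr i; inl j; inr j] C hZ.
rewrite !big_cons big_nil mule1 /C /= !eqxx ji !two// muleA => <- //.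
- congr (P _); apply/seteqP; split => w.
    move=> [[h1 h2] [h3 h4]] k /=; rewrite !inE => /or4P[] /eqP -> /=; by rewrite ?eqxx ?ji.
  move=> h; split; split.
  + have : (Z (inl i) @^-1` C (inl i)) w by apply: h; rewrite /= !inE eqxx.
    by rewrite /C /= eqxx.
  + have : (Z (inr i) @^-1` C (inr i)) w by apply: h; rewrite /= !inE eqxx ?orbT.
    by rewrite /C /= eqxx.
  + have : (Z (inl j) @^-1` C (inl j)) w by apply: h; rewrite /= !inE eqxx ?orbT.
    by rewrite /C /= ji.
  + have : (Z (inr j) @^-1` C (inr j)) w by apply: h; rewrite /= !inE eqxx ?orbT.
    by rewrite /C /= ji.
- have il : (inl i == inl j :> 'I_n + 'I_n) = false by apply/eqP => -[] /eqP; rewrite (negbTE ij).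
  have ir : (inr i == inr j :> 'I_n + 'I_n) = false by apply/eqP => -[] /eqP; rewrite (negbTE ij).
  by rewrite /= !inE il ir.
- by case=> k /=; case: ifP.
Qed.

(** [indep_extend] is used twice, replacing one rectangle at a time by an event on a sum, starting
    from the joint independence of the four variables. *)
Lemma obs_independent i j (A B : set R) : i != j -> measurable A -> measurable B ->
  P (obs i @^-1` A `&` obs j @^-1` B) = (P (obs i @^-1` A) * P (obs j @^-1` B))%E.
Proof.
move=> ij mA mB; pose S (D : set R) := [set z : R * R | D (z.1 + z.2)].
have mS D : measurable D -> measurable (S D).
  move=> mD; rewrite -[S D]setTI.
  have h : measurable_fun setT (fun z : R * R => z.1 + z.2) by exact: measurable_funD.
  exact: h.
have mX k (D : set R) : measurable D -> measurable (X k @^-1` D).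
  by move=> mD; rewrite -[X in measurable X]setTI; exact: (measurable_funPT (X k)).
have me k (D : set R) : measurable D -> measurable (eps k @^-1` D).
  by move=> mD; rewrite -[X in measurable X]setTI; exact: (measurable_funPT (eps k)).
have mo k (D : set R) : measurable D -> measurable (obs k @^-1` D).
  by move=> mD; rewrite -[X in measurable X]setTI; exact: (measurable_funPT (obs k)).
rewrite setIC muleC.
apply: (@indep_extend R d T P (obs j @^-1` B) (X i) (eps i) _ _ (S A)) => //; [exact: mo| |exact: mS].
move=> A1 B1 mA1 mB1; rewrite setIC muleC.
apply: (@indep_extend R d T P (X i @^-1` A1 `&` eps i @^-1` B1) (X j) (eps j) _ _ (S B)) => //.
- by apply: measurableI; [exact: mX|exact: me].
- by move=> A2 B2 mA2 mB2; exact: four.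
- exact: mS.
Qed.

(** Expectation of [phi] at one observation, expressed by the two densities so that it depends
    neither on the index nor on the probability space. *)
Definition law_mean (phi : R -> R) : R :=
  \int[mu]_x (f x * \int[mu]_e (feps e * phi (x + e))).

Lemma obs_mean j (phi : R -> R) (M : R) : measurable_fun setT phi ->
  (forall x, `|phi x| <= M) -> \int[P]_w phi (obs j w) = law_mean phi.
Proof.
move=> mphi phiM; case: hm => hX he _.
have mphi2 : measurable_fun setT (fun z : R * R => phi (z.1 + z.2)).
  by apply: (measurableT_comp mphi); exact: measurable_funD.
rewrite (@indep_Rintegral R d T P (X j) (eps j) (fun z => phi (z.1 + z.2)) M)//; last first.
  by move=> A B; exact: two.
have iM : 0 <= M by apply: le_trans (phiM 0).
have mphix (x : R) : measurable_fun setT (fun y => phi (x + y)).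
  by apply: (measurableT_comp mphi); exact: measurable_funD.
have inner x : \int[distribution P (eps j)]_y phi (x + y) = \int[mu]_e (feps e * phi (x + e)).
  by apply: (@density_Rintegral R d T P (eps j) feps _ M).
pose h x := \int[distribution P (eps j)]_y phi (x + y).
have hM x : `|h x| <= M.
  have := @le_normr_Rintegral_le _ _ R (distribution P (eps j)) setT (fun y => phi (x + y)) (fun=> M)
    measurableT (mphix x) (fun y _ => phiM _).
  rewrite Rintegral_cst// [fine _](_ : _ = 1) ?mulr1; last first.
    exact: (congr1 fine (probability_setT (distribution P (eps j)))).
  by apply; exact: finite_measure_integrable_cst.
have ic Q : (Q : probability R R).-integrable setT (EFin \o (fun=> 1 : R)).
  exact: finite_measure_integrable_cst.
have mh : measurable_fun setT h.
  have := @Rfubini_integrable _ _ _ _ R (distribution P (X j)) (distribution P (eps j))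
    (fun=> 1) (fun=> 1) (fun z => phi (z.1 + z.2)) M (ic _) (ic _) mphi2 (fun z => phiM _).
  move/integrable_measurable; congr (measurable_fun _ _); apply/funext => x.
  by rewrite mul1r; apply: eq_Rintegral => y _; rewrite mul1r.
rewrite (@density_Rintegral R d T P (X j) f h M)//.
by apply: eq_Rintegral => x _; rewrite /h inner.
Qed.

Lemma obs_cov i j (phi : R -> R) (M : R) : i != j -> measurable_fun setT phi ->
  (forall x, `|phi x| <= M) ->
  \int[P]_w (phi (obs i w) * phi (obs j w)) = law_mean phi ^+ 2.
Proof.
move=> ij mphi phiM.
have M0 : 0 <= M by apply: le_trans (phiM 0).
have D k : \int[distribution P (obs k)]_x phi x = law_mean phi.
  rewrite -(obs_mean k mphi phiM) /Rintegral; congr fine.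
  apply: (@integral_distribution _ _ _ _ _ P (obs k) (EFin \o phi)).
    exact/measurable_EFinP.
  apply: (@integrable_bounded _ _ _ P (phi \o obs k) M); last by move=> w; exact: phiM.
  by apply: (measurableT_comp mphi); exact: measurable_funPT.
have iphi k : (distribution P (obs k)).-integrable setT (EFin \o phi).
  exact: (@integrable_bounded _ _ _ _ phi M).
rewrite (@indep_Rintegral R d T P (obs i) (obs j) (fun z => phi z.1 * phi z.2) (M * M)).
- transitivity (\int[distribution P (obs i)]_x (law_mean phi * phi x)).
    apply: eq_Rintegral => x _; transitivity (phi x * \int[distribution P (obs j)]_y phi y).
      exact: (@RintegralZl _ _ R (distribution P (obs j)) setT phi (phi x) measurableT (iphi j)).
    by rewrite D mulrC.
  rewrite expr2 -{3}(D i).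
  exact: (@RintegralZl _ _ R (distribution P (obs i)) setT phi _ measurableT (iphi i)).
- by move=> A B; exact: obs_independent.
- by apply: measurable_funM; exact: measurableT_comp.
- by move=> z; rewrite normrM; apply: ler_pM.
Qed.

(** Centred summands of different indices are uncorrelated, and each variance is at most the second
    moment. *)
Lemma obs_variance (phi : R -> R) (M : R) : (0 < n)%N -> measurable_fun setT phi ->
  (forall x, `|phi x| <= M) ->
  \int[P]_w ((n%:R^-1 * \sum_(j < n) phi (obs j w) - law_mean phi) ^+ 2) <=
  n%:R^-1 * law_mean (fun x => phi x ^+ 2).
Proof.
move=> n0 mphi phiM; set m := law_mean phi.
have nR : (n%:R : R) != 0 by rewrite pnatr_eq0 -lt0n.
pose xi x := phi x - m; pose M' := M + `|m|.
have mxi : measurable_fun setT xi by exact: measurable_funB.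
have xiM x : `|xi x| <= M' by apply: le_trans (ler_normB _ _) _; rewrite lerD2r.
have mo j : measurable_fun setT (obs j) by exact: measurable_funPT.
have ii i j : P.-integrable setT (EFin \o (fun w => xi (obs i w) * xi (obs j w))).
  apply: (@integrable_bounded _ _ _ P _ (M' * M')).
    by apply: measurable_funM; apply: (measurableT_comp mxi).
  by move=> w; rewrite normrM; apply: ler_pM.
have iphi j : P.-integrable setT (EFin \o (fun w => phi (obs j w))).
  apply: (@integrable_bounded _ _ _ P _ M) => //; exact: (measurableT_comp mphi).
have i1 c : P.-integrable setT (EFin \o (fun=> c : R)) by exact: finite_measure_integrable_cst.
have c1 c : \int[P]_w (c : R) = c by exact: Rintegral_probability_cst.
have xi0 : law_mean xi = 0.
  rewrite -(obs_mean (Ordinal n0) mxi xiM) RintegralB//.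
  by rewrite (obs_mean _ mphi phiM) c1 subrr.
have off i j : i != j -> \int[P]_w (xi (obs i w) * xi (obs j w)) = 0.
  by move=> ij; rewrite (obs_cov ij mxi xiM) xi0 expr0n.
have mphi2 : measurable_fun setT (fun x => phi x ^+ 2) by exact: measurable_funX.
have phi2M x : `|phi x ^+ 2| <= M ^+ 2.
  by rewrite normrX lerXn2r ?nnegrE// (le_trans _ (phiM x)).
have diag j : \int[P]_w (xi (obs j w) * xi (obs j w)) <= law_mean (fun x => phi x ^+ 2).
  rewrite -(obs_mean j mphi2 phi2M).
  have iphi2 : P.-integrable setT (EFin \o (fun w => phi (obs j w) ^+ 2)).
    apply: (@integrable_bounded _ _ _ P _ (M ^+ 2)) => //; exact: (measurableT_comp mphi2).
  have -> : \int[P]_w (xi (obs j w) * xi (obs j w)) =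
     \int[P]_w (phi (obs j w) ^+ 2) - m ^+ 2.
    transitivity (\int[P]_w ((phi (obs j w) ^+ 2 + (- 2 * m) * phi (obs j w)) + m ^+ 2)).
      by apply: eq_Rintegral => w _; rewrite /xi; ring.
    rewrite RintegralD//; last by apply: integrable_add => //; exact: integrable_scale.
    rewrite RintegralD//; last exact: integrable_scale.
    by rewrite RintegralZl// (obs_mean j mphi phiM) c1 -/m; ring.
  by rewrite lerBlDr lerDl sqr_ge0.
have E w : (n%:R^-1 * \sum_(j < n) phi (obs j w) - m) ^+ 2 =
    n%:R^-1 ^+ 2 * \sum_(i < n) \sum_(j < n) (xi (obs i w) * xi (obs j w)).
  rewrite -big_distrlr/= -expr2 -exprMn; congr (_ ^+ 2).
  by rewrite /xi sumrB big_const_ord iter_addr_0 mulrBr -[m *+ n]mulr_natl mulKf.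
under eq_Rintegral do rewrite E.
have inner i := Rintegral_sum (index_enum 'I_n) (ii i).
have [iS eS] := Rintegral_sum (index_enum 'I_n) (fun i => (inner i).1).
rewrite RintegralZl// eS.
apply: (@le_trans _ _ (n%:R^-1 ^+ 2 * \sum_(i < n) law_mean (fun x => phi x ^+ 2))).
  rewrite ler_wpM2l ?sqr_ge0//; apply: ler_sum => i _; rewrite (inner i).2.
  rewrite (bigD1 i)//= big1; first by rewrite addr0; exact: diag.
  by move=> j ji; apply: off; rewrite eq_sym.
by rewrite big_const_ord iter_addr_0 -[X in _ * X]mulr_natl mulrA expr2 -[_ * _ * n%:R]mulrA mulVf// mulr1.
Qed.

End observations.

(** * Distribution functions of densities with a local Hölder bound *)

Section taylor.
Context (R : realType).
Implicit Types (G : nat -> R -> R) (c : nat -> R).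

Lemma mean_value_le (g g' : R -> R) (a B : R) (y : R) : g 0 = 0 ->
  (forall t : R, `|t| < a -> is_derive t 1 g (g' t)) -> `|y| < a ->
  (forall t, `|t| <= `|y| -> `|g' t| <= B) -> `|g y| <= B * `|y|.
Proof.
move=> g0 dg ya Bg'.
have dgt (t : R) : `|t| <= `|y| -> derivable g t 1.
  by move=> ty; case: (dg t (le_lt_trans ty ya)).
have [y0|/ltW y0] := leP 0 y.
- have in0 t : t \in `[0, y] -> `|t| <= `|y|.
    by rewrite in_itv/= => /andP[t0 ty]; rewrite !ger0_norm.
  have [| |t /in0 ty] := @MVT_segment R g g' 0 y y0.
  + by move=> t /subset_itv_oo_cc /in0 ty; apply: dg; exact: le_lt_trans ya.
  + by apply: derivable_within_continuous => t /in0; exact: dgt.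
  + by rewrite g0 !subr0 => ->; rewrite normrM ler_wpM2r// Bg'.
- have in0 t : t \in `[y, 0] -> `|t| <= `|y|.
    by rewrite in_itv/= => /andP[ty t0]; rewrite !ler0_norm// lerN2.
  have [| |t /in0 ty] := @MVT_segment R g g' y 0 y0.
  + by move=> t /subset_itv_oo_cc /in0 ty; apply: dg; exact: le_lt_trans ya.
  + by apply: derivable_within_continuous => t /in0; exact: dgt.
  + by rewrite g0 !sub0r -normrN => ->; rewrite normrM normrN ler_wpM2r// Bg'.
Qed.

Definition taylor_sum c (M : nat) (y : R) : R :=
  \sum_(k < M) c k * (k`!%:R^-1 * y ^+ k).

Lemma is_derive_taylor_sum c (M : nat) (y : R) :
  is_derive y 1 (taylor_sum c M.+1) (taylor_sum (fun k => c k.+1) M y).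
Proof.
elim: M => [|M IH].
  rewrite /taylor_sum big_ord0 (_ : (fun y => _) = cst (c 0%N)); last first.
    by apply/funext => z; rewrite big_ord1 expr0 fact0 invr1 !mulr1.
  exact: is_derive_cst.
have -> : taylor_sum c M.+2 = (fun z => taylor_sum c M.+1 z +
    c M.+1 * ((M.+1)`!%:R^-1 * z ^+ M.+1)).
  by apply/funext => z; rewrite /taylor_sum big_ord_recr.
have -> : taylor_sum (fun k => c k.+1) M.+1 y = taylor_sum (fun k => c k.+1) M y +
    c M.+1 * (M`!%:R^-1 * y ^+ M).
  by rewrite /taylor_sum big_ord_recr.
apply: is_deriveD.
have h := is_deriveZ (c M.+1) (is_deriveZ (M.+1)`!%:R^-1 (is_deriveX M.+1 (is_derive_id y (1 : R)))).
suff <- : c M.+1 *: ((M.+1)`!%:R^-1 *: ((M.+1%:R * y ^+ M) *: (1 : R))) = c M.+1 * (M`!%:R^-1 * y ^+ M).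
  rewrite (_ : (fun x : R => _) = c M.+1 \*: ((M.+1)`!%:R^-1 \*: id ^+ M.+1)); first exact: h.
  by apply/funext => x; rewrite /= exprfctE.
rewrite /GRing.scale/= factS natrM.
have : (M`!%:R : R) != 0 by rewrite pnatr_eq0 -lt0n fact_gt0.
have : (M.+1%:R : R) != 0 by rewrite pnatr_eq0.
by move: (M.+1%:R : R) (M`!%:R : R) => u v h1 h2; field; rewrite h1 h2.
Qed.

Lemma taylor_sum0 c (M : nat) : taylor_sum c M.+1 0 = c 0%N.
Proof.
rewrite /taylor_sum big_ord_recl/= expr0 fact0 invr1 !mulr1 big1 ?addr0// => i _.
by rewrite /bump/= add1n expr0n/= !mulr0.
Qed.

(** Induction on [M]: the derivative of the remainder is the remainder of one order less for the
    shifted sequence [G k.+1], and the mean value inequality from 0 adds one factor [|y|]. *)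
Lemma taylor_holder G (M : nat) (eta a L p y : R) : 0 <= p -> 0 <= L ->
  (forall k (x : R), (k < M)%N -> `|x - eta| < a -> is_derive x 1 (G k) (G k.+1 x)) ->
  (forall x, `|x - eta| < a -> `|G M x - G M eta| <= L * `|x - eta| `^ p) ->
  `|y| < a ->
  `|G 0%N (eta + y) - taylor_sum (G ^~ eta) M.+1 y| <= L * (`|y| ^+ M * `|y| `^ p).
Proof.
move=> p0 L0; elim: M G y => [|M IH] G y dG hG ya.
  have := hG (eta + y); rewrite addrC addKr => /(_ ya).
  by rewrite /taylor_sum big_ord1 !expr0 fact0 invr1 !mulr1 mul1r addrC.
pose g t := G 0%N (eta + t) - taylor_sum (G ^~ eta) M.+2 t.
pose g' t := G 1%N (eta + t) - taylor_sum (fun k => G k.+1 eta) M.+1 t.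
have -> : L * (`|y| ^+ M.+1 * `|y| `^ p) = L * (`|y| ^+ M * `|y| `^ p) * `|y|.
  by rewrite exprS; ring.
apply: (@mean_value_le g g' a) => //.
- by rewrite /g addr0 taylor_sum0 subrr.
- move=> t ta; apply: is_deriveB; last exact: is_derive_taylor_sum.
  have d0 := dG 0%N (eta + t) isT; rewrite addrC addKr in d0; have {}d0 := d0 ta.
  have ds : is_derive t 1 (fun s : R => eta + s) 1.
    rewrite -[X in is_derive _ _ _ X]add0r; exact: (is_deriveD (is_derive_cst eta t (1 : R)) (is_derive_id t (1 : R))).
  by have := is_derive1_comp d0 ds; rewrite mulr1; exact.
- move=> t ty; apply: le_trans (IH (fun k => G k.+1) t _ _ (le_lt_trans ty ya)) _.
  + by move=> k x kM; exact: dG.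
  + exact: hG.
  + rewrite ler_wpM2l// ler_pM ?exprn_ge0 ?powR_ge0//.
      by rewrite lerXn2r ?nnegrE.
    by rewrite ge0_ler_powR ?nnegrE.
Qed.

End taylor.

(** * Consequences of a local Hölder bound *)

Section holder.
Context (R : realType).
Local Notation mu := (@lebesgue_measure R).
Implicit Types (g : R -> R) (x l : R).

Lemma is_derive_quotient_on (I : set R) g x l :
  nbhs x I -> quotient_on I g x --> l -> is_derive x 1 g l.
Proof.
move=> Ix hl.
have h : (fun t : R => t^-1 *: (g (t *: 1 + x) - g x)) @ 0^' --> l.
  apply/cvgrPdist_lt => e e0.
  move/cvgrPdist_lt : hl => /(_ e e0) hx.
  have {}hx : nbhs x (fun y => y != x -> I y -> `|l - (g y - g x) / (y - x)| < e) by exact: hx.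
  have [d d0 hd] := (nbhs_ballP _ _).1 (filterI hx Ix).
  apply: (nbhs_ballP _ _).2; exists d => //= t; rewrite /ball/= sub0r normrN => td t0.
  have [] := hd (t + x); first by rewrite /ball/= opprD addrCA subrr addr0 normrN.
  rewrite /GRing.scale/= mulr1 => h1 h2.
  have := h1 _ h2; rewrite addrK mulrC; apply.
  by apply: contra t0 => /eqP h3; apply/eqP; rewrite -(addrK x t) h3 subrr.
apply: DeriveDef; first by apply/cvg_ex; exists l.
exact: cvg_lim h.
Qed.

Lemma lebesgue_measure_gt0 : (0 < mu setT)%E.
Proof.
apply: (@lt_le_trans _ _ (mu (ball (0 : R) 1))); last by apply: le_measure; rewrite ?inE//; exact: measurable_ball.
by rewrite lebesgue_measure_ball// lte_fin mulr2n addr_gt0.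
Qed.

Lemma Lnorm_oo_ae (h : R -> \bar R) (L : R) : ('N[mu]_+oo [h] <= L%:E)%E ->
  {ae mu, forall x, (`|h x| <= L%:E)%E}.
Proof. by rewrite unlock lebesgue_measure_gt0 => /ess_supP. Qed.

(** The Hölder norm bounds derivatives only almost everywhere. A strict violation at [x] would
    persist on a ball, which has positive measure. *)
Lemma ae_le_continuous (I : set R) g x (L : R) : nbhs x I -> {for x, continuous g} ->
  {ae mu, forall y, I y -> `|g y| <= L} -> `|g x| <= L.
Proof.
move=> Ix cg [N [mN N0 hN]]; rewrite leNgt; apply/negP => Lg.
have : nbhs x [set y | L < `|g y|].
  have h : `|g y| @[y --> x] --> `|g x| by apply: cvg_norm; exact: cg.
  exact: (cvgr_gt _ h).
move=> /(filterI Ix) h; have [d d0 hd] := (nbhs_ballP _ _).1 h.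
have : (mu (ball x d) <= mu N)%E.
  apply: le_measure; rewrite ?inE//; first exact: measurable_ball.
  by move=> y /hd[Iy Ly]; apply: hN => /(_ Iy); rewrite leNgt Ly.
rewrite N0 lebesgue_measure_ball; last exact: ltW.
by apply/negP; rewrite -ltNge lte_fin mulr2n addr_gt0.
Qed.

Variables (q zeta alpha L : R) (f : R -> R).
Hypotheses (zeta0 : 0 < zeta) (alpha0 : 0 < alpha)
  (hf : holder_ball `[q - zeta, q + zeta] alpha L f).
Local Notation I := `[q - zeta, q + zeta]%classic.
Local Notation m := (strict_floor alpha).
Local Notation D k := (iter k (derive_on I) f).

Let inI x : `|x - q| <= zeta -> I x.
Proof. by rewrite ler_distl /= in_itv. Qed.

Let nbhsI x : `|x - q| < zeta -> nbhs x I.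
Proof.
rewrite ltr_distl => /andP[h1 h2]; apply: (@filterS _ _ _ `]q - zeta, q + zeta[%classic).
  exact: subset_itv_oo_cc.
by apply: open_nbhs_nbhs; split; [exact: itv_open|rewrite /= in_itv/= h1].
Qed.

(** Each term of the norm is nonnegative, so each is at most [L]. Nonnegativity of the supremum is
    read off the pair [q], [q + zeta]. *)
Let holder_parts : [/\ (forall k, (k <= m)%N -> ('N[mu]_+oo [(EFin \o D k) \_ I] <= L%:E)%E) &
  forall x y, I x -> I y -> x != y -> `|D m x - D m y| / `|x - y| `^ (alpha - m%:R) <= L].
Proof.
case: hf => _ _ _; rewrite /holder_norm; set S := [set _ | _ in _]; set s := (\sum_(_ <= _ < _) _)%E.
have inS x y : I x -> I y -> x != y ->
    S (`|D m x - D m y| / `|x - y| `^ (alpha - m%:R))%:E.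
  by move=> Ix Iy xy; exists (x, y).
have S0 : (0 <= ereal_sup S)%E.
  apply: (@le_trans _ _ (`|D m q - D m (q + zeta)| / `|q - (q + zeta)| `^ (alpha - m%:R))%:E).
    by rewrite lee_fin divr_ge0// powR_ge0.
  apply: ereal_sup_ubound; apply: inS.
  - by apply: inI; rewrite subrr normr0 ltW.
  - by apply: inI; rewrite addrC addKr gtr0_norm.
  - by rewrite -subr_eq0 opprD addNKr oppr_eq0 gt_eqF.
have s0 : (0 <= s)%E by apply: sume_ge0 => k _; exact: Lnorm_ge0.
move=> h; split => [k km|x y Ix Iy xy].
  apply: le_trans h; rewrite /s big_mkord (bigD1 (Ordinal (km : (k < m.+1)%N)))//=.
  rewrite -addeA leeDl// adde_ge0//.
  by apply: sume_ge0 => j _; exact: Lnorm_ge0.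
rewrite -lee_fin; apply: le_trans h; apply: le_trans (leeDr _ s0).
by apply: ereal_sup_ubound; exact: inS.
Qed.

Lemma holder_is_derive k x : (k < m)%N -> `|x - q| < zeta ->
  is_derive x 1 (D k) (D k.+1 x).
Proof.
move=> km xq; case: hf => _ _ hd _.
apply: is_derive_quotient_on (nbhsI xq) _.
apply: hd km _ _; apply: inI; exact: ltW.
Qed.

Let p0 : 0 < alpha - m%:R.
Proof. by have /andP[h _] := strict_floorP alpha0; rewrite subr_gt0. Qed.

Lemma holder_top x y : `|x - q| <= zeta -> `|y - q| <= zeta ->
  `|D m x - D m y| <= L * `|x - y| `^ (alpha - m%:R).
Proof.
move=> xq yq; have [->|xy] := eqVneq x y.
  by rewrite !subrr !normr0 powR0 ?mulr0// gt_eqF.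
have [_ /(_ x y (inI xq) (inI yq) xy)] := holder_parts.
by rewrite ler_pdivrMr// powR_gt0// normr_gt0 subr_eq0.
Qed.

Lemma holder_continuous k x : (k <= m)%N -> `|x - q| < zeta -> {for x, continuous (D k)}.
Proof.
rewrite leq_eqVlt => /orP[/eqP ->|km] xq; last first.
  by apply/differentiable_continuous/derivable1_diffP; case: (holder_is_derive km xq).
have L0 : 0 <= L.
  have [_ /(_ q (q + zeta))] := holder_parts.
  move=> h; apply: le_trans (h _ _ _).
  - by rewrite divr_ge0// powR_ge0.
  - by apply: inI; rewrite subrr normr0 ltW.
  - by apply: inI; rewrite addrC addKr gtr0_norm.
  - by rewrite -subr_eq0 opprD addNKr oppr_eq0 gt_eqF.
apply/cvgrPdist_lt => e e0.
(* Chosen so that [L * d ^ (alpha - m) = L * e / (L + 1) < e]; the [+ 1] covers [L = 0]. *)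
pose d := (e / (L + 1)) `^ (alpha - m%:R)^-1.
have eL : 0 < e / (L + 1) by rewrite divr_gt0// ltr_wpDl.
have d0 : 0 < d by rewrite powR_gt0.
near=> y.
have yd : `|x - y| < d by near: y; exact: cvgr_dist_lt.
have yI : I y by near: y; exact: nbhsI.
apply: le_lt_trans (holder_top _ _) _; [exact: ltW|by move: yI; rewrite /= in_itv/= -ler_distl|].
apply: (@le_lt_trans _ _ (L * (e / (L + 1)))).
  rewrite ler_wpM2l// (_ : e / (L + 1) = d `^ (alpha - m%:R)); last first.
    by rewrite -powRrM mulVf ?gt_eqF// powRr1 ?ltW.
  by rewrite ge0_ler_powR ?nnegrE// ltW.
rewrite mulrCA gtr_pMr// ltr_pdivrMr ?ltr_wpDl// mul1r ltrDl//.
Unshelve. all: by end_near.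
Qed.

Lemma holder_bounded k x : (k <= m)%N -> `|x - q| < zeta -> `|D k x| <= L.
Proof.
move=> km xq; apply: (@ae_le_continuous I) (nbhsI xq) (holder_continuous km xq) _.
have [/(_ k km)/Lnorm_oo_ae h _] := holder_parts.
case: h => N [mN N0 hN]; exists N; split => // y hy; apply: hN; apply: contra_not hy => h Iy.
by move: h; rewrite /= patchE mem_set.
Qed.

End holder.

Section distribution_functions.
Context (R : realType).
Local Notation mu := (@lebesgue_measure R).
Local Notation int1 g := (mu.-integrable setT (EFin \o g)).
Variables (f : R -> R).
Hypothesis df : is_density f.

Let fi : int1 f. Proof. by have [] := density_integrable df. Qed.
Let f0 x : 0 <= f x. Proof. by case: df. Qed.
Let mf : measurable_fun setT f. Proof. by case: df. Qed.

Lemma cdf_ge0_le1 t : 0 <= ray f t <= 1.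
Proof.
apply/andP; split; first exact: Rintegral_ge0.
have [_ <-] := density_integrable df.
apply: le_trans (ler_norm _) _; apply: le_trans (normr_ray_le t fi) _.
rewrite le_eqVlt; apply/orP; left; apply/eqP.
by apply: eq_Rintegral => x _; rewrite ger0_norm.
Qed.

Lemma density_weight_le (L : R) (g : R -> R) :
  ('N[mu]_+oo [EFin \o f] <= L%:E)%E -> measurable_fun setT g -> (forall x, 0 <= g x) ->
  int1 g -> int1 (fun x => f x * g x) /\ \int[mu]_x (f x * g x) <= L * \int[mu]_x g x.
Proof.
move=> fL mg g0 ig; have hL := Lnorm_oo_ae fL.
have L0 : 0 <= L by rewrite -lee_fin; apply: le_trans fL; exact: Lnorm_ge0.
have iLg : int1 (fun x => L * g x) by exact: integrable_scale.
have mfg : measurable_fun setT (fun x => f x * g x) by exact: measurable_funM.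
rewrite -RintegralZl//; apply: ge0_integrable_of_le => //.
  by move=> x _; rewrite mulr_ge0.
rewrite EFin_Rintegral//; apply: ae_ge0_le_integral => //.
- by move=> x _; rewrite lee_fin mulr_ge0.
- exact/measurable_EFinP.
- by move=> x _; rewrite lee_fin mulr_ge0.
- by apply/measurable_EFinP; exact: measurable_funM.
- case: hL => N [mN N0 hN]; exists N; split => // x hx; apply: hN; apply: contra_not hx => h _.
  by rewrite lee_fin ler_wpM2r//; apply: le_trans (ler_norm _) _; rewrite -lee_fin.
Qed.

Lemma cdf_increment_ge (c s t : R) : s <= t -> 0 <= c -> (forall x, s <= x <= t -> c <= f x) ->
  c * (t - s) <= ray f t - ray f s.
Proof.
move=> st c0 hc; rewrite ray_sub// -Rintegral_indic// -Rintegral_itv_cst//.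
apply: le_Rintegral => //; [exact: integrable_itv_cst|exact: integrable_indicM|].
move=> x _; rewrite indicE; have [|_] := boolP (x \in _); last by rewrite !mulr0.
by rewrite inE/= in_itv/= => h; rewrite !mulr1 hc.
Qed.

Lemma cdf_le s t : s <= t -> ray f s <= ray f t.
Proof.
move=> st; rewrite -subr_ge0; have := @cdf_increment_ge 0 s t st (lexx _) (fun x _ => f0 x).
by rewrite mul0r.
Qed.

Lemma cdf_lipschitz (L : R) : ('N[mu]_+oo [EFin \o f] <= L%:E)%E ->
  forall s t, `|ray f s - ray f t| <= L * `|s - t|.
Proof.
move=> fL s t; wlog ts : s t / t <= s.
  move=> H; have [|/ltW] := leP t s; first exact: H.
  by move=> st; rewrite distrC [`|s - t|]distrC; exact: H.
rewrite !ger0_norm ?subr_ge0//; last exact: cdf_le.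
rewrite ray_sub// -Rintegral_indic//.
have ii := integrable_itv_cst t s 1.
have e : (fun x => 1 * \1_(`[t, s]) x) = \1_(`[t, s]) :> (R -> R) by apply/funext => x; rewrite mul1r.
rewrite e in ii.
have [||_] := density_weight_le fL _ _ ii; [exact: measurable_indic|by move=> x; rewrite indicE|].
by rewrite -[\int[mu]_x \1_(_) x]/(\int[mu]_x (\1_(`[t, s]) : R -> R) x) -e Rintegral_itv_cst// mul1r.
Qed.

(** Inside the radius [delta] the distribution function grows at rate [c]; beyond it, monotonicity
    keeps the gain [c * delta], whence the minimum. *)
Lemma cdf_gap (c delta q s : R) : 0 <= c -> 0 <= delta ->
  (forall x, `|x - q| <= delta -> c <= f x) ->
  c * Num.min `|s - q| delta <= `|ray f s - ray f q|.
Proof.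
move=> c0 d0 hc; pose u := Num.min `|s - q| delta; rewrite -/u.
have u0 : 0 <= u by rewrite le_min normr_ge0.
have ud : u <= delta by rewrite ge_min lexx orbT.
have us : u <= `|s - q| by rewrite ge_min lexx.
clearbody u.
have [qs|/ltW sq] := leP q s.
- rewrite ger0_norm in us; last by rewrite subr_ge0.
  rewrite ger0_norm; last by rewrite subr_ge0 cdf_le.
  apply: le_trans (_ : ray f (q + u) - ray f q <= _); last by rewrite lerD2r cdf_le// -lerBrDl.
  have := @cdf_increment_ge c q (q + u); rewrite (_ : q + u - q = u); last by ring.
  apply => //; first by rewrite lerDl.
  move=> x /andP[qx xu]; apply: hc; rewrite ger0_norm ?subr_ge0//.
  by apply: le_trans ud; rewrite lerBlDl.
- rewrite distrC ger0_norm in us; last by rewrite subr_ge0.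
  rewrite distrC ger0_norm; last by rewrite subr_ge0 cdf_le.
  apply: le_trans (_ : ray f q - ray f (q - u) <= _); last by rewrite lerD2l lerN2 cdf_le// lerBrDr -lerBrDl.
  have := @cdf_increment_ge c (q - u) q; rewrite (_ : q - (q - u) = u); last by ring.
  apply => //; first by rewrite gerBl.
  move=> x /andP[xu xq]; apply: hc; rewrite ler0_norm ?subr_le0// opprB.
  by move: xu ud; lra.
Qed.

End distribution_functions.

(** * Uniform properties of the density class *)

Section density_class.
Context (R : realType).
Local Notation mu := (@lebesgue_measure R).
Local Notation int1 g := (mu.-integrable setT (EFin \o g)).
Variables (tau alpha L r zeta : R).
Hypotheses (alpha0 : 0 < alpha) (L0 : 0 < L) (r0 : 0 < r) (zeta0 : 0 < zeta).
Local Notation m := (strict_floor alpha).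
Local Notation I q := `[q - zeta, q + zeta]%classic.

(** The radius depends on the class only. If [m = 0] the Hölder bound keeps [f] within [r / 2] of
    [f q]; if [m > 0] the first derivative is bounded by [L] and the mean value inequality does the
    same. The cap [zeta / 2] leaves room for Taylor expansions around the points of the smaller
    interval. *)
Lemma holder_radius : exists2 delta, 0 < delta <= zeta / 2 &
  forall q (f : R -> R), holder_ball (I q) alpha L f -> r <= f q ->
  forall x, `|x - q| <= delta -> r / 2 <= f x.
Proof.
have p0 : 0 < alpha - m%:R by have /andP[h _] := strict_floorP alpha0; rewrite subr_gt0.
have rL : 0 < r / 2 / L by rewrite !divr_gt0.
suff [d d0 hd] : exists2 d, 0 < d & forall q (f : R -> R), holder_ball (I q) alpha L f ->
    forall x, `|x - q| <= Num.min (zeta / 2) d -> `|f x - f q| <= r / 2.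
  exists (Num.min (zeta / 2) d); first by rewrite lt_min divr_gt0// d0 ge_min lexx.
  move=> q f hf rf x /(hd _ _ hf); rewrite ler_distl => /andP[h _]; apply: le_trans h.
  by move: rf; lra.
have inz d (x q : R) : `|x - q| <= Num.min (zeta / 2) d -> `|x - q| < zeta /\ `|x - q| <= d.
  by rewrite le_min => /andP[h1 ->]; split => //; move: h1 zeta0; lra.
have [m0|m0] := posnP m.
- exists ((r / 2 / L) `^ alpha^-1); first exact: powR_gt0.
  move=> q f hf x /inz[xq xd].
  have := holder_top zeta0 alpha0 hf (ltW xq) (_ : `|q - q| <= zeta).
  rewrite subrr normr0 m0 subr0 /= => /(_ (ltW zeta0)) h; apply: le_trans h _.
  rewrite -ler_pdivlMl// mulrC; apply: (@le_trans _ _ (((r / 2 / L) `^ alpha^-1) `^ alpha)).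
    by rewrite ge0_ler_powR ?nnegrE ?powR_ge0// ltW.
  by rewrite -powRrM mulVf ?gt_eqF// powRr1// ltW.
- exists (r / 2 / L) => // q f hf x /inz[xq xd].
  have := @mean_value_le R (fun t => f (q + t) - f q) (fun t => iter 1 (derive_on (I q)) f (q + t))
    zeta L (x - q) _ _ xq _.
  rewrite (_ : q + (x - q) = x); [|by ring] => h; apply: le_trans (h _ _ _) _.
  + by rewrite addr0 subrr.
  + move=> t tz.
    have d0 := holder_is_derive hf m0 (_ : `|(q + t) - q| < zeta).
    rewrite addrC addKr in d0; have {}d0 := d0 tz.
    have ds : is_derive t 1 (fun s : R => q + s) 1.
      rewrite -[X in is_derive _ _ _ X]add0r; exact: (is_deriveD (is_derive_cst q t (1 : R)) (is_derive_id t (1 : R))).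
    have := is_derive1_comp d0 ds; rewrite mulr1 => d1.
    by have := is_deriveB d1 (is_derive_cst (f q) t (1 : R)); rewrite subr0; exact.
  + move=> t tx; apply: (holder_bounded zeta0 alpha0 hf) => //.
    by rewrite addrC addKr; apply: le_lt_trans xq.
  + by rewrite -ler_pdivlMl// mulrC.
Qed.

(** The class only asserts that some quantile has the local properties. Around it [f >= r / 2], so
    the distribution function is strictly increasing across it and no other point is a
    [tau]-quantile. *)
Lemma density_class_quantile (U q : R) f : density_class tau alpha L r zeta U f ->
  is_quantile tau f q -> [/\ q \in `[- U, U], holder_ball (I q) alpha L f & r <= f q].
Proof.
case=> df _ [q' [hq' q'U hf rf]] hq; suff -> : q = q' by [].
have [d /andP[d0 _] hd] := holder_radius.
have r2 : 0 < r / 2 by exact: divr_gt0.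
have := cdf_gap df q (ltW r2) (ltW d0) (hd _ _ hf rf).
rewrite (_ : ray f q = ray f q'); last by rewrite [LHS]hq [RHS]hq'.
rewrite subrr normr0 pmulr_rle0//.
by rewrite ge_min [d <= 0]leNgt d0 orbF normr_le0 subr_eq0 => /eqP.
Qed.

Let z := zeta / 2.
Let z0 : 0 < z. Proof. exact: divr_gt0. Qed.
Let B := (1 + L) * m.+2%:R * (1 + z) ^+ m.+2.
Let B0 : 0 <= B.
Proof.
have z1 : 0 <= 1 + z by rewrite addr_ge0// ltW.
have L1 : 0 <= 1 + L by rewrite addr_ge0// ltW.
by rewrite /B mulr_ge0 ?exprn_ge0// mulr_ge0.
Qed.
Let B1 : 0 <= (1 + B) * z^-1 `^ (alpha + 1).
Proof. by rewrite mulr_ge0 ?powR_ge0// addr_ge0. Qed.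

Definition cdf_taylor_cst : R := L + (1 + B) * z^-1 `^ (alpha + 1).

Lemma cdf_taylor_cst_ge0 : 0 <= cdf_taylor_cst.
Proof.
by rewrite /cdf_taylor_cst addr_ge0// ltW.
Qed.

(** The kernel is not assumed compactly supported, so the expansion must hold for every [y]. For
    [|y| < z] it is [taylor_holder]; for [|y| >= z] the distribution function is at most 1 and the
    polynomial has [m.+2] terms with derivatives at most [1 + L], all absorbed by a multiple of
    [(|y| / z) ^ (alpha + 1) >= 1]. *)
Lemma cdf_taylor q f : is_density f -> holder_ball (I q) alpha L f ->
  forall eta, `|eta - q| <= z -> exists2 c : nat -> R, c 0%N = ray f eta &
  forall y, `|ray f (eta + y) - taylor_sum c m.+2 y| <= cdf_taylor_cst * `|y| `^ (alpha + 1).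
Proof.
move=> df hf eta eq; have /andP[ma _] := strict_floorP alpha0.
pose G k := if k is k'.+1 then iter k' (derive_on (I q)) f else ray f.
have [fi _] := density_integrable df.
have near (x : R) : `|x - eta| < z -> `|x - q| < zeta.
  move=> h; have -> : x - q = (x - eta) + (eta - q) by ring.
  by apply: le_lt_trans (ler_normD _ _) _; move: h eq; rewrite /z; lra.
have a1 : alpha + 1 != 0 by rewrite gt_eqF// addr_gt0.
exists (G ^~ eta) => // y; have [yz|zy] := ltP `|y| z.
  apply: le_trans (_ : L * (`|y| ^+ m.+1 * `|y| `^ (alpha - m%:R)) <= _).
    apply: (@taylor_holder R G m.+1 eta z L (alpha - m%:R) y) => //.
    - by rewrite subr_ge0 ltW.
    - exact: ltW.
    - move=> [|k] x km /near xq.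
        by apply: is_derive_ray => //; exact: (holder_continuous zeta0 alpha0 hf (leq0n _) xq).
      exact: (holder_is_derive hf km xq).
    - move=> x /near xq; apply: (holder_top zeta0 alpha0 hf); first exact: ltW.
      by apply: le_trans eq _; rewrite /z; move: zeta0; lra.
  rewrite (_ : `|y| ^+ _ * _ = `|y| `^ (alpha + 1)); last first.
    have e : alpha + 1 = m.+1%:R + (alpha - m%:R) by rewrite -natr1; ring.
    by rewrite e [RHS]powRD ?powR_mulrn// -e (negbTE a1).
  by rewrite ler_wpM2r ?powR_ge0// lerDl.
have yz1 : 1 <= `|y| * z^-1 by rewrite ler_pdivlMr// mul1r.
have W1 : 1 <= (`|y| * z^-1) `^ (alpha + 1).
  by rewrite -[leLHS](powRr0 (`|y| * z^-1)) ler_powR// ltW// addr_gt0.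
have pk k : (k < m.+2)%N -> `|y| ^+ k <= (1 + z) ^+ m.+2 * (`|y| * z^-1) `^ (alpha + 1).
  move=> km; have -> : `|y| ^+ k = z ^+ k * (`|y| * z^-1) ^+ k.
    by rewrite -exprMn mulrCA mulfV ?mulr1// gt_eqF.
  have zp : 0 <= z by exact: ltW.
  apply: ler_pM; [exact: exprn_ge0|by rewrite exprn_ge0// mulr_ge0// invr_ge0| |].
    apply: (@le_trans _ _ ((1 + z) ^+ k)).
      by rewrite lerXn2r ?nnegrE ?addr_ge0 ?lerDr.
    by apply: ler_weXn2l; [rewrite lerDl|exact: ltnW].
  rewrite -powR_mulrn; last by rewrite mulr_ge0// invr_ge0.
  rewrite ler_powR//.
  move: km; rewrite ltnS -(ler_nat R) -natr1 => km; apply: le_trans km _.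
  by rewrite lerD2r ltW.
have Gk k : (k < m.+2)%N -> `|G k eta| <= 1 + L.
  case: k => [_|k km] /=.
    by have /andP[h0 h1] := cdf_ge0_le1 df eta; rewrite ger0_norm// ler_wpDr// ltW.
  apply: le_trans (holder_bounded zeta0 alpha0 hf _ _) _ => //; last by rewrite lerDr.
  by apply: near; rewrite subrr normr0.
apply: le_trans (_ : (1 + B) * (`|y| * z^-1) `^ (alpha + 1) <= _); last first.
  rewrite powRM ?invr_ge0 ?(ltW z0)// mulrCA mulrC ler_wpM2r ?powR_ge0//.
  by rewrite lerDr ltW.
apply: le_trans (ler_normB _ _) _; rewrite mulrDl mul1r; apply: lerD.
  have /andP[h0 h1] := cdf_ge0_le1 df (eta + y).
  by rewrite ger0_norm//; apply: le_trans W1.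
rewrite /taylor_sum; apply: le_trans (ler_norm_sum _ _ _) _.
apply: le_trans (_ : \sum_(i < m.+2) ((1 + L) * ((1 + z) ^+ m.+2 * (`|y| * z^-1) `^ (alpha + 1))) <= _).
  apply: ler_sum => i _; rewrite normrM; apply: ler_pM => //; first exact: Gk.
  rewrite normrM normrX ger0_norm ?invr_ge0//.
  apply: le_trans (pk i (ltn_ord i)); rewrite ler_piMl ?exprn_ge0//.
  by rewrite invf_le1 ?ltr0n ?fact_gt0// ler1n fact_gt0.
rewrite big_const_ord iter_addr_0 -[X in X <= _]mulr_natl /B.
by rewrite le_eqVlt; apply/orP; left; apply/eqP; ring.
Qed.

End density_class.

(** * Bias *)

Section smoothing.
Context (R : realType).
Local Notation mu := (@lebesgue_measure R).
Local Notation int1 g := (mu.-integrable setT (EFin \o g)).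
Variables (l : nat) (K : R -> R).
Hypotheses (iK : int1 K) (hK : kernel_of_order l K).

Let mK : measurable_fun setT K. Proof. exact: integrable_measurable iK. Qed.

Lemma integrable_abs_moment : int1 (fun u => `|K u| * `|u| ^+ l.+1).
Proof.
case: hK => h _ _; apply/integrableP; split.
  apply/measurable_EFinP; apply: measurable_funM; first exact: measurableT_comp.
  by apply: measurable_funX; exact: normr_measurable.
apply: le_lt_trans h; rewrite le_eqVlt; apply/orP; left; apply/eqP.
by apply: eq_integral => u _; rewrite /= ger0_norm// mulr_ge0// exprn_ge0.
Qed.

Lemma integrable_moment_weight : int1 (fun u => `|K u| * (1 + `|u| ^+ l.+1)).
Proof.
have := integrable_add measurableT (integrable_norm iK) integrable_abs_moment.
by apply: eq_integrable => //= u _; rewrite mulrDr mulr1.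
Qed.

Definition moment_mass : R := \int[mu]_u (`|K u| * (1 + `|u| ^+ l.+1)).

Lemma moment_mass_ge0 : 0 <= moment_mass.
Proof. by apply: Rintegral_ge0 => u _; rewrite mulr_ge0// addr_ge0// exprn_ge0. Qed.

Lemma expr_le_moment_weight k (u : R) : (k <= l.+1)%N -> `|u| ^+ k <= 1 + `|u| ^+ l.+1.
Proof.
move=> kl; have [u1|/ltW u1] := leP `|u| 1.
  apply: (@le_trans _ _ 1); first exact: exprn_ile1.
  by rewrite lerDl exprn_ge0.
by apply: le_trans (ler_weXn2l u1 kl) _; rewrite lerDr.
Qed.

Lemma integrable_moment k : (k <= l.+1)%N -> int1 (fun u => u ^+ k * K u).
Proof.
move=> kl; apply: (@integrable_le _ _ R mu setT (fun u => u ^+ k * K u)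
  (fun u => `|K u| * (1 + `|u| ^+ l.+1)) measurableT _ _ integrable_moment_weight).
  by apply: measurable_funM => //; exact: measurable_funX.
move=> u _; rewrite normrM mulrC ler_wpM2l// normrX.
exact: expr_le_moment_weight.
Qed.

Lemma integrable_abs_first_moment : int1 (fun u => `|u| * `|K u|).
Proof.
have := integrable_norm (@integrable_moment 1 isT).
by apply: eq_integrable => //= u _; rewrite expr1 normrM.
Qed.

Lemma abs_first_moment_le : \int[mu]_u (`|u| * `|K u|) <= moment_mass.
Proof.
apply: ge0_le_Rintegral => //; last exact: integrable_moment_weight.
- exact: integrable_measurable integrable_abs_first_moment.
- by move=> u _; rewrite mulrC ler_wpM2l// -[leLHS]expr1; exact: expr_le_moment_weight.
Qed.

Lemma kernel_taylor_sum (c : nat -> R) (b : R) :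
  int1 (fun u => K u * taylor_sum c l.+1 (- (b * u))) /\
  \int[mu]_u (K u * taylor_sum c l.+1 (- (b * u))) = c 0%N.
Proof.
pose h (k : 'I_l.+1) u := (c k * (k`!%:R^-1 * (- b) ^+ k)) * (u ^+ k * K u).
have ih k : int1 (h k).
  by apply: integrable_scale => //; apply: integrable_moment; exact: ltnW (ltn_ord k).
have E : (fun u => K u * taylor_sum c l.+1 (- (b * u))) = (fun u => \sum_(k < l.+1) h k u).
  apply/funext => u; rewrite /taylor_sum mulr_sumr; apply: eq_bigr => k _.
  by rewrite /h -mulNr exprMn; ring.
rewrite E; have [i1 e1] := Rintegral_sum (index_enum 'I_l.+1) ih; split => //.
rewrite e1 big_ord_recl big1; last first.
  move=> k _; rewrite /h RintegralZl//; last by apply: integrable_moment; exact: ltnW (ltn_ord (lift ord0 k)).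
  by case: hK => _ _ ->; rewrite ?mulr0// lift0/=; exact: ltn_ord.
rewrite addr0 /h RintegralZl; [|by []|by apply: (@integrable_moment 0)].
have -> : \int[mu]_x (x ^+ 0 * K x) = 1.
  by case: hK => _ <- _; apply: eq_Rintegral => u _; rewrite mul1r.
by rewrite /= fact0 invr1 !expr0 !mulr1.
Qed.

Variables (F : R -> R) (b : R).
Hypotheses (mF : measurable_fun setT F) (F01 : forall t, 0 <= F t <= 1) (b0 : 0 < b).

Definition smoothed (eta : R) : R := \int[mu]_u (K u * F (eta - b * u)).

Lemma integrable_smoothed eta : int1 (fun u => K u * F (eta - b * u)).
Proof.
apply: (@integrable_mulr _ _ R mu setT K (fun u => F (eta - b * u)) 1 measurableT) => //.
  apply: (measurableT_comp mF); apply: measurable_funB => //; exact: measurable_funM.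
by move=> u _; have /andP[h0 h1] := F01 (eta - b * u); rewrite ger0_norm.
Qed.

(** The remainder is integrated with [|u| ^ a <= 1 + |u| ^ l.+1], valid since [a <= l.+1]. For
    [l = m.+1] and [a = alpha + 1] the condition reads [alpha <= m.+1], which holds by the choice of
    [m]. *)
Lemma smoothing_bias (a C eta : R) (c : nat -> R) : 0 <= a <= l.+1%:R ->
  0 <= C -> c 0%N = F eta ->
  (forall y, `|F (eta + y) - taylor_sum c l.+1 y| <= C * `|y| `^ a) ->
  `|smoothed eta - F eta| <= C * moment_mass * b `^ a.
Proof.
move=> /andP[a0 al] C0 c0 hc; have [i1 e1] := kernel_taylor_sum c b.
rewrite -c0 -e1 /smoothed -RintegralB//; last exact: integrable_smoothed.
have -> : C * moment_mass * b `^ a = \int[mu]_u (C * b `^ a * (`|K u| * (1 + `|u| ^+ l.+1))).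
  by rewrite RintegralZl//; [rewrite mulrAC|exact: integrable_moment_weight].
apply: le_normr_Rintegral_le => //.
- apply: measurable_funB; first exact: integrable_measurable (integrable_smoothed eta).
  exact: integrable_measurable i1.
- move=> u _; rewrite -mulrBr normrM.
  apply: (@le_trans _ _ (`|K u| * (C * (b `^ a * `|u| `^ a)))).
    rewrite ler_wpM2l// -powRM ?(ltW b0)//.
    by have := hc (- (b * u)); rewrite normrN normrM [`|b|]gtr0_norm.
  rewrite [leLHS](_ : _ = (C * b `^ a) * (`|K u| * `|u| `^ a)); last by ring.
  apply: ler_wpM2l; first by rewrite mulr_ge0// powR_ge0.
  rewrite ler_wpM2l//.
  have [u1|/ltW u1] := leP `|u| 1.
    apply: (@le_trans _ _ 1); last by rewrite lerDl exprn_ge0.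
    have e : (1 : R) `^ a = 1 by rewrite powR1.
    by rewrite -[leRHS]e ge0_ler_powR// nnegrE.
  apply: (@le_trans _ _ (`|u| `^ l.+1%:R)); first exact: ler_powR.
  by rewrite powR_mulrn// lerDr.
- by apply: integrable_scale => //; exact: integrable_moment_weight.
Qed.

(** Far from the quantile no smoothness of [f] is available, but a bounded [f] makes the
    distribution function Lipschitz, and the first moment of [K] still gives a bias of order [b]. *)
Lemma smoothing_lipschitz (L eta : R) : 0 <= L -> (forall s t, `|F s - F t| <= L * `|s - t|) ->
  `|smoothed eta - F eta| <= L * moment_mass * b.
Proof.
move=> L0 hF; have K1 : \int[mu]_u K u = 1 by case: hK.
have -> : F eta = \int[mu]_u (F eta * K u) by rewrite RintegralZl// K1 mulr1.
rewrite /smoothed -RintegralB//; [|exact: integrable_smoothed|exact: integrable_scale].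
apply: (@le_trans _ _ (\int[mu]_u (L * b * (`|u| * `|K u|)))).
  apply: le_normr_Rintegral_le => //.
  - apply: measurable_funB; first exact: integrable_measurable (integrable_smoothed eta).
    exact: measurable_funM.
  - move=> u _; rewrite [F eta * _]mulrC -mulrBr normrM mulrC.
    rewrite [leRHS](_ : _ = (L * (b * `|u|)) * `|K u|); last by ring.
    rewrite ler_wpM2r//; apply: le_trans (hF _ _) _.
    by rewrite (_ : eta - b * u - eta = - (b * u)); [rewrite normrN normrM gtr0_norm|ring].
  - by apply: integrable_scale => //; exact: integrable_abs_first_moment.
rewrite RintegralZl//; last exact: integrable_abs_first_moment.
rewrite [leRHS]mulrAC ler_wpM2l//; first by rewrite mulr_ge0// ltW.
exact: abs_first_moment_le.
Qed.

End smoothing.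

Section law_mean_dprim.
Context (R : realType).
Local Notation mu := (@lebesgue_measure R).
Local Notation int1 g := (mu.-integrable setT (EFin \o g)).
Variables (beta L gamma : R) (feps K : R -> R).
Hypotheses (b0 : 0 < beta) (L0 : 0 < L) (hf : error_class beta L gamma feps).
Hypotheses (iK : int1 K) (iuK : int1 (fun u => `|u| * `|K u|)).
Hypothesis suppK : closure [set u | fourier K u != 0] `<=` `[-1, 1].
Variables (b : R) (bp : 0 < b).

(** Averaging over the error first leaves the indicator of [b * u + x <= eta] against [K];
    integrating it against [f] produces the distribution function at [eta - b * u]. *)
Lemma law_mean_dprim (f : R -> R) (eta : R) : is_density f ->
  law_mean f feps (fun y => dprim feps K b (eta - y)) = smoothed K (ray f) b eta.
Proof.
move=> df; have [fi _] := density_integrable df; rewrite /law_mean /smoothed.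
have ii (a t : R) : \1_(`]-oo, a]) t = (t <= a)%R%:R :> R.
  rewrite indicE; congr ((nat_of_bool _)%:R).
  by apply/idP/idP; [rewrite inE/= in_itv|move=> ta; rewrite inE/= in_itv].
pose c (z : R * R) : R := \1_(`]-oo, eta]) (b * z.2 + z.1).
have e1 x : \int[mu]_e (feps e * dprim feps K b (eta - (x + e))) =
    \int[mu]_u (K u * c (x, u)).
  transitivity (\int[mu]_e (feps e * dprim feps K b ((eta - x) - e))).
    by apply: eq_Rintegral => e _; rewrite opprD addrA.
  rewrite (mean_dprim b0 L0 hf iK iuK suppK bp); apply: eq_Rintegral => u _.
  by congr (_ * _); rewrite /c !ii/= lerBrDr.
under eq_Rintegral do rewrite e1.
rewrite (@Rfubini _ _ _ _ R mu mu f K c 1 fi iK).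
- apply: eq_Rintegral => u _; congr (_ * _); rewrite /ray -Rintegral_indic//.
  apply: eq_Rintegral => x _; congr (_ * _).
  by rewrite /c !ii/= lerBrDl.
- apply: (@measurableT_comp _ _ _ _ _ _ (\1_(`]-oo, eta]) : R -> R)); first exact: measurable_indic.
  by apply: measurable_funD => //; exact: measurable_funM.
- by move=> z; rewrite /c indicE; case: (_ \in _); rewrite ?normr1 ?normr0.
Qed.

End law_mean_dprim.

(** * Variance and uniform deviation *)

Section law_mean_bound.
Context (R : realType).
Local Notation mu := (@lebesgue_measure R).
Local Notation int1 g := (mu.-integrable setT (EFin \o g)).
Variables (L : R) (f feps : R -> R).
Hypotheses (df : is_density f) (de : is_density feps)
  (fL : ('N[mu]_+oo [EFin \o f] <= L%:E)%E).

(** Convolution with the errors does not increase the essential bound [L] of the density, so the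
    mean is at most the bounded part [A] plus the integrable part weighted by [L]. *)
Lemma law_mean_le (phi g : R -> R) (A M : R) :
  measurable_fun setT phi -> (forall y, 0 <= phi y <= M) ->
  (forall y, 0 <= g y) -> int1 g -> (forall y, phi y <= A + g y) ->
  law_mean f feps phi <= A + L * \int[mu]_y g y.
Proof.
move=> mphi phiM g0 ig hphi; have [fi f1] := density_integrable df.
have [ei e1] := density_integrable de.
have mg : measurable_fun setT g by exact: integrable_measurable ig.
have mphix (e : R) : measurable_fun setT (fun x : R => phi (x + e)).
  by apply: (measurableT_comp mphi); exact: measurable_funD.
have hM y : `|phi y| <= M by have /andP[h0 h1] := phiM y; rewrite ger0_norm.
have f0 x : 0 <= f x by case: df.
have e0 x : 0 <= feps x by case: de.
have inner e : \int[mu]_x (f x * phi (x + e)) <= A + L * \int[mu]_y g y.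
  have mge : measurable_fun setT (fun x : R => g (x + e)).
    by apply: (measurableT_comp mg); exact: measurable_funD.
  have [i1 h1] := density_weight_le df fL mge (fun x => g0 _) (integrable_translation e ig).
  apply: (@le_trans _ _ (\int[mu]_x (A * f x + f x * g (x + e)))).
    apply: ge0_le_Rintegral => //.
    - by apply: measurable_funM; [exact: (integrable_measurable fi)|exact: mphix].
    - by move=> x _; rewrite mulr_ge0//; have /andP[] := phiM (x + e).
    - by move=> x _; rewrite [A * _]mulrC -mulrDr ler_wpM2l.
    - by apply: integrable_add => //; exact: integrable_scale.
  rewrite RintegralD//; last exact: integrable_scale.
  by rewrite RintegralZl// f1 mulr1 lerD2l -(Rintegral_translation e ig).
have mphi2 : measurable_fun setT (fun z : R * R => phi (z.1 + z.2)).
  by apply: (measurableT_comp mphi); exact: measurable_funD.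
rewrite /law_mean (@Rfubini _ _ _ _ R mu mu f feps (fun z => phi (z.1 + z.2)) M fi ei mphi2 (fun z => hM _)).
rewrite -[leRHS]mulr1 -e1 -RintegralZl//.
apply: ge0_le_Rintegral => //.
- exact: (integrable_measurable (@Rfubini_integrable _ _ _ _ R mu mu feps f
    (fun z => phi (z.2 + z.1)) M ei fi (measurableT_comp mphi (measurable_funD measurable_snd measurable_fst)) (fun z => hM _))).
- move=> e _; rewrite mulr_ge0//; apply: Rintegral_ge0 => x _.
  by rewrite mulr_ge0//; have /andP[] := phiM (x + e).
- by move=> e _; rewrite mulrC ler_wpM2r//; exact: inner.
- exact: integrable_scale.
Qed.

End law_mean_bound.

Section moments.
Context (R : realType).
Local Notation mu := (@lebesgue_measure R).
Local Notation int1 g := (mu.-integrable setT (EFin \o g)).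
Variables (beta L gamma : R) (feps K : R -> R).
Hypotheses (b0 : 0 < beta) (L0 : 0 < L) (hf : error_class beta L gamma feps).
Hypotheses (iK : int1 K) (iuK : int1 (fun u => `|u| * `|K u|)).
Hypothesis suppK : closure [set u | fourier K u != 0] `<=` `[-1, 1].
Variables (b : R) (bp : 0 < b) (b1 : b <= 1).
Variables (f : R -> R).
Hypotheses (df : is_density f) (fL : ('N[mu]_+oo [EFin \o f] <= L%:E)%E).

Let de : is_density feps. Proof. by case: hf. Qed.

Definition symbol_bound : R := 2 * (\int[mu]_u `|K u|) * L.

(* Bounds the second moments of both [dprim (eta - Y)] and its increments, for
   which the squares are bounded twice by [2 (x ^ 2 + y ^ 2)]. *)
Definition prim_var (a : R) : R :=
  8 * low_bound beta L K ^+ 2 + 64 * L * symbol_bound ^+ 2 * vmass beta a^-1.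

Definition kern_var (a : R) : R :=
  L * (4 * symbol_bound ^+ 2 * (1 + a^-1) `^ (2 * beta) / a).

Local Notation prim := (dprim feps K b).
Local Notation kern := (dkernel feps K b).
Local Notation high := (dhigh_prim feps K b).

Let ck : continuous kern. Proof. exact: continuous_dkernel b0 L0 hf iK iuK suppK _ bp. Qed.
Let cp : continuous prim. Proof. exact: continuous_dprim b0 L0 hf iK iuK suppK _ bp. Qed.
Let mk : measurable_fun setT kern. Proof. exact: continuous_measurable_fun. Qed.
Let mp : measurable_fun setT prim. Proof. exact: continuous_measurable_fun. Qed.
Let ik : int1 kern. Proof. exact: integrable_dkernel b0 L0 hf iK iuK suppK _ bp. Qed.

Lemma dprim_bounded t : `|prim t| <= \int[mu]_x `|kern x|.
Proof. exact: normr_ray_le. Qed.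

Let mh : measurable_fun setT high.
Proof.
apply: continuous_measurable_fun => t.
exact: is_derive_continuous (is_derive_dhigh_prim b0 L0 hf iK iuK suppK bp b1 t).
Qed.

Let ih : int1 (fun x => high x ^+ 2) /\ \int[mu]_x (high x ^+ 2) <= 8 * symbol_bound ^+ 2 * vmass beta b^-1.
Proof.
apply: ge0_integrable_of_le => //.
- exact: measurable_funX.
- by move=> x _; exact: sqr_ge0.
- exact: (dhigh_prim_sqr_le b0 L0 hf iK iuK suppK bp).
Qed.

Let ik2 : int1 (fun x => kern x ^+ 2) /\
  \int[mu]_x (kern x ^+ 2) <= 4 * symbol_bound ^+ 2 * (1 + b^-1) `^ (2 * beta) / b.
Proof.
apply: ge0_integrable_of_le => //.
- exact: measurable_funX.
- by move=> x _; exact: sqr_ge0.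
- exact: (dkernel_sqr_le b0 L0 hf iK iuK suppK bp).
Qed.

Let mrefl (h : R -> R) (eta : R) : measurable_fun setT h -> measurable_fun setT (fun y : R => h (eta - y)).
Proof. by move=> mh'; apply: (measurableT_comp mh'); exact: measurable_funB. Qed.

Lemma dkernel_moment eta : law_mean f feps (fun y => kern (eta - y) ^+ 2) <= kern_var b.
Proof.
have [i2 h2] := ik2.
have [B hB] : exists B, forall x, `|kern x| <= B.
  by eexists => x; exact: (dkernel_bounded b0 L0 hf iK iuK suppK bp).
have := @law_mean_le R L f feps df de fL (fun y => kern (eta - y) ^+ 2) (fun y => kern (eta - y) ^+ 2) 0 (B ^+ 2).
move=> h; apply: le_trans (h _ _ _ _ _) _.
- by apply: measurable_funX; exact: mrefl.
- move=> y; rewrite sqr_ge0/= -(real_normK (num_real _)) lerXn2r ?nnegrE//.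
  by apply: le_trans (hB 0).
- by move=> y; exact: sqr_ge0.
- exact: (integrable_reflection eta i2).
- by move=> y; rewrite add0r.
- by rewrite add0r (Rintegral_reflection eta i2) /kern_var ler_wpM2l// ltW.
Qed.

(** The bound does not improve as [eta] approaches [q]; the slope argument compensates by keeping a
    distance [t0 * psi] from [q]. *)
Lemma dprim_increment_moment eta q :
  law_mean f feps (fun y => (prim (eta - y) - prim (q - y)) ^+ 2) <= prim_var b.
Proof.
have [i2 h2] := ih; pose B := \int[mu]_x `|kern x|.
have hB := dprim_bounded.
pose g y := 4 * high (eta - y) ^+ 2 + 4 * high (q - y) ^+ 2.
have i3 := integrable_scale 4 measurableT (integrable_reflection eta i2).
have i4 := integrable_scale 4 measurableT (integrable_reflection q i2).
have := @law_mean_le R L f feps df de fL (fun y => (prim (eta - y) - prim (q - y)) ^+ 2) g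
  (8 * low_bound beta L K ^+ 2) ((B + B) ^+ 2).
move=> h; apply: le_trans (h _ _ _ _ _) _.
- by apply: measurable_funX; apply: measurable_funB; exact: mrefl.
- move=> y; rewrite sqr_ge0/= -(real_normK (num_real _)) lerXn2r ?nnegrE//.
    by rewrite addr_ge0//; exact: Rintegral_ge0.
  by apply: le_trans (ler_normB _ _) _; apply: lerD; exact: hB.
- by move=> y; rewrite /g addr_ge0// mulr_ge0// sqr_ge0.
- exact: integrable_add.
- move=> y; rewrite /g.
  have := dprim_sqr_le b0 L0 hf iK iuK suppK bp b1 (eta - y).
  have := dprim_sqr_le b0 L0 hf iK iuK suppK bp b1 (q - y).
  move: (prim _) (prim _) (high _ ^+ 2) (high _ ^+ 2) (low_bound _ _ _ ^+ 2) => x z u v w h3 h4.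
  have -> : (x - z) ^+ 2 = 2 * x ^+ 2 + 2 * z ^+ 2 - (x + z) ^+ 2 by ring.
  by have := sqr_ge0 (x + z); move: h3 h4; move: (x ^+ 2) (z ^+ 2) (_ ^+ 2) => a c e; lra.
- have er (t : R) : \int[mu]_y (4 * high (t - y) ^+ 2) = 4 * \int[mu]_y (high y ^+ 2).
    rewrite -(Rintegral_reflection t i2).
    by apply: RintegralZl => //; exact: (integrable_reflection t i2).
  rewrite /g RintegralD// !er /prim_var lerD2l.
  rewrite (_ : 64 * L * _ * _ = L * (4 * (8 * symbol_bound ^+ 2 * vmass beta b^-1) + 4 * (8 * symbol_bound ^+ 2 * vmass beta b^-1))); last by ring.
  have h4 := ler_wpM2l (ler0n R 4) h2.
  by apply: ler_wpM2l; [exact: ltW|apply: lerD].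
Qed.

Lemma dprim_moment eta : law_mean f feps (fun y => prim (eta - y) ^+ 2) <= prim_var b.
Proof.
have [i2 h2] := ih; pose B := \int[mu]_x `|kern x|.
have hB := dprim_bounded.
pose g y := 2 * high (eta - y) ^+ 2.
have := @law_mean_le R L f feps df de fL (fun y => prim (eta - y) ^+ 2) g
  (2 * low_bound beta L K ^+ 2) (B ^+ 2).
move=> h; apply: le_trans (h _ _ _ _ _) _.
- by apply: measurable_funX; exact: mrefl.
- move=> y; rewrite sqr_ge0/= -(real_normK (num_real _)) lerXn2r ?nnegrE//.
  exact: Rintegral_ge0.
- by move=> y; rewrite /g mulr_ge0// sqr_ge0.
- by apply: integrable_scale => //; exact: (integrable_reflection eta i2).
- by move=> y; exact: (dprim_sqr_le b0 L0 hf iK iuK suppK bp b1).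
- rewrite /g RintegralZl//; last exact: (integrable_reflection eta i2).
  rewrite (Rintegral_reflection _ i2) /prim_var.
  have : 0 <= \int[mu]_x (high x ^+ 2) by apply: Rintegral_ge0 => x _; exact: sqr_ge0.
  move: (\int[mu]_x _) h2 => J h2 J0.
  have := sqr_ge0 (low_bound beta L K); move: (low_bound _ _ _ ^+ 2) => w w0.
  have -> : 64 * L * symbol_bound ^+ 2 * vmass beta b^-1 =
    8 * (L * (8 * symbol_bound ^+ 2 * vmass beta b^-1)) by ring.
  have := ler_wpM2l (ltW L0) h2; have := mulr_ge0 (ltW L0) J0.
  by rewrite [L * (2 * _)]mulrCA; move: (L * J) (L * _) => x z; lra.
Qed.

End moments.

(** * Slope of a random path away from the origin *)

Section maximal_slope.
Context (R : realType) d (T : measurableType d) (P : probability T R).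
Local Notation mu := (@lebesgue_measure R).

Lemma markov_Rintegral (W : T -> R) (c a : R) : P.-integrable setT (EFin \o W) ->
  (forall w, 0 <= W w) -> 0 < c -> \int[P]_w W w <= a ->
  (P [set w | (c < W w)%R] <= (a / c)%:E)%E /\ measurable [set w | c < W w].
Proof.
move=> iW W0 c0 Wa; have mW := integrable_measurable iW.
have mE : measurable [set w | c < W w].
  rewrite -[X in measurable X]setTI (_ : [set w | _] = W @^-1` `]c, +oo[); first exact: mW.
  by apply/seteqP; split => w /=; rewrite in_itv/= andbT.
split => //; set E := [set w | _] in mE *.
have pE : P E = (fine (P E))%:E by rewrite fineK// fin_num_measure.
rewrite pE lee_fin ler_pdivlMr//; apply: le_trans Wa.
have -> : fine (P E) * c = \int[P]_w (c * \1_E w).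
  rewrite RintegralZl//; last first.
    apply: (@integrable_bounded _ _ _ _ _ 1); first exact: measurable_indic.
    by move=> w; rewrite indicE ger0_norm// lern1; case: (_ \in _).
  by rewrite mulrC /Rintegral integral_indic// setIT.
apply: ge0_le_Rintegral => //.
- by apply: measurable_funM => //; exact: measurable_indic.
- by move=> w _; rewrite mulr_ge0// ltW.
- move=> w _; rewrite indicE; have [|_] := boolP (w \in E); last by rewrite mulr0.
  by rewrite inE mulr1 => /ltW.
Qed.

Variables (Z Z' : T -> R -> R) (t0 t1 M a v lam : R).
Hypotheses (t00 : 0 < t0) (t01 : t0 < t1) (lam0 : 0 < lam).
Hypotheses (mZ : measurable_fun setT (fun p : T * R => Z p.1 p.2))
  (mZ' : measurable_fun setT (fun p : T * R => Z' p.1 p.2))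
  (ZM : forall w t, `|Z w t| <= M) (Z'M : forall w t, `|Z' w t| <= M)
  (dZ : forall w (t : R), is_derive t 1 (Z w) (Z' w t))
  (cZ' : forall w, continuous (Z' w))
  (EZ : forall t, \int[P]_w (Z w t ^+ 2) <= a)
  (EZ' : forall t, \int[P]_w (Z' w t ^+ 2) <= v).

(** Majorant of [2 * |Z| * |Z'|] by the arithmetic-geometric inequality, with a weight [lam] left
    free to balance the two variances; it is distinct from the rate of the same name. *)
Let psi (p : T * R) : R := lam * Z p.1 p.2 ^+ 2 + lam^-1 * Z' p.1 p.2 ^+ 2.
Let h (t : R) : R := (t ^+ 2)^-1 * \1_(`[t0, t1]) t.

Let psi0 p : 0 <= psi p.
Proof. by rewrite addr_ge0// mulr_ge0 ?sqr_ge0 ?invr_ge0// ltW. Qed.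

Let mpsi : measurable_fun setT psi.
Proof. by apply: measurable_funD; apply: measurable_funM => //; exact: measurable_funX. Qed.

Let sqM (x : R) : `|x| <= M -> x ^+ 2 <= M ^+ 2.
Proof.
by move=> xM; rewrite -(real_normK (num_real x)) lerXn2r ?nnegrE// (le_trans _ xM).
Qed.

Let psiM p : `|psi p| <= lam * M ^+ 2 + lam^-1 * M ^+ 2.
Proof.
rewrite ger0_norm// lerD// ler_wpM2l ?invr_ge0 ?(ltW lam0)//; exact: sqM.
Qed.

Let h0 t : 0 <= h t.
Proof. by rewrite mulr_ge0 ?invr_ge0 ?sqr_ge0// indicE. Qed.

Let in01 t : (t \in `[t0, t1]%classic) = (t0 <= t <= t1).
Proof. by apply/idP/idP; rewrite inE/= in_itv. Qed.

Let ih : mu.-integrable setT (EFin \o h).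
Proof.
apply: (@integrable_le _ _ R mu setT h (fun t => (t0 ^+ 2)^-1 * \1_(`[t0, t1]) t)) => //.
- apply: measurable_funM; last exact: measurable_indic.
  rewrite (_ : (fun t : R => _) = (fun t : R => (t ^+ 2) `^ (-1))); last first.
    by apply/funext => t; rewrite powR_inv1// sqr_ge0.
  by apply: (measurableT_comp (@measurable_powR R (-1))); exact: measurable_funX.
- move=> t _; rewrite ger0_norm// /h indicE in01; case: andP => [[tt _]|_]; last by rewrite !mulr0.
  rewrite !mulr1 lef_pV2 ?posrE ?exprn_gt0//; last exact: lt_le_trans tt.
  by rewrite lerXn2r ?nnegrE ?(le_trans (ltW t00) tt) ?(ltW t00).
- exact: integrable_itv_cst.
Qed.

Let continuous_inv (t : R) : t0 <= t -> {for t, continuous (@GRing.inv R)}.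
Proof. by move=> tt; apply: inv_continuous; rewrite gt_eqF// (lt_le_trans t00). Qed.

Let is_derive_inv (t : R) : t0 <= t -> is_derive t 1 (@GRing.inv R) (- (t ^+ 2)^-1).
Proof.
move=> tt; have tn : t != 0 by rewrite gt_eqF// (lt_le_trans t00).
have := is_deriveV tn (is_derive_id t (1 : R)).
by rewrite /GRing.scale/= mulr1.
Qed.

Let int_h : \int[mu]_t h t <= t0^-1.
Proof.
rewrite /h Rintegral_indic// (_ : \int[mu]_(x in _) _ = - t1^-1 - - t0^-1).
  by rewrite opprK addrC gerBl invr_ge0 ltW// (lt_trans t00).
rewrite /Rintegral (@continuous_FTC2 _ _ (fun t => - t^-1))//=.
- apply: continuous_in_subspaceT => t; rewrite in01 => /andP[tt _].
  have -> : (fun x : R => (x ^+ 2)^-1) = (fun x => x^-1 * x^-1).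
    by apply/funext => x; rewrite expr2 invfM.
  by apply: cvgM; exact: continuous_inv.
- split.
  + move=> t; rewrite in_itv/= => /andP[/ltW tt _]; apply: derivableN.
    by have [] := is_derive_inv tt.
  + by apply: cvg_at_right_filter; apply: cvgN; exact: continuous_inv.
  + by apply: cvg_at_left_filter; apply: cvgN; apply: continuous_inv; exact: ltW.
- move=> t; rewrite in_itv/= => /andP[/ltW tt _].
  have := is_deriveN (is_derive_inv tt); rewrite opprK => ht.
  by have [_ ->] := is_derive1E ht.
Qed.

Let W w := (Z w t0 / t0) ^+ 2 + \int[mu]_t (h t * psi (w, t)).

(* The derivative of [(Z t / t) ^ 2] is at most [2 Z t * Z' t / t ^ 2]. *)
Let path_le w t : t0 <= t <= t1 -> (Z w t / t) ^+ 2 <= W w.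
Proof.
move=> /andP[tt tt1].
have Z0 s : 0 <= h s * psi (w, s) by rewrite mulr_ge0.
have mpw : measurable_fun setT (fun s => psi (w, s)) by exact: measurableT_comp.
have ihp : mu.-integrable setT (EFin \o (fun s => h s * psi (w, s))).
  exact: (@integrable_mulr _ _ R mu setT h (fun s => psi (w, s)) _ measurableT mpw (fun s _ => psiM _) ih).
have [->|tn] := eqVneq t t0.
  by rewrite /W lerDl; apply: Rintegral_ge0.
have lt : t0 < t by rewrite lt_neqAle eq_sym tn.
pose G s := (Z w s / s) ^+ 2.
pose G' s := 2 * (Z w s * s^-1) * (Z' w s * s^-1 - Z w s * s^-1 * s^-1).
have cZ (s : R) : {for s, continuous (Z w)} by exact: is_derive_continuous (dZ w s).
have dG s : t0 <= s -> is_derive s 1 G (G' s).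
  move=> ts; have du := is_deriveM (dZ w s) (is_derive_inv ts).
  have dG := is_deriveM du du.
  have s0 : s != 0 by rewrite gt_eqF// (lt_le_trans t00).
  suff <- : (Z w * @GRing.inv R) s *: (Z w s *: - (s ^+ 2)^-1 + s^-1 *: Z' w s) +
     (Z w * @GRing.inv R) s *: (Z w s *: - (s ^+ 2)^-1 + s^-1 *: Z' w s) = G' s.
    by rewrite (_ : G = (Z w * @GRing.inv R) * (Z w * @GRing.inv R))//.
  rewrite /G' /GRing.scale/= [(Z w * _) s](_ : _ = Z w s * s^-1)//.
  by move: (Z w s) (Z' w s) => x y; field.
have cG' s : t0 <= s -> {for s, continuous G'}.
  move=> ts; have ci := continuous_inv ts.
  apply: cvgM; first by apply: cvgM; [exact: cvg_cst|apply: cvgM; [exact: cZ|exact: ci]].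
  apply: cvgB; first by apply: cvgM; [exact: cZ'|exact: ci].
  by apply: cvgM; [apply: cvgM; [exact: cZ|exact: ci]|exact: ci].
have FTC : G t - G t0 = \int[mu]_(s in `[t0, t]) G' s.
  rewrite /Rintegral (@continuous_FTC2 _ _ G)//=.
  - by apply: continuous_in_subspaceT => s; rewrite inE/= in_itv/= => /andP[ts _]; exact: cG'.
  - split.
    + by move=> s; rewrite in_itv/= => /andP[/ltW ts _]; have [] := dG s ts.
    + by apply: cvg_at_right_filter; exact: is_derive_continuous (dG t0 (lexx _)).
    + by apply: cvg_at_left_filter; exact: is_derive_continuous (dG t (ltW lt)).
  - by move=> s; rewrite in_itv/= => /andP[/ltW ts _]; have [_ ->] := is_derive1E (dG s ts).
rewrite -[leLHS]/(G t) -[G t](subrK (G t0)) addrC /W lerD2l FTC.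
have iG' : mu.-integrable `[t0, t] (EFin \o G').
  apply: continuous_compact_integrable; first exact: segment_compact.
  by apply: continuous_in_subspaceT => s; rewrite inE/= in_itv/= => /andP[ts _]; exact: cG'.
apply: (@le_trans _ _ (\int[mu]_(s in `[t0, t]) (h s * psi (w, s)))); last first.
  rewrite -Rintegral_indic//; apply: le_Rintegral => //.
    exact: integrable_indicM.
  by move=> s _; rewrite ler_piMr// indicE lern1; case: (_ \in _).
apply: le_Rintegral => //; first exact: integrable_on.
move=> s; rewrite /= in_itv/= => /andP[ts st].
have s0 : 0 < s by exact: lt_le_trans ts.
rewrite /h indicE in01 ts (le_trans st tt1)/= mulr1 /G' /psi/=.
move: (Z w s) (Z' w s) => x y.
rewrite -subr_ge0.
(* The difference is a sum of nonnegative terms: a completed square, and [2 * x ^+ 2 / s] from the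
   derivative of [1 / s], which has the favourable sign. *)
have -> : (s ^+ 2)^-1 * (lam * x ^+ 2 + lam^-1 * y ^+ 2) - 2 * (x / s) * (y / s - x / s / s) =
   (s ^+ 2)^-1 * (lam^-1 * (lam * x - y) ^+ 2 + 2 * x ^+ 2 / s).
  by field; rewrite !gt_eqF.
have p1 : 0 <= s ^- 2 by rewrite invr_ge0 sqr_ge0.
have p2 : 0 <= lam^-1 * (lam * x - y) ^+ 2 by rewrite mulr_ge0 ?sqr_ge0// invr_ge0 ltW.
have p3 : 0 <= 2 * x ^+ 2 / s by rewrite divr_ge0 ?(ltW s0)// mulr_ge0 ?sqr_ge0.
by rewrite mulr_ge0// addr_ge0.
Qed.

(** Markov's inequality for [W], which dominates every [(Z t / t) ^ 2] on the interval: its mean is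
    at most [a / t0 ^+ 2] for the starting point plus [lam * a + v / lam] times the integral of
    [t ^- 2], which is at most [1 / t0]. The bound does not involve [t1]. *)
Lemma maximal_slope (e : R) : 0 < e ->
  exists E : set T, [/\ measurable E,
    (P E <= ((a / t0 ^+ 2 + (lam * a + v / lam) / t0) / e ^+ 2)%:E)%E &
    forall w, ~ E w -> forall t, t0 <= t <= t1 -> `|Z w t| <= e * t].
Proof.
move=> e0; pose one := (fun=> 1) : T -> R.
have i1 : P.-integrable setT (EFin \o one) by exact: finite_measure_integrable_cst.
have Fi := @Rfubini_integrable _ _ _ _ R P mu one h psi _ i1 ih mpsi psiM.
have Fe := @Rfubini _ _ _ _ R P mu one h psi _ i1 ih mpsi psiM.
have eF : (fun w => one w * \int[mu]_t (h t * psi (w, t))) = (fun w => \int[mu]_t (h t * psi (w, t))).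
  by apply/funext => w; rewrite mul1r.
rewrite eF in Fi Fe.
have mZt t : measurable_fun setT (fun w => Z w t).
  exact: (measurableT_comp mZ (measurable_pair2 t)).
have mZ't t : measurable_fun setT (fun w => Z' w t).
  exact: (measurableT_comp mZ' (measurable_pair2 t)).
have iZ t : P.-integrable setT (EFin \o (fun w => Z w t ^+ 2)).
  apply: (@integrable_bounded _ _ _ P _ (M ^+ 2)); first exact: measurable_funX.
  by move=> w; rewrite ger0_norm ?sqr_ge0//; exact: sqM.
have iZ' t : P.-integrable setT (EFin \o (fun w => Z' w t ^+ 2)).
  apply: (@integrable_bounded _ _ _ P _ (M ^+ 2)); first exact: measurable_funX.
  by move=> w; rewrite ger0_norm ?sqr_ge0//; exact: sqM.
have iZ0 : P.-integrable setT (EFin \o (fun w => (Z w t0 / t0) ^+ 2)).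
  have := integrable_scale (t0 ^- 2) measurableT (iZ t0).
  by apply: eq_integrable => //= w _; rewrite expr_div_n mulrC.
have iW : P.-integrable setT (EFin \o W) by exact: integrable_add.
have Epsi t : \int[P]_w psi (w, t) <= lam * a + v / lam.
  rewrite /psi/= RintegralD//; [|exact: integrable_scale..].
  by rewrite !RintegralZl// [v / lam]mulrC lerD// ler_wpM2l ?invr_ge0 ?(ltW lam0).
have c0 : 0 <= lam * a + v / lam.
  by apply: le_trans (Epsi t0); apply: Rintegral_ge0.
have EW : \int[P]_w W w <= a / t0 ^+ 2 + (lam * a + v / lam) / t0.
  rewrite /W RintegralD//; apply: lerD.
    under eq_Rintegral do rewrite expr_div_n mulrC.
    by rewrite RintegralZl// mulrC ler_wpM2r ?invr_ge0 ?sqr_ge0.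
  rewrite Fe; apply: (@le_trans _ _ (\int[mu]_t ((lam * a + v / lam) * h t))); last first.
    by rewrite RintegralZl// ler_wpM2l.
  apply: ge0_le_Rintegral => //.
  - have mpsi' : measurable_fun setT (fun p : R * T => psi (p.2, p.1)).
      by apply: (measurableT_comp mpsi); exact: measurable_fun_pair.
    exact: (integrable_measurable (@Rfubini_integrable _ _ _ _ R mu P h one (fun p => psi (p.2, p.1)) _ ih i1 mpsi' (fun p => psiM _))).
  - move=> t _; rewrite mulr_ge0//; apply: Rintegral_ge0 => w _; exact: mulr_ge0.
  - move=> t _; rewrite [leRHS]mulrC ler_wpM2l//.
    by under eq_Rintegral do rewrite mul1r; exact: Epsi.
  - exact: integrable_scale.
have W0 w : 0 <= W w by rewrite addr_ge0 ?sqr_ge0//; apply: Rintegral_ge0 => t _; exact: mulr_ge0.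
have [PE mE] := markov_Rintegral iW W0 (exprn_gt0 2 e0) EW.
exists [set w | e ^+ 2 < W w]; split => // w /negP; rewrite -leNgt => We t tt.
have t0' : 0 < t by have /andP[h1 _] := tt; exact: lt_le_trans h1.
have := le_trans (path_le w tt) We; rewrite -(real_normK (num_real (Z w t / t))).
rewrite ler_pXn2r ?nnegrE// ?(ltW e0)// normrM normfV (gtr0_norm t0').
by rewrite ler_pdivrMr.
Qed.

End maximal_slope.

(** * Regularity of the kernel at a fixed bandwidth *)

Section kernel_regularity.
Context (R : realType).
Local Notation mu := (@lebesgue_measure R).
Local Notation int1 g := (mu.-integrable setT (EFin \o g)).
Variables (beta L gamma : R) (feps K : R -> R).
Hypotheses (b0 : 0 < beta) (L0 : 0 < L) (hf : error_class beta L gamma feps).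
Hypotheses (iK : int1 K) (iuK : int1 (fun u => `|u| * `|K u|)).
Hypothesis suppK : closure [set u | fourier K u != 0] `<=` `[-1, 1].
Variables (b : R) (bp : 0 < b).
Local Notation prim := (dprim feps K b).
Local Notation kern := (dkernel feps K b).

(** A quadratic Taylor bound is stable under averaging over the sample and under expectation, so the
    centred process is differentiable without differentiating under an integral. *)
Lemma is_derive_quadratic (g : R -> R) (x c C : R) :
  (forall h, `|g (x + h) - g x - h * c| <= C * h ^+ 2) -> is_derive x 1 g c.
Proof.
move=> hg; have C0 : 0 <= C.
  by have := hg 1; rewrite expr1n mulr1; apply: le_trans.
have h : (fun t : R => t^-1 *: (g (t *: 1 + x) - g x)) @ 0^' --> c.
  apply/cvgrPdist_lt => e e0; apply: (nbhs_ballP _ _).2.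
  exists (e / (C + 1)); first by rewrite /= divr_gt0// ltr_wpDl.
  move=> t; rewrite /ball/= sub0r normrN => te t0.
  rewrite /GRing.scale/= mulr1 addrC [t + x]addrC.
  have -> : - (t^-1 * (g (x + t) - g x)) + c = - (t^-1 * (g (x + t) - g x - t * c)) by field.
  rewrite normrN normrM normfV.
  apply: (@le_lt_trans _ _ (`|t|^-1 * (C * t ^+ 2))); first by rewrite ler_wpM2l ?invr_ge0.
  have -> : `|t|^-1 * (C * t ^+ 2) = C * `|t|.
    by rewrite -(real_normK (num_real t)); field; rewrite normr_eq0.
  apply: le_lt_trans (_ : (C + 1) * `|t| < e); first by rewrite ler_wpM2r// lerDl.
  by rewrite mulrC -ltr_pdivlMr// ltr_wpDl.
apply: DeriveDef; first by apply/cvg_ex; exists c.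
exact: cvg_lim h.
Qed.

(** The constant depends on [b] and serves only for measurability and differentiability, never for a
    rate. *)
Lemma dkernel_lipschitz : exists2 C, 0 <= C & forall x y, `|kern x - kern y| <= C * `|x - y|.
Proof.
have A0 : 0 < b^-1 by rewrite invr_gt0.
have CK0 : 0 <= \int[mu]_u (`|u| * `|K u|) by apply: Rintegral_ge0 => u _; rewrite mulr_ge0.
have BK0 : 0 <= \int[mu]_u `|K u| by apply: Rintegral_ge0.
have C0 : 0 <= symbol_lip beta L b^-1 (b * \int[mu]_u (`|u| * `|K u|)) (\int[mu]_u `|K u|).
  by apply: addr_ge0; apply: quot_lip_ge0; rewrite ?invr_ge0 ?mulr_ge0 ?(ltW bp).
have [sre sim] := symbol_lip_support b0 L0 hf iK iuK suppK bp.
have p0 : 0 < 2 * pi :> R by rewrite mulr_gt0// pi_gt0.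
set c1 := \int[mu]_u (`|u| * `|symbol_re feps K b u|).
set c2 := \int[mu]_u (`|u| * `|symbol_im feps K b u|).
have c10 : 0 <= c1 by apply: Rintegral_ge0 => u _; rewrite mulr_ge0.
have c20 : 0 <= c2 by apply: Rintegral_ge0 => u _; rewrite mulr_ge0.
exists ((2 * pi)^-1 * (c1 + c2)); first by rewrite mulr_ge0 ?addr_ge0// invr_ge0 ltW.
move=> x y; rewrite /dkernel /ftr -mulrBr normrM ger0_norm ?invr_ge0 ?(ltW p0)// -mulrA.
rewrite ler_wpM2l ?invr_ge0 ?(ltW p0)// opprD addrACA mulrDl.
apply: le_trans (ler_normD _ _) _; apply: lerD.
- apply: (trigtr_lipschitz (trig_kernel_cos R)).
  + exact: (lip_support_integrable A0 C0 sre).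
  + exact: (lip_support_integrable_moment A0 C0 sre).
- apply: (trigtr_lipschitz (trig_kernel_sin R)).
  + exact: (lip_support_integrable A0 C0 sim).
  + exact: (lip_support_integrable_moment A0 C0 sim).
Qed.

Lemma dprim_taylor (C : R) : 0 <= C -> (forall x y, `|kern x - kern y| <= C * `|x - y|) ->
  forall x h, `|prim (x + h) - prim x - h * kern x| <= C * h ^+ 2.
Proof.
move=> C0 hC x h.
have := @mean_value_le R (fun t => prim (x + t) - prim x - t * kern x)
  (fun t => kern (x + t) - kern x) (`|h| + 1) (C * `|h|) h.
rewrite -mulrA -expr2 real_normK ?num_real//; apply.
- by rewrite addr0 subrr mul0r subr0.
- move=> t _; have ds : is_derive t 1 (fun s : R => x + s) 1.
    rewrite -[X in is_derive _ _ _ X]add0r; exact: (is_deriveD (is_derive_cst x t (1 : R)) (is_derive_id t (1 : R))).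
  have d0 := is_derive_dprim b0 L0 hf iK iuK suppK bp (x + t).
  have := is_derive1_comp d0 ds; rewrite mulr1 => d1.
  have d2 := is_deriveB d1 (is_derive_cst (prim x) t (1 : R)).
  have d3 := is_deriveM (is_derive_id t (1 : R)) (is_derive_cst (kern x) t (1 : R)).
  have := is_deriveB d2 d3.
  by rewrite subr0 /GRing.scale/= mulr0 add0r mulr1; exact.
- by rewrite ltrDl.
- move=> t th; apply: le_trans (hC _ _) _; rewrite ler_wpM2l// addrC addKr//.
Qed.

End kernel_regularity.

Section centered.
Context (R : realType) d (T : measurableType d) (P : probability T R).
Local Notation mu := (@lebesgue_measure R).
Variables (n : nat) (X eps : 'I_n -> {mfun T >-> R}) (f feps : R -> R).
Hypotheses (hm : @deconvolution_model R d T P n X eps f feps)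
  (df : is_density f) (de : is_density feps) (n0 : (0 < n)%N).
Local Notation Em := (law_mean f feps).
Implicit Types (phi : R -> R) (M : R).

Definition sample_mean (phi : R -> R) (w : T) : R := n%:R^-1 * \sum_(j < n) phi (obs X eps j w).

Definition centered (phi : R -> R) (w : T) : R := sample_mean phi w - Em phi.

Let Em_obs phi M : measurable_fun setT phi -> (forall x, `|phi x| <= M) ->
  Em phi = \int[P]_w phi (obs X eps (Ordinal n0) w).
Proof. by move=> mphi hM; rewrite (obs_mean hm df de _ mphi hM). Qed.

Let iobs phi M : measurable_fun setT phi -> (forall x, `|phi x| <= M) ->
  P.-integrable setT (EFin \o (fun w => phi (obs X eps (Ordinal n0) w))).
Proof.
move=> mphi hM; apply: (@integrable_bounded _ _ _ P _ M); last by move=> w; exact: hM.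
by apply: (measurableT_comp mphi); exact: measurable_funPT.
Qed.

Lemma normr_law_mean_le phi M : measurable_fun setT phi -> (forall x, `|phi x| <= M) ->
  `|Em phi| <= M.
Proof.
move=> mphi hM; rewrite (Em_obs mphi hM) -[leRHS](Rintegral_probability_cst P M).
apply: le_normr_Rintegral_le => //.
- by apply: (measurableT_comp mphi); exact: measurable_funPT.
- exact: finite_measure_integrable_cst.
Qed.

Lemma normr_sample_mean_le phi M w : (forall x, `|phi x| <= M) -> `|sample_mean phi w| <= M.
Proof.
move=> hM; rewrite /sample_mean normrM ger0_norm ?invr_ge0//.
rewrite mulrC ler_pdivrMr ?ltr0n//; apply: le_trans (ler_norm_sum _ _ _) _.
apply: le_trans (ler_sum _ (fun j _ => hM _)) _.
by rewrite big_const_ord iter_addr_0 -[X in X <= _]mulr_natr.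
Qed.

Lemma normr_centered_le phi M w : measurable_fun setT phi -> (forall x, `|phi x| <= M) ->
  `|centered phi w| <= M + M.
Proof.
move=> mphi hM; apply: le_trans (ler_normB _ _) _.
by rewrite lerD// ?normr_sample_mean_le// normr_law_mean_le.
Qed.

(** Linearity is that of the expectation of one observation. The form [phi1 - c * phi2] covers
    increments, with [c = 1], and the subtraction of a first-order term, with [c = h]. *)
Lemma law_mean_lin phi1 phi2 M1 M2 (c : R) :
  measurable_fun setT phi1 -> (forall x, `|phi1 x| <= M1) ->
  measurable_fun setT phi2 -> (forall x, `|phi2 x| <= M2) ->
  Em (fun y => phi1 y - c * phi2 y) = Em phi1 - c * Em phi2.
Proof.
move=> m1 h1 m2 h2; rewrite (Em_obs m1 h1) (Em_obs m2 h2) (@Em_obs _ (M1 + `|c| * M2)).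
- rewrite RintegralB//; [|exact: iobs m1 h1|by apply: integrable_scale => //; exact: iobs m2 h2].
  by rewrite RintegralZl//; exact: iobs m2 h2.
- by apply: measurable_funB => //; exact: measurable_funM.
- by move=> x; apply: le_trans (ler_normB _ _) _; rewrite lerD// normrM ler_wpM2l.
Qed.

Lemma centered_lin phi1 phi2 M1 M2 (c : R) w :
  measurable_fun setT phi1 -> (forall x, `|phi1 x| <= M1) ->
  measurable_fun setT phi2 -> (forall x, `|phi2 x| <= M2) ->
  centered (fun y => phi1 y - c * phi2 y) w = centered phi1 w - c * centered phi2 w.
Proof.
move=> m1 h1 m2 h2.
rewrite /centered (law_mean_lin c m1 h1 m2 h2) /sample_mean sumrB -mulr_sumr.
by move: (\sum_(_ < _) _) (\sum_(_ < _) _) (Em _) (Em _) => u v x y; ring.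
Qed.

Lemma centered_lipschitz (phi : R -> R -> R) M (C : R) w :
  (forall t, measurable_fun setT (phi t)) -> (forall t x, `|phi t x| <= M) ->
  (forall s t x, `|phi s x - phi t x| <= C * `|s - t|) ->
  forall s t, `|centered (phi s) w - centered (phi t) w| <= (C + C) * `|s - t|.
Proof.
move=> mphi hM hC s t; rewrite -[centered (phi t) w]mul1r.
rewrite -(centered_lin 1 w (mphi s) (hM s) (mphi t) (hM t)) mulrDl.
apply: normr_centered_le; last by move=> x; rewrite mul1r.
by apply: measurable_funB => //; exact: measurable_funM.
Qed.

Lemma measurable_law_mean (phi : R -> R -> R) M (C : R) :
  (forall t, measurable_fun setT (phi t)) -> (forall t x, `|phi t x| <= M) ->
  (forall s t x, `|phi s x - phi t x| <= C * `|s - t|) ->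
  measurable_fun setT (fun t => Em (phi t)).
Proof.
move=> mphi hM hC; apply: continuous_measurable_fun.
apply: (@lipschitz_continuous R C) => s t; rewrite -[Em (phi t)]mul1r.
rewrite -(law_mean_lin 1 (mphi s) (hM s) (mphi t) (hM t)).
apply: normr_law_mean_le; last by move=> x; rewrite mul1r.
by apply: measurable_funB => //; exact: measurable_funM.
Qed.

Lemma centered_variance phi M : measurable_fun setT phi -> (forall x, `|phi x| <= M) ->
  \int[P]_w (centered phi w ^+ 2) <= n%:R^-1 * Em (fun x => phi x ^+ 2).
Proof. by move=> mphi hM; exact: (obs_variance hm df de n0 mphi hM). Qed.

Lemma measurable_sample_mean (phi : R -> R -> R) :
  measurable_fun setT (fun p : R * R => phi p.1 p.2) ->
  measurable_fun setT (fun p : T * R => sample_mean (phi p.2) p.1).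
Proof.
move=> mphi; apply: measurable_funM => //; apply: measurable_sum => j.
apply: (measurableT_comp mphi (_ : measurable_fun _ (fun p : T * R => (p.2, obs X eps j p.1)))).
apply: measurable_fun_pair => //.
by apply: (measurableT_comp (measurable_funPT (obs X eps j))).
Qed.

End centered.

(** * The centred distribution function estimator *)

Section deviation.
Context (R : realType) d (T : measurableType d) (P : probability T R).
Local Notation mu := (@lebesgue_measure R).
Local Notation int1 g := (mu.-integrable setT (EFin \o g)).
Variables (beta L gamma : R) (feps K : R -> R).
Hypotheses (b0 : 0 < beta) (L0 : 0 < L) (hf : error_class beta L gamma feps).
Hypotheses (iK : int1 K) (iuK : int1 (fun u => `|u| * `|K u|)).
Hypothesis suppK : closure [set u | fourier K u != 0] `<=` `[-1, 1].
Variables (b : R) (bp : 0 < b) (b1 : b <= 1).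
Variables (n : nat) (X eps : 'I_n -> {mfun T >-> R}) (f : R -> R).
Hypotheses (hm : @deconvolution_model R d T P n X eps f feps)
  (df : is_density f) (fL : ('N[mu]_+oo [EFin \o f] <= L%:E)%E) (n0 : (0 < n)%N).
Local Notation prim := (dprim feps K b).
Local Notation kern := (dkernel feps K b).
Local Notation ctr := (centered X eps f feps).

Let de : is_density feps. Proof. by case: hf. Qed.

Definition deviation (eta : R) (w : T) : R := ctr (fun y => prim (eta - y)) w.
Let ddev (eta : R) (w : T) : R := ctr (fun y => kern (eta - y)) w.

Let mprim : measurable_fun setT prim.
Proof. by apply: continuous_measurable_fun; exact: continuous_dprim b0 L0 hf iK iuK suppK _ bp. Qed.
Let mkern : measurable_fun setT kern.
Proof. by apply: continuous_measurable_fun; exact: continuous_dkernel b0 L0 hf iK iuK suppK _ bp. Qed.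

Let mrefl (h : R -> R) (eta : R) : measurable_fun setT h -> measurable_fun setT (fun y : R => h (eta - y)).
Proof. by move=> mh'; apply: (measurableT_comp mh'); exact: measurable_funB. Qed.

Let B1 := \int[mu]_x `|kern x|.
Let B2 := \int[mu]_u `|symbol_re feps K b u| + \int[mu]_u `|symbol_im feps K b u|.
Let hB1 x : `|prim x| <= B1. Proof. exact: (dprim_bounded b0 L0 hf iK iuK suppK bp). Qed.
Let hB2 x : `|kern x| <= B2. Proof. exact: (dkernel_bounded b0 L0 hf iK iuK suppK bp). Qed.

Let prim_lip x y : `|prim x - prim y| <= B2 * `|x - y|.
Proof.
by apply: (@le_lipschitz_derive R prim kern) => // z; exact: (is_derive_dprim b0 L0 hf iK iuK suppK bp z).
Qed.

Let shift_lip (h : R -> R) (C : R) : (forall x y, `|h x - h y| <= C * `|x - y|) ->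
  forall s t x : R, `|h (s - x) - h (t - x)| <= C * `|s - t|.
Proof. by move=> hC s t x; apply: le_trans (hC _ _) _; rewrite opprB addrA subrK. Qed.

(** [centered] is linear and at most doubles a uniform bound, so the Taylor estimate for [dprim]
    carries over with [C + C]. *)
Lemma deviation_taylor : exists2 C, 0 <= C & forall eta h w,
  `|deviation (eta + h) w - deviation eta w - h * ddev eta w| <= C * h ^+ 2.
Proof.
have [C C0 hC] := dkernel_lipschitz b0 L0 hf iK iuK suppK bp.
exists (C + C) => [|eta h w]; first exact: addr_ge0.
have m1 t := mrefl t mprim; have m2 t := mrefl t mkern.
rewrite /deviation /ddev -[ctr (fun y => prim (eta - y)) w]mul1r.
rewrite -(centered_lin hm df de n0 1 w (m1 _) (fun y => hB1 _) (m1 _) (fun y => hB1 _)).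
rewrite -(@centered_lin _ _ _ P n X eps f feps hm df de n0 _ _ (B1 + B1) B2).
- rewrite mulrDl; apply: (normr_centered_le hm df de n0).
    apply: measurable_funB; last exact: measurable_funM.
    by apply: measurable_funB => //; exact: measurable_funM.
  move=> y; rewrite mul1r; have := dprim_taylor b0 L0 hf iK iuK suppK bp C0 hC (eta - y) h.
  by rewrite [eta - y + h]addrAC.
- by apply: measurable_funB => //; exact: measurable_funM.
- by move=> y; rewrite mul1r; apply: le_trans (ler_normB _ _) _; apply: lerD.
- exact: m2.
- by move=> y; exact: hB2.
Qed.

(** Joint measurability in the sample and the parameter, which the exchange of expectation and
    integral over [t] needs; [q + c * t] covers both sides of [q] and, with [c = 0], a fixed
    point. *)
Let measurable_ctr (h : R -> R) (B C : R) (c q : R) : measurable_fun setT h ->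
  (forall x, `|h x| <= B) -> (forall x y, `|h x - h y| <= C * `|x - y|) ->
  measurable_fun setT (fun p : T * R => ctr (fun y => h (q + c * p.2 - y)) p.1).
Proof.
move=> mh hB hC; apply: measurable_funB.
  apply: (measurable_sample_mean X eps (phi := fun t y => h (q + c * t - y))).
  apply: (measurableT_comp mh); apply: measurable_funB => //.
  by apply: measurable_funD => //; exact: measurable_funM.
have ml := @measurable_law_mean _ _ _ P n X eps f feps hm df de n0 (fun t y => h (t - y)) B C
  (fun t => mrefl t mh) (fun t x => hB _) (shift_lip hC).
apply: (measurableT_comp ml (_ : measurable_fun setT (fun p : T * R => q + c * p.2))).
by apply: measurable_funD => //; exact: measurable_funM.
Qed.

Lemma measurable_deviation eta : measurable_fun setT (deviation eta).
Proof.
have := @measurable_ctr prim B1 B2 0 eta mprim hB1 prim_lip => h.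
pose z : R := 0; have := measurableT_comp h (measurable_pair2 z).
by apply: eq_measurable_fun => w _; rewrite /= /deviation mul0r addr0.
Qed.

Lemma deviation_variance eta :
  \int[P]_w (deviation eta w ^+ 2) <= n%:R^-1 * prim_var beta L K b.
Proof.
apply: le_trans (centered_variance hm df de n0 (mrefl eta mprim) (fun y => hB1 _)) _.
by rewrite ler_wpM2l ?invr_ge0//; exact: (dprim_moment b0 L0 hf iK iuK suppK bp b1 df fL).
Qed.

Lemma deviation_integrable eta : P.-integrable setT (EFin \o (fun w => deviation eta w ^+ 2)).
Proof.
apply: (@integrable_bounded _ _ _ P _ ((B1 + B1) ^+ 2)).
  by apply: measurable_funX; exact: measurable_deviation.
move=> w; rewrite normrX lerXn2r ?nnegrE// ?addr_ge0 ?(le_trans _ (hB1 0))//.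
exact: (normr_centered_le hm df de n0 w (mrefl eta mprim) (fun y => hB1 _)).
Qed.

Lemma deviation_slope (q t0 t1 lam e : R) : 0 < t0 -> t0 < t1 -> 0 < lam -> 0 < e ->
  let a := n%:R^-1 * prim_var beta L K b in
  let v := n%:R^-1 * kern_var beta L K b in
  exists E : set T, [/\ measurable E,
    (P E <= (2 * ((a / t0 ^+ 2 + (lam * a + v / lam) / t0) / e ^+ 2))%:E)%E &
    forall w, ~ E w -> forall eta, t0 <= `|eta - q| <= t1 ->
      `|deviation eta w - deviation q w| <= e * `|eta - q|].
Proof.
move=> t00 t01 lam0 e0 a v.
have [C C0 hC] := dkernel_lipschitz b0 L0 hf iK iuK suppK bp.
have [C' C'0 hC'] := deviation_taylor.
(* [maximal_slope] follows the path on one side only; [s = 1] and [s = -1] give the two sides and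
   the factor 2. *)
have side (s : R) : s ^+ 2 = 1 -> exists E : set T, [/\ measurable E,
    (P E <= ((a / t0 ^+ 2 + (lam * a + v / lam) / t0) / e ^+ 2)%:E)%E &
    forall w, ~ E w -> forall t, t0 <= t <= t1 ->
      `|deviation (q + s * t) w - deviation q w| <= e * t].
  move=> s2.
  have s1 : `|s| = 1.
    by apply/eqP; rewrite -(@eqrXn2 _ 2)// real_normK ?num_real// s2 expr1n.
  pose M := (B1 + B1 + (B1 + B1)) + (B2 + B2).
  have B10 : 0 <= B1 by apply: le_trans (hB1 0).
  have B20 : 0 <= B2 by apply: le_trans (hB2 0).
  have dM eta w : `|deviation eta w| <= B1 + B1.
    exact: (normr_centered_le hm df de n0 w (mrefl eta mprim) (fun y => hB1 _)).
  have ddM eta w : `|ddev eta w| <= B2 + B2.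
    exact: (normr_centered_le hm df de n0 w (mrefl eta mkern) (fun y => hB2 _)).
  apply: (@maximal_slope R d T P (fun w t => deviation (q + s * t) w - deviation q w)
    (fun w t => s * ddev (q + s * t) w) t0 t1 M a v lam t00 t01 lam0 _ _ _ _ _ _ _ _ e e0).
  - apply: measurable_funB; first exact: measurable_ctr mprim hB1 prim_lip.
    by apply: (measurableT_comp (measurable_deviation q)).
  - by apply: measurable_funM => //; exact: measurable_ctr mkern hB2 hC.
  - move=> w t; apply: le_trans (ler_normB _ _) _.
    by apply: le_trans (lerD (dM _ _) (dM _ _)) _; rewrite lerDl addr_ge0.
  - by move=> w t; rewrite normrM s1 mul1r; apply: le_trans (ddM _ _) _; rewrite lerDr !addr_ge0.
  - move=> w t; apply: (@is_derive_quadratic R _ _ _ C') => h.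
    have := hC' (q + s * t) (s * h) w; rewrite exprMn s2 mul1r.
    rewrite [s * (t + h)]mulrDr addrA.
    move: (deviation _ w) (deviation _ w) (deviation _ w) (ddev _ w) => x1 x2 x3 x4.
    by have -> : x3 - x2 - s * h * x4 = x3 - x1 - (x2 - x1) - h * (s * x4) by ring.
  - move=> w; apply: (@lipschitz_continuous R (C + C)) => x y; rewrite -mulrBr normrM s1 mul1r.
    have := @centered_lipschitz _ _ _ P n X eps f feps hm df de n0 (fun t y => kern (t - y)) B2 C w
      (fun t => mrefl t mkern) (fun t x => hB2 _) (shift_lip hC) (q + s * x) (q + s * y).
    have -> : q + s * x - (q + s * y) = s * (x - y) by ring.
    by rewrite [`|s * _|]normrM s1 mul1r.
  - move=> t; under eq_Rintegral do rewrite /deviation -[X in _ - X]mul1r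
      -(centered_lin hm df de n0 1 _ (mrefl _ mprim) (fun y => hB1 _) (mrefl _ mprim) (fun y => hB1 _)).
    apply: le_trans (@centered_variance _ _ _ P n X eps f feps hm df de n0 _ (B1 + B1) _ _) _.
    + by apply: measurable_funB; [exact: mrefl|apply: measurable_funM => //; exact: mrefl].
    + by move=> y; rewrite mul1r; apply: le_trans (ler_normB _ _) _; apply: lerD.
    + rewrite ler_wpM2l ?invr_ge0//.
      apply: le_trans (dprim_increment_moment b0 L0 hf iK iuK suppK bp b1 df fL (q + s * t) q).
      rewrite le_eqVlt; apply/orP; left; apply/eqP; congr law_mean.
      by apply/funext => y; rewrite mul1r.
  - move=> t; under eq_Rintegral do rewrite exprMn s2 mul1r.
    apply: le_trans (centered_variance hm df de n0 (mrefl _ mkern) (fun y => hB2 _)) _.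
    by rewrite ler_wpM2l ?invr_ge0//; exact: (dkernel_moment b0 L0 hf iK iuK suppK bp df fL).
have [E1 [mE1 PE1 h1]] := side 1 (expr1n _ _).
have m1 : (-1) ^+ 2 = 1 :> R by rewrite sqrrN expr1n.
have [E2 [mE2 PE2 h2]] := side (-1) m1.
exists (E1 `|` E2); split; first exact: measurableU.
- apply: le_trans (measureU2 _ _ _) _ => //.
  by rewrite mulr_natl mulr2n EFinD; exact: leeD.
- move=> w /not_orP[nE1 nE2] eta; have [h|/ltW h] := leP 0 (eta - q).
    rewrite [`|eta - q|]ger0_norm// => /(h1 w nE1).
    by have -> : q + 1 * (eta - q) = eta by ring.
  rewrite [`|eta - q|]ler0_norm// => /(h2 w nE2).
  by have -> : q + -1 * (- (eta - q)) = eta by ring.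
Qed.

End deviation.

(** * The estimator *)

Section estimator.
Context (R : realType).
Local Notation mu := (@lebesgue_measure R).
Local Notation int1 g := (mu.-integrable setT (EFin \o g)).
Variables (beta L gamma : R) (feps K : R -> R).
Hypotheses (b0 : 0 < beta) (L0 : 0 < L) (hf : error_class beta L gamma feps).
Hypotheses (iK : int1 K) (iuK : int1 (fun u => `|u| * `|K u|)).
Hypothesis suppK : closure [set u | fourier K u != 0] `<=` `[-1, 1].
Variables (b : R) (bp : 0 < b) (n : nat) (Y : 'I_n -> R).

Lemma complex_sum (a c : 'I_n -> R) :
  \sum_(j < n) ((a j +i* c j)%C : R[i]) = ((\sum_(j < n) a j) +i* (\sum_(j < n) c j))%C.
Proof. by elim/big_rec3: _ => // j x y z _ ->. Qed.

Lemma emp_charE u : emp_char Y u =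
  ((n%:R^-1 * \sum_(j < n) cos (u * Y j)) +i* (n%:R^-1 * \sum_(j < n) sin (u * Y j)))%C.
Proof.
by rewrite /emp_char /expi complex_sum; congr (_ +i* _)%C; rewrite ?mul0r ?subr0 ?addr0.
Qed.

Lemma fhat_integrand u x :
  complex.Re (expi (- (u * x)) * (emp_char Y u * fourier K (b * u) / fourier feps u)) =
  n%:R^-1 * \sum_(j < n) (symbol_re feps K b u * cos (u * (x - Y j)) +
     symbol_im feps K b u * sin (u * (x - Y j))).
Proof.
rewrite emp_charE !fourier_trigtr /expi cosN sinN.
rewrite [X in _ = _ * X](eq_bigr (fun j => (symbol_re feps K b u * cos (u * x) + symbol_im feps K b u * sin (u * x)) * cos (u * Y j)
    + (symbol_re feps K b u * sin (u * x) - symbol_im feps K b u * cos (u * x)) * sin (u * Y j))); last first.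
  by move=> j _; rewrite mulrBr cosB sinB; ring.
rewrite big_split/= -!mulr_sumr /symbol_re /symbol_im /sqmod.
move: (\sum_(_ < _) _) (\sum_(_ < _) _) (n%:R^-1) => C S v.
move: (trigtr cos K _) (trigtr sin K _) (trigtr cos feps u) (trigtr sin feps u) => p q r s.
by move: (cos _) (sin _) (_ ^-1) => c t e; ring.
Qed.

Let A0 : 0 < b^-1. Proof. by rewrite invr_gt0. Qed.
Let C0 : 0 <= symbol_lip beta L b^-1 (b * \int[mu]_u (`|u| * `|K u|)) (\int[mu]_u `|K u|).
Proof.
by apply: addr_ge0; apply: quot_lip_ge0; rewrite ?invr_ge0 ?mulr_ge0 ?(ltW bp)//;
  apply: Rintegral_ge0 => u _; rewrite ?mulr_ge0.
Qed.
Let ire := lip_support_integrable A0 C0 (symbol_lip_support b0 L0 hf iK iuK suppK bp).1.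
Let iim := lip_support_integrable A0 C0 (symbol_lip_support b0 L0 hf iK iuK suppK bp).2.

Lemma fhatE x : fhat feps K b Y x = n%:R^-1 * \sum_(j < n) dkernel feps K b (x - Y j).
Proof.
rewrite /fhat /inv_fourier /Cintegral /= mul0r subr0.
under eq_Rintegral do rewrite fhat_integrand.
pose h (j : 'I_n) u := symbol_re feps K b u * cos (u * (x - Y j)) +
  symbol_im feps K b u * sin (u * (x - Y j)).
have ih j : int1 (h j).
  by apply: integrable_add => //; apply: integrable_trig => //; [exact: trig_kernel_cos|exact: trig_kernel_sin].
have [iS eS] := Rintegral_sum (index_enum 'I_n) ih.
rewrite RintegralZl// eS mulrCA mulr_sumr; congr (_ * _); apply: eq_bigr => j _.
rewrite /dkernel /ftr; congr (_ * _); rewrite /h RintegralD//.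
- by apply: integrable_trig => //; exact: trig_kernel_cos.
- by apply: integrable_trig => //; exact: trig_kernel_sin.
Qed.

Let ik : int1 (dkernel feps K b). Proof. exact: integrable_dkernel b0 L0 hf iK iuK suppK _ bp. Qed.

Let ikY j : int1 (fun x => dkernel feps K b (x - Y j)).
Proof. exact: (integrable_translation (- Y j) ik). Qed.

Lemma integrable_fhat : int1 (fhat feps K b Y).
Proof.
rewrite (_ : fhat feps K b Y = fun x => n%:R^-1 * \sum_(j < n) dkernel feps K b (x - Y j)); last first.
  by apply/funext => x; exact: fhatE.
by apply: integrable_scale => //; exact: (Rintegral_sum (index_enum 'I_n) ikY).1.
Qed.

Lemma ray_fhat eta : ray (fhat feps K b Y) eta = n%:R^-1 * \sum_(j < n) dprim feps K b (eta - Y j).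
Proof.
rewrite /ray -Rintegral_indic//.
pose h (j : 'I_n) x : R := dkernel feps K b (x - Y j) * \1_(`]-oo, eta]) x.
have ih j : int1 (h j) by apply: integrable_indicM.
have [iS eS] := Rintegral_sum (index_enum 'I_n) ih.
transitivity (\int[mu]_x (n%:R^-1 * \sum_(j < n) h j x)).
  by apply: eq_Rintegral => x _; rewrite fhatE /h -mulrA mulr_suml.
rewrite RintegralZl// eS; congr (_ * _); apply: eq_bigr => j _.
rewrite /dprim /ray -Rintegral_indic// /h.
have ii := integrable_indicM (measurable_itv `]-oo, eta - Y j]) ik.
rewrite -(Rintegral_translation (- Y j) ii); apply: eq_Rintegral => x _; congr (_ * _).
rewrite !indicE; congr ((nat_of_bool _)%:R).
by apply/idP/idP; rewrite !inE/= !in_itv/= lerD2r.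
Qed.

End estimator.

(** * Rates *)

Section rates.
Context (R : realType).
Variables (alpha beta : R).
Hypotheses (a0 : 0 < alpha) (b0 : 0 < beta).
Local Notation half := (2^-1 : R).
Local Notation kap := (2 * alpha + 2 * Num.max beta half + 1).
Local Notation bw n := (bstar alpha beta n).
Local Notation rate n := (psi alpha beta n).

Let kap1 : 1 <= kap.
Proof.
have : half <= Num.max beta half by rewrite le_max lexx orbT.
by move: a0; move: (Num.max _ _) => m; lra.
Qed.
Let kap0 : 0 < kap. Proof. exact: lt_le_trans kap1. Qed.

Let natr_near (c : R) : \forall n \near \oo, c <= (n%:R : R).
Proof. exact: nbhs_infty_ger. Qed.

Lemma powRN_small (s c : R) : 0 < s -> 0 < c -> \forall n \near \oo, n%:R `^ (- s) <= c :> R.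
Proof.
move=> s0 c0; have ci : 0 < c^-1 by rewrite invr_gt0.
near=> n; have n1 : 1 <= (n%:R : R) by near: n; exact: natr_near.
have n0 : 0 < (n%:R : R) by exact: lt_le_trans n1.
rewrite powRN -[leRHS]invrK lef_pV2 ?posrE ?powR_gt0//.
have -> : c^-1 = (c^-1 `^ s^-1) `^ s by rewrite -powRrM mulVf ?gt_eqF// powRr1 ?ltW.
rewrite ge0_ler_powR ?nnegrE ?powR_ge0 ?(ltW s0) ?(ltW n0)//.
by near: n; exact: natr_near.
Unshelve. all: by end_near. Qed.

Lemma ln_le_powR (s x : R) : 0 < s -> 0 < x -> ln x <= s^-1 * x `^ s.
Proof.
move=> s0 x0; rewrite mulrC ler_pdivlMr// mulrC -ln_powR.
have := expR_ge1Dx (ln (x `^ s)); rewrite lnK ?posrE ?powR_gt0//.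
by apply: le_trans; rewrite lerDr.
Qed.

Lemma bstar_gt0_le1 : \forall n \near \oo, 0 < bw n <= 1.
Proof.
near=> n; have n1 : 1 <= (n%:R : R) by near: n; exact: natr_near.
rewrite /bstar powR_gt0 ?(lt_le_trans ltr01)//= powRN invf_le1 ?powR_gt0 ?(lt_le_trans ltr01)//.
by rewrite -[leLHS](powRr0 n%:R) ler_powR// invr_ge0 ltW.
Unshelve. all: by end_near. Qed.

Lemma bstar_small (c : R) : 0 < c -> \forall n \near \oo, bw n <= c.
Proof. by apply: powRN_small; rewrite invr_gt0. Qed.

Let ln_near : \forall n \near \oo, 1 <= ln (n%:R : R).
Proof.
near=> n; have ne : expR 1 <= (n%:R : R) by near: n; exact: natr_near.
by rewrite -[leLHS](expRK 1) ler_ln ?posrE ?expR_gt0// (lt_le_trans _ ne) ?expR_gt0.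
Unshelve. all: by end_near. Qed.

Lemma psi_gt0 : \forall n \near \oo, 0 < rate n.
Proof.
near=> n; have n1 : 1 <= (n%:R : R) by near: n; exact: natr_near.
have n0 : 0 < (n%:R : R) by exact: lt_le_trans n1.
have l1 : 1 <= ln (n%:R : R) by near: n; exact: ln_near.
rewrite /psi; case: ifP => _; first exact: powR_gt0.
by case: ifP => _; apply: powR_gt0 => //; rewrite divr_gt0// (lt_le_trans ltr01).
Unshelve. all: by end_near. Qed.

Let max_large : half < beta -> Num.max beta half = beta.
Proof. by move=> h; apply/max_idPl; exact: ltW. Qed.
Let powR2 (x s : R) : 0 <= x -> (x `^ s) ^+ 2 = x `^ (2 * s).
Proof. by move=> x0; rewrite -powR_mulrn ?powR_ge0// -powRrM mulrC. Qed.

(** For [beta <= 1 / 2] the exponent [(alpha + 1) / (2 alpha + 2)] is [1 / 2], and the logarithm at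
    [beta = 1 / 2] only enlarges the rate; for [beta > 1 / 2] there is equality. *)
Lemma bstar_bias : \forall n \near \oo, bw n `^ (alpha + 1) <= rate n.
Proof.
near=> n; have n1 : 1 <= (n%:R : R) by near: n; exact: natr_near.
have n0 : 0 < (n%:R : R) by exact: lt_le_trans n1.
have l1 : 1 <= ln (n%:R : R) by near: n; exact: ln_near.
have al : 0 < alpha + 1 by rewrite addr_gt0.
rewrite /bstar /psi -powRrM; have [bs|bs] := ltP beta half.
  have -> : - (2 * alpha + 2 * half + 1)^-1 * (alpha + 1) = - half.
    by field; rewrite ?gt_eqF//; move: al; lra.
  by [].
case: ifPn => [/eqP be|bn].
  rewrite be; have -> : - (2 * alpha + 2 * half + 1)^-1 * (alpha + 1) = - half.
    by field; rewrite ?gt_eqF//; move: al; lra.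
  rewrite powRN -powR_inv1 ?powR_ge0// -powRrM mulrN1 -mulN1r powRrM powR_inv1 ?(ltW n0)//.
  rewrite ge0_ler_powR ?nnegrE ?invr_ge0 ?(ltW n0) ?divr_ge0 ?(ltW (lt_le_trans ltr01 l1))//.
  by rewrite -[leLHS]mul1r ler_wpM2r ?invr_ge0 ?(ltW n0).
by rewrite (_ : - _ * _ = - ((alpha + 1) / (2 * alpha + 2 * beta + 1)))// mulNr mulrC.
Unshelve. all: by end_near. Qed.

(** One bound for the three regimes: the factor [ln n] absorbs the logarithm of the critical
    case. *)
Lemma psi_small : exists2 s : R, 0 < s & \forall n \near \oo, rate n <= ln n%:R * n%:R `^ (- s).
Proof.
pose s := if beta <= half then half else (alpha + 1) / (2 * alpha + 2 * beta + 1).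
exists s.
  rewrite /s; case: ifPn => // _; rewrite divr_gt0//; move: a0 b0; lra.
near=> n; have n1 : 1 <= (n%:R : R) by near: n; exact: natr_near.
have n0 : 0 < (n%:R : R) by exact: lt_le_trans n1.
have l1 : 1 <= ln (n%:R : R) by near: n; exact: ln_near.
have l0 : 0 <= ln (n%:R : R) by exact: le_trans l1.
rewrite /psi /s; have [bs|bs] := ltP beta half.
  by rewrite (ltW bs) ler_peMl ?powR_ge0.
case: ifPn => [/eqP be|bn].
  rewrite be lexx powRM ?invr_ge0 ?(ltW n0)//; apply: ler_pM; rewrite ?powR_ge0//.
    by rewrite -[leRHS]powRr1// ler_powR//; lra.
  by rewrite -powR_inv1 ?(ltW n0)// -powRrM mulN1r.
have -> : (beta <= half) = false by apply/negbTE; rewrite -ltNge lt_neqAle eq_sym bn.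
by rewrite ler_peMl ?powR_ge0.
Unshelve. all: by end_near. Qed.

(** Since [U_n = O (log n)], the far part of the quantile tail is of order [psi * ln n ^ 2]; the
    summand [1] makes [psi] itself small at the same time. *)
Lemma psi_ln_small (c : R) : 0 < c ->
  \forall n \near \oo, rate n * (1 + ln n%:R ^+ 2) <= c.
Proof.
move=> c0; have [s s0 hs] := psi_small.
(* Three powers of the logarithm, one from [psi_small] and two from the factor, cost
   [n ^ (3 t) = n ^ (s / 2)], half of the available decay. *)
pose t := s / 6; have t0 : 0 < t by rewrite divr_gt0.
have h2 : 0 < s / 2 by rewrite divr_gt0.
have cc : 0 < c / (2 * t^-1 ^+ 3) by rewrite divr_gt0// mulr_gt0// exprn_gt0// invr_gt0.
near=> n; have n1 : 1 <= (n%:R : R) by near: n; exact: natr_near.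
have n0 : 0 < (n%:R : R) by exact: lt_le_trans n1.
have l1 : 1 <= ln (n%:R : R) by near: n; exact: ln_near.
have hr : rate n <= ln n%:R * n%:R `^ (- s) by near: n; exact: hs.
have hp : n%:R `^ (- (s / 2)) <= c / (2 * t^-1 ^+ 3) by near: n; exact: powRN_small.
have hl := ln_le_powR t0 n0.
set l := ln _ in l1 hr hl *.
have l0 : 0 <= l by exact: le_trans l1.
have P0 : 0 <= n%:R `^ (- s) :> R by exact: powR_ge0.
apply: (@le_trans _ _ ((l * n%:R `^ (- s)) * (2 * l ^+ 2))).
  apply: (@le_trans _ _ ((l * n%:R `^ (- s)) * (1 + l ^+ 2))).
    by rewrite ler_wpM2r// addr_ge0// sqr_ge0.
  rewrite ler_wpM2l ?mulr_ge0//.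
  have : 1 <= l ^+ 2 by rewrite expr_ge1.
  by move: (l ^+ 2) => x; lra.
have l3 : l ^+ 3 <= t^-1 ^+ 3 * n%:R `^ (s / 2).
  have -> : n%:R `^ (s / 2) = (n%:R `^ t) ^+ 3 :> R.
    by rewrite -powR_mulrn ?powR_ge0// -powRrM; congr (_ `^ _); rewrite /t; field.
  rewrite -exprMn lerXn2r ?nnegrE// mulr_ge0 ?powR_ge0// invr_ge0 ltW//.
have -> : l * n%:R `^ (- s) * (2 * l ^+ 2) = 2 * (n%:R `^ (- s) * l ^+ 3) by ring.
apply: (@le_trans _ _ (2 * (n%:R `^ (- s) * (t^-1 ^+ 3 * n%:R `^ (s / 2))))).
  by rewrite ler_wpM2l// ler_wpM2l.
have -> : n%:R `^ (- s) * (t^-1 ^+ 3 * n%:R `^ (s / 2)) = t^-1 ^+ 3 * n%:R `^ (- (s / 2)) :> R.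
  rewrite mulrCA -powRD; last by apply/implyP => _; rewrite gt_eqF.
  by congr (_ * _ `^ _); field.
rewrite mulrA mulrC -ler_pdivlMr//; by rewrite mulr_gt0// exprn_gt0// invr_gt0.
Unshelve. all: by end_near. Qed.

Variables (L : R) (K : R -> R).
Hypothesis L0 : 0 < L.

Let A := 8 * low_bound beta L K ^+ 2.
Let G := 64 * L * symbol_bound L K ^+ 2.
Let A0 : 0 <= A. Proof. by rewrite mulr_ge0 ?sqr_ge0. Qed.
Let G0 : 0 <= G. Proof. by rewrite /G mulr_ge0 ?sqr_ge0// mulr_ge0// ltW. Qed.

Let bwV n : (bw n)^-1 = n%:R `^ kap^-1.
Proof. by rewrite /bstar powRN invrK. Qed.

Lemma prim_var_rate : exists2 C, 0 < C &
  \forall n \near \oo, n%:R^-1 * prim_var beta L K (bw n) <= C * rate n ^+ 2.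
Proof.
suff [C C0 hC] : exists2 C, 0 <= C &
    \forall n \near \oo, n%:R^-1 * prim_var beta L K (bw n) <= C * rate n ^+ 2.
  exists (C + 1); first by rewrite ltr_wpDl.
  near=> n; have h : n%:R^-1 * prim_var beta L K (bw n) <= C * rate n ^+ 2 by near: n.
  by apply: le_trans h _; rewrite ler_wpM2r ?sqr_ge0// lerDl.
have [bs|bs] := ltP beta half.
  have c0 : 0 <= 2 / (1 - 2 * beta) by rewrite divr_ge0// subr_ge0 ltW//; move: bs; lra.
  exists (A + G * (2 / (1 - 2 * beta))); first by rewrite addr_ge0// mulr_ge0.
  near=> n; have n1 : 1 <= (n%:R : R) by near: n; exact: natr_near.
  have n0 : 0 < (n%:R : R) by exact: lt_le_trans n1.
  have bV : 0 < (bw n)^-1 by rewrite bwV powR_gt0.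
  rewrite /psi bs powR2 ?(ltW n0)// (_ : 2 * - half = -1); last by field.
  rewrite powR_inv1 ?(ltW n0)// mulrC ler_wpM2r ?invr_ge0 ?(ltW n0)//.
  rewrite /prim_var lerD2l ler_wpM2l//; exact: vmass_small.
have [be|bn] := eqVneq beta half.
  exists (A + G * 4); first by rewrite addr_ge0// mulr_ge0.
  near=> n; have n2 : 2 <= (n%:R : R) by near: n; exact: natr_near.
  have n1 : 1 <= (n%:R : R) by apply: le_trans n2; lra.
  have n0 : 0 < (n%:R : R) by exact: lt_le_trans n1.
  have l1 : 1 <= ln (n%:R : R) by near: n; exact: ln_near.
  have l0 : 0 <= ln (n%:R : R) by exact: le_trans l1.
  have bV : 0 < (bw n)^-1 by rewrite bwV powR_gt0.
  rewrite /psi ltNge bs/= be eqxx powR2 ?divr_ge0 ?(ltW n0)// mulfV// powRr1 ?divr_ge0 ?(ltW n0)//.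
  rewrite mulrA mulrC ler_wpM2r ?invr_ge0 ?(ltW n0)//.
  (* Here [1 / b <= n], the exponent of [bstar] being at least -1, and [1 + n <= n ^ 2] for
     [n >= 2]; so the logarithm of [1 + 1 / b] is at most [2 ln n]. *)
  have hv : vmass beta (bw n)^-1 <= 4 * ln n%:R.
    rewrite {1}be; apply: le_trans (vmass_half bV) _.
    have -> : 4 * ln n%:R = 2 * ln (n%:R ^+ 2) :> R by rewrite lnXn// mulr2n; ring.
    rewrite ler_wpM2l// ler_ln ?posrE ?exprn_gt0 ?addr_gt0//.
    have : (bw n)^-1 <= n%:R.
      by rewrite bwV -[leRHS]powRr1 ?(ltW n0)// ler_powR// invf_le1.
    by move: n2; move: (_^-1) (n%:R : R) => x y; nra.
  rewrite -be; apply: (@le_trans _ _ (A + G * (4 * ln n%:R))).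
    by rewrite /prim_var lerD2l ler_wpM2l.
  rewrite [leRHS](_ : _ = A * ln n%:R + G * (4 * ln n%:R)); last by ring.
  by rewrite lerD2r ler_peMr.
have bl : half < beta by rewrite lt_neqAle eq_sym bn.
have c1 : 0 < 2 * beta - 1 by move: bl; lra.
pose e := (alpha + 1) / (2 * alpha + 2 * beta + 1).
have kb : kap = 2 * alpha + 2 * beta + 1 by rewrite max_large.
pose c := 2 / (2 * beta - 1) * 2 `^ (2 * beta - 1).
have c0 : 0 <= c by rewrite mulr_ge0 ?powR_ge0// divr_ge0// ltW.
exists (A + G * c); first by rewrite addr_ge0// mulr_ge0.
near=> n; have n1 : 1 <= (n%:R : R) by near: n; exact: natr_near.
have n0 : 0 < (n%:R : R) by exact: lt_le_trans n1.
have bV : 0 < (bw n)^-1 by rewrite bwV powR_gt0.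
rewrite /psi ltNge bs/= (negbTE bn) -/e powR2 ?(ltW n0)//.
(* The bounded part contributes [1 / n], which is below [psi ^ 2] because [beta > 1 / 2] makes
   [2 * e <= 1]. *)
have h1 : n%:R^-1 <= n%:R `^ (2 * - e) :> R.
  rewrite -powR_inv1 ?(ltW n0)// ler_powR//.
  rewrite mulrN lerN2 /e mulrA ler_pdivrMr -?kb// mul1r kb; move: bl; lra.
have h2 : vmass beta (bw n)^-1 <= c * n%:R `^ ((2 * beta - 1) / kap).
  apply: le_trans (vmass_large bl bV) _; rewrite /c -[leRHS]mulrA.
  apply: ler_wpM2l; first by rewrite divr_ge0// ltW.
  have -> : (2 * beta - 1) / kap = kap^-1 * (2 * beta - 1) by rewrite mulrC.
  rewrite powRrM -bwV -powRM ?(ltW bV)// ge0_ler_powR ?nnegrE ?(ltW c1) ?addr_ge0 ?mulr_ge0 ?(ltW bV)//.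
  have : 1 <= (bw n)^-1.
    by rewrite bwV -[leLHS](powRr0 n%:R) ler_powR// invr_ge0 ltW.
  by move: (_^-1) => x; lra.
rewrite /prim_var -/A -/G mulrDr mulrDl; apply: lerD.
  by rewrite mulrC ler_wpM2l.
apply: (@le_trans _ _ (n%:R^-1 * (G * (c * n%:R `^ ((2 * beta - 1) / kap))))).
  by rewrite ler_wpM2l ?invr_ge0 ?(ltW n0)// ler_wpM2l.
rewrite (_ : n%:R `^ (2 * - e) = n%:R^-1 * n%:R `^ ((2 * beta - 1) / kap)); last first.
  rewrite -powR_inv1 ?(ltW n0)// -powRD; last by apply/implyP => _; rewrite gt_eqF.
  congr (_ `^ _); rewrite kb /e; field; rewrite gt_eqF//; move: a0 b0; lra.
by rewrite le_eqVlt; apply/orP; left; apply/eqP; ring.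
Unshelve. all: by end_near. Qed.

(** The order [n^-1 * b ^ (- 2 beta - 1)] is bounded because [2 beta + 1] is at most [kap], the
    inverse of the exponent of [n] in [1 / b]. *)
Lemma kern_var_rate : exists2 C, 0 < C &
  \forall n \near \oo, n%:R^-1 * kern_var beta L K (bw n) <= C.
Proof.
pose H := 4 * symbol_bound L K ^+ 2 * 2 `^ (2 * beta).
have H0 : 0 <= H by rewrite mulr_ge0 ?powR_ge0// mulr_ge0 ?sqr_ge0.
exists (L * H + 1); first by rewrite ltr_wpDl// mulr_ge0// ltW.
near=> n; have n1 : 1 <= (n%:R : R) by near: n; exact: natr_near.
have n0 : 0 < (n%:R : R) by exact: lt_le_trans n1.
have bV : 0 < (bw n)^-1 by rewrite bwV powR_gt0.
have b2 : 0 <= 2 * beta by rewrite mulr_ge0// ltW.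
apply: (@le_trans _ _ (L * H)); last by rewrite lerDl.
rewrite /kern_var mulrCA ler_wpM2l ?(ltW L0)//.
have h : (1 + (bw n)^-1) `^ (2 * beta) <= 2 `^ (2 * beta) * n%:R `^ (kap^-1 * (2 * beta)).
  have B1 : 1 <= (bw n)^-1.
    by rewrite bwV -[leLHS](powRr0 n%:R) ler_powR// invr_ge0 ltW.
  rewrite (powRrM n%:R) -bwV -powRM ?(ltW bV)//.
  move: (bw n)^-1 bV B1 => x x0 x1.
  apply: ge0_ler_powR => //; rewrite ?nnegrE; move: x1; lra.
apply: (@le_trans _ _ (H * (n%:R^-1 * (n%:R `^ (kap^-1 * (2 * beta)) * (bw n)^-1)))).
  have ni : 0 <= n%:R^-1 :> R by rewrite invr_ge0.
  rewrite /H; have := sqr_ge0 (symbol_bound L K); move: (symbol_bound L K ^+ 2) => S S0.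
  have := ler_wpM2l (mulr_ge0 (mulr_ge0 (ler0n R 4) S0) (mulr_ge0 ni (ltW bV))) h.
  by congr (_ <= _); ring.
rewrite -[leRHS]mulr1 ler_wpM2l// bwV -powRD; last by apply/implyP => _; rewrite gt_eqF.
rewrite mulrC ler_pdivrMr// mul1r -[leRHS]powRr1 ?(ltW n0)// ler_powR//.
have -> : kap^-1 * (2 * beta) + kap^-1 = (2 * beta + 1) / kap by move: (kap^-1) => x; ring.
rewrite ler_pdivrMr// mul1r.
have : beta <= Num.max beta half by rewrite le_max lexx.
by move: a0; move: (Num.max _ _) => m; lra.
Unshelve. all: by end_near. Qed.

End rates.

(** * Tail bounds and the theorem *)

Section fixed_sample.
Context (R : realType) d (T : measurableType d) (P : probability T R).
Local Notation mu := (@lebesgue_measure R).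
Local Notation int1 g := (mu.-integrable setT (EFin \o g)).
Variables (tau alpha beta L r zeta gamma : R) (feps K : R -> R).
Hypotheses (a0 : 0 < alpha) (b0 : 0 < beta) (L0 : 0 < L) (r0 : 0 < r) (z0 : 0 < zeta)
  (hf : error_class beta L gamma feps) (iK : int1 K)
  (suppK : closure [set u | fourier K u != 0] `<=` `[-1, 1])
  (hK : kernel_of_order (strict_floor alpha).+1 K).
Variables (b : R) (bp : 0 < b) (b1 : b <= 1).
Variables (n : nat) (X eps : 'I_n -> {mfun T >-> R}) (f : R -> R) (U q : R).
Hypotheses (n0 : (0 < n)%N) (hm : @deconvolution_model R d T P n X eps f feps)
  (hc : density_class tau alpha L r zeta U f) (hq : is_quantile tau f q).
Local Notation m := (strict_floor alpha).
Local Notation I q := `[q - zeta, q + zeta]%classic.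
Local Notation dev := (deviation feps K b X eps f).
Local Notation Y := (fun w (j : 'I_n) => X j w + eps j w).

Let df : is_density f. Proof. by case: hc. Qed.
Let fL : ('N[mu]_+oo [EFin \o f] <= L%:E)%E. Proof. by case: hc. Qed.
Let iuK : int1 (fun u => `|u| * `|K u|). Proof. exact: integrable_abs_first_moment iK hK. Qed.

Definition bias_cst : R := cdf_taylor_cst alpha L zeta * moment_mass m.+1 K.
Definition drift_cst : R := L * moment_mass m.+1 K.

Let F01 t : 0 <= ray f t <= 1. Proof. exact: cdf_ge0_le1. Qed.
Let Flip : forall s t, `|ray f s - ray f t| <= L * `|s - t|. Proof. exact: cdf_lipschitz. Qed.
Let mF : measurable_fun setT (ray f).
Proof. by apply: continuous_measurable_fun; exact: lipschitz_continuous Flip. Qed.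

Let bias eta := smoothed K (ray f) b eta - ray f eta.

Lemma bias_near eta : `|eta - q| <= zeta / 2 -> `|bias eta| <= bias_cst * b `^ (alpha + 1).
Proof.
move=> eq; have [_ hfq _] := density_class_quantile a0 L0 r0 z0 hc hq.
have [c c0 hT] := cdf_taylor a0 L0 z0 df hfq eq.
apply: (smoothing_bias iK hK mF F01 bp _ (cdf_taylor_cst_ge0 alpha L0 z0) c0 hT).
have /andP[_ h] := strict_floorP a0.
by rewrite addr_ge0 ?(ltW a0)//= -[m.+2]addn1 natrD lerD2r.
Qed.

Lemma bias_far eta : `|bias eta| <= drift_cst * b.
Proof. exact: (smoothing_lipschitz iK hK mF F01 bp eta (ltW L0) Flip). Qed.

Lemma estimate_split eta w : ray (fhat feps K b (Y w)) eta = dev eta w + (bias eta + ray f eta).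
Proof.
rewrite (ray_fhat b0 L0 hf iK iuK suppK bp) /bias subrK.
rewrite -(law_mean_dprim b0 L0 hf iK iuK suppK bp eta df).
by rewrite /deviation /centered subrK.
Qed.

Lemma integrated_error w :
  `|\int[mu]_(x in `]-oo, q]) (fhat feps K b (Y w) x - f x)| = `|dev q w + bias q|.
Proof.
have [fi _] := density_integrable df.
have ih := integrable_fhat b0 L0 hf iK iuK suppK bp (Y w).
rewrite RintegralB//; [|exact: integrable_on..].
by rewrite -/(ray (fhat feps K b (Y w)) q) estimate_split -/(ray f q) addrA addrK.
Qed.

(** Minimality is applied at [q], which lies in [[- U, U]] and satisfies [ray f q = tau]: the
    criterion at [qhat] is at most [|dev q + bias q|]. The second copy of [|dev q|] comes from
    recentring [dev qhat] at [q], the form that the slope bound controls. *)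
Lemma quantile_error w qhat : is_quantile_estimate feps K tau U b (Y w) qhat ->
  `|ray f qhat - ray f q| <=
    2 * `|dev q w| + `|dev qhat w - dev q w| + (`|bias q| + `|bias qhat|).
Proof.
case=> _ h; have [qU _ _] := density_class_quantile a0 L0 r0 z0 hc hq.
have := h q qU; rewrite -/(ray (fhat feps K b (Y w)) q) -/(ray (fhat feps K b (Y w)) qhat).
rewrite !estimate_split; have <- : ray f q = tau by exact: hq.
have -> : dev q w + (bias q + ray f q) - ray f q = dev q w + bias q by ring.
move: (dev q w) (dev qhat w) (bias q) (bias qhat) (ray f q) (ray f qhat) => x y u v s t hst.
have -> : t - s = (y + (v + t) - s) - ((y - x) + x + v) by ring.
apply: le_trans (ler_normB _ _) _; have := ler_normD x u.
have := ler_normD (y - x + x) v; have := ler_normD (y - x) x.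
by move: hst; lra.
Qed.

Variables (psi C4 C5 S : R).
Hypotheses (psi0 : 0 < psi) (S0 : 0 < S) (hb : b `^ (alpha + 1) <= psi)
  (hC4 : n%:R^-1 * prim_var beta L K b <= C4 * psi ^+ 2)
  (hC5 : n%:R^-1 * kern_var beta L K b <= C5).

Let bias_cst0 : 0 <= bias_cst.
Proof. by rewrite mulr_ge0 ?moment_mass_ge0// cdf_taylor_cst_ge0. Qed.

Lemma deviation_tail :
  (P [set w | (S * psi < `|dev q w|)%R] <= (C4 / S ^+ 2)%:E)%E /\
  measurable [set w | S * psi < `|dev q w|].
Proof.
have mD := measurable_deviation b0 L0 hf iK iuK suppK bp hm df n0 q.
have iD := deviation_integrable b0 L0 hf iK iuK suppK bp hm df n0 q.
have Sp : 0 < S * psi by rewrite mulr_gt0.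
have [] := @markov_Rintegral R d T P (fun w => dev q w ^+ 2) ((S * psi) ^+ 2) (C4 * psi ^+ 2) iD.
- by move=> w; exact: sqr_ge0.
- exact: exprn_gt0.
- by apply: le_trans hC4; exact: (deviation_variance b0 L0 hf iK iuK suppK bp b1 hm df fL n0).
- have -> : [set w | (S * psi) ^+ 2 < dev q w ^+ 2] = [set w | S * psi < `|dev q w|].
    apply/seteqP; split => w /=; rewrite -(real_normK (num_real (dev q w))) ltr_pXn2r// ?nnegrE//; exact: ltW.
  have -> : C4 * psi ^+ 2 / (S * psi) ^+ 2 = C4 / S ^+ 2 by field; rewrite !gt_eqF.
  by [].
Qed.

Lemma integrated_error_tail :
  (P [set w | ((S + bias_cst) * psi <
     `|\int[mu]_(x in `]-oo, q]) (fhat feps K b (Y w) x - f x)|)%R] <= (C4 / S ^+ 2)%:E)%E.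
Proof.
have [h mE] := deviation_tail; apply: le_trans h.
have mD := measurable_deviation b0 L0 hf iK iuK suppK bp hm df n0 q.
apply: le_measure; rewrite ?inE//.
  rewrite (_ : [set w | _] = (fun w => `|dev q w + bias q|) @^-1` `](S + bias_cst) * psi, +oo[).
    rewrite -[X in measurable X]setTI.
    have mN : measurable_fun setT (fun w => `|dev q w + bias q|).
      by apply: measurableT_comp => //; exact: measurable_funD.
    exact: mN.
  by apply/seteqP; split => w /=; rewrite integrated_error in_itv/= andbT.
move=> w /=; rewrite integrated_error mulrDl => h1.
have h2 := bias_near (_ : `|q - q| <= zeta / 2).
rewrite subrr normr0 in h2; have {}h2 := h2 (ltW (divr_gt0 z0 (@ltr0Sn R 1))).
have h3 := ler_wpM2l bias_cst0 hb; have h4 := ler_normD (dev q w) (bias q).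
by move: h1 h2 h3 h4; lra.
Qed.

Variables (t0 delta : R) (qhat : {mfun T >-> R}).
Hypotheses (t01 : 1 <= t0) (t0d : t0 * psi < delta) (dz : delta <= zeta / 2) (dU : delta < 2 * U)
  (psi1 : psi <= 1) (C40 : 0 <= C4)
  (hd : forall x, `|x - q| <= delta -> r / 2 <= f x)
  (small : 2 * S * psi + 2 * drift_cst * b < r * delta / 4)
  (hqhat : forall w, is_quantile_estimate feps K tau U b (Y w) (qhat w)).

(** Three exceptional events are excluded: [|dev q| > S * psi], a slope above [r / 4] at distances
    between [t0 * psi] and [delta], and a slope above [r * delta / (16 * U)] at distances between
    [delta] and [2 * U]. Off them, [quantile_error] contradicts the growth of [ray f]. *)
Lemma quantile_tail :
  (P [set w | ((t0 + 8 / r * (S + bias_cst)) * psi < `|qhat w - q|)%R] <=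
   (C4 / S ^+ 2 + 32 / r ^+ 2 * ((C4 + C4 + C5) / t0) +
    512 / (r * delta) ^+ 2 * (C4 / delta ^+ 2 + (C4 + C5) / delta) * (psi * U ^+ 2))%:E)%E.
Proof.
have p0 : 0 < t0 by exact: lt_le_trans t01.
have d0 : 0 < delta by apply: lt_trans t0d; rewrite mulr_gt0.
have U0 : 0 < U by move: dU d0; lra.
have pV : 0 < psi^-1 by rewrite invr_gt0.
have [PD mD] := deviation_tail.
have rd : 0 < r * delta by rewrite mulr_gt0.
have e20 : 0 < r * delta / (16 * U) by rewrite divr_gt0// mulr_gt0.
have r40 : 0 < r / 4 by rewrite divr_gt0.
have slope := deviation_slope b0 L0 hf iK iuK suppK bp b1 hm df fL n0 q.
(* Slope [r / 4] is half of the growth rate [r / 2] of [ray f] near [q]; its inverse square, doubled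
   for the two sides, is [32 / r ^+ 2]. *)
have [E1 [mE1 PE1 h1]] := slope (t0 * psi) delta psi^-1 (r / 4) (mulr_gt0 p0 psi0) t0d pV r40.
(* Over a distance of at most [2 * U] this slope accumulates to [r * delta / 8], below the gap
   [r * delta / 2]; it produces the factor [512 * U ^+ 2 / (r * delta) ^+ 2]. *)
have [E2 [mE2 PE2 h2]] := slope delta (2 * U) psi^-1 (r * delta / (16 * U)) d0 dU pV e20.
have PE1' : (P E1 <= (32 / r ^+ 2 * ((C4 + C4 + C5) / t0))%:E)%E.
  apply: le_trans PE1 _; rewrite lee_fin.
  have -> : 32 / r ^+ 2 * ((C4 + C4 + C5) / t0) = 2 * ((C4 * t0 / t0 ^+ 2 + (C4 + C5) / t0) / (r / 4) ^+ 2).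
    by field; rewrite !gt_eqF.
  rewrite ler_wpM2l// ler_wpM2r ?invr_ge0 ?sqr_ge0// lerD//.
    apply: (@le_trans _ _ (C4 * psi ^+ 2 / (t0 * psi) ^+ 2)).
      by rewrite ler_wpM2r ?invr_ge0 ?sqr_ge0.
    have -> : C4 * psi ^+ 2 / (t0 * psi) ^+ 2 = C4 / t0 ^+ 2 by field; rewrite !gt_eqF.
    by rewrite ler_wpM2r ?invr_ge0 ?sqr_ge0// ler_peMr.
  have -> : (C4 + C5) / t0 = (psi^-1 * (C4 * psi ^+ 2) + C5 / psi^-1) / (t0 * psi) by field; rewrite !gt_eqF.
  rewrite ler_wpM2r ?invr_ge0 ?mulr_ge0 ?(ltW p0) ?(ltW psi0)// lerD//.
    by rewrite ler_wpM2l// ltW.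
  by rewrite ler_wpM2r// invr_ge0 ltW.
have PE2' : (P E2 <= (512 / (r * delta) ^+ 2 * (C4 / delta ^+ 2 + (C4 + C5) / delta) * (psi * U ^+ 2))%:E)%E.
  apply: le_trans PE2 _; rewrite lee_fin.
  have -> : 512 / (r * delta) ^+ 2 * (C4 / delta ^+ 2 + (C4 + C5) / delta) * (psi * U ^+ 2) =
    2 * ((C4 * psi / delta ^+ 2 + (C4 * psi + C5 * psi) / delta) / (r * delta / (16 * U)) ^+ 2).
    by field; rewrite !gt_eqF.
  rewrite ler_wpM2l// ler_wpM2r ?invr_ge0 ?sqr_ge0// lerD//.
    rewrite ler_wpM2r ?invr_ge0 ?sqr_ge0//; apply: le_trans hC4 _.
    by rewrite ler_wpM2l// expr2 ler_piMl// ltW.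
  rewrite ler_wpM2r ?invr_ge0 ?(ltW d0)// lerD//.
    have -> : C4 * psi = psi^-1 * (C4 * psi ^+ 2) by field; rewrite gt_eqF.
    by rewrite ler_wpM2l// ltW.
  by rewrite invrK ler_wpM2r// ltW.
have mq : measurable [set w | (t0 + 8 / r * (S + bias_cst)) * psi < `|qhat w - q|].
  rewrite (_ : [set w | _] = (fun w => `|qhat w - q|) @^-1` `](t0 + 8 / r * (S + bias_cst)) * psi, +oo[).
    rewrite -[X in measurable X]setTI.
    have mN : measurable_fun setT (fun w => `|qhat w - q|).
      by apply: measurableT_comp => //; apply: measurable_funB => //; exact: measurable_funPT.
    exact: mN.
  by apply/seteqP; split => w /=; rewrite in_itv/= andbT.
rewrite !EFinD; apply: le_trans (leeD (leeD PD PE1') PE2').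
apply: (@le_trans _ _ (P ([set w | S * psi < `|dev q w|] `|` E1 `|` E2))); last first.
  apply: le_trans (measureU2 _ _ _) _ => //; first exact: measurableU.
  by apply: leeD => //; exact: measureU2.
apply: le_measure; rewrite ?inE//; first by apply: measurableU => //; exact: measurableU.
move=> w /= far; apply: contrapT => /not_orP[/not_orP[/negP]]; rewrite -leNgt => nS /(h1 w) {}h1 /(h2 w) {}h2.
have hw := quantile_error (hqhat w).
have gap := cdf_gap df (qhat w) (ltW (divr_gt0 r0 (@ltr0Sn R 1))) (ltW d0) hd.
have C0 : 0 <= S + bias_cst by rewrite addr_ge0// ltW.
have far1 : t0 * psi <= `|qhat w - q|.
  have k0 : 0 <= 8 / r * (S + bias_cst) by rewrite mulr_ge0// divr_ge0// ltW.
  by apply: le_trans (ltW far); rewrite ler_wpM2r ?(ltW psi0)// lerDl.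
have bq : `|bias q| <= bias_cst * psi.
  apply: le_trans (bias_near _) _; last by rewrite ler_wpM2l.
  by rewrite subrr normr0 ltW// divr_gt0.
have [hle|hgt] := leP `|qhat w - q| delta.
- have s1 := h1 (qhat w); rewrite far1 hle in s1; have {}s1 := s1 isT.
  have bqh : `|bias (qhat w)| <= bias_cst * psi.
    by apply: le_trans (bias_near (le_trans hle dz)) _; rewrite ler_wpM2l.
  rewrite (min_idPl hle) in gap.
  (* Near [q] half of the growth [r / 2] is spent on the slope bound; the remaining [r / 4] confines
     [|qhat - q|] to [8 / r * (S + bias_cst) * psi]. *)
  have key : r / 4 * `|qhat w - q| <= 2 * (S + bias_cst) * psi.
    by move: gap hw s1 bq bqh nS; rewrite !mulrDl; lra.
  move: far; rewrite ltNge => /negP; apply.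
  rewrite mulrDl -[leLHS]add0r; apply: lerD; first by rewrite mulr_ge0// ltW.
  have -> : 8 / r * (S + bias_cst) * psi = (r / 4)^-1 * (2 * (S + bias_cst) * psi) by field; rewrite gt_eqF.
  by rewrite ler_pdivlMl.
- have qU : `|qhat w - q| <= 2 * U.
    have [qU _ _] := density_class_quantile a0 L0 r0 z0 hc hq.
    have [qhU _] := hqhat w.
    move: qU qhU; rewrite !in_itv/= -!ler_norml => u1 u2.
    by apply: le_trans (ler_normB _ _) _; move: u1 u2; lra.
  have s2 := h2 (qhat w); rewrite (ltW hgt) qU in s2; have {}s2 := s2 isT.
  have s3 : r * delta / (16 * U) * `|qhat w - q| <= r * delta / 8.
    have -> : r * delta / 8 = r * delta / (16 * U) * (2 * U) by field; rewrite gt_eqF.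
    by rewrite ler_wpM2l// ltW.
  rewrite (min_idPr (ltW hgt)) in gap.
  have := bias_far q; have := bias_far (qhat w).
  (* The gap [r * delta / 2] exceeds the sum of [r * delta / 8] from the slope and of the quantity
     below [r * delta / 4] granted by [small]. *)
  move: gap hw s2 s3 nS small; rewrite mulrAC -[2 * drift_cst * b]mulrA -[2 * S * psi]mulrA.
  by move: (r * delta) rd => rr rr0; lra.
Qed.

End fixed_sample.

Theorem corollary2p9 (R : realType) (tau alpha beta L r zeta gamma : R)
  (feps K : R -> R) (U : nat -> R)
  (d : nat -> measure_display) (Omega : forall n, measurableType (d n))
  (P : forall n, (R -> R) -> probability (Omega n) R)
  (X eps : forall n, 'I_n -> {mfun Omega n >-> R})
  (htau : 0 < tau < 1)
  (halpha : 0 < alpha) (hbeta : 0 < beta) (hL : 0 < L) (hr : 0 < r)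
  (hzeta : 0 < zeta) (hgamma : 0 <= gamma)
  (hfeps : error_class beta L gamma feps)
  (hK : (@lebesgue_measure R).-integrable setT (EFin \o K))
  (hsuppK : closure [set u | fourier K u != 0] `<=` `[-1, 1])
  (hordK : kernel_of_order (strict_floor alpha).+1 K)
  (hUoo : U n @[n --> \oo] --> +oo)
  (hUlog : U =O_\oo (fun n => ln n%:R))
  (hmodel : forall n f, density_class tau alpha L r zeta (U n) f ->
    @deconvolution_model R (d n) (Omega n) (P n f) n (X n) (eps n) f feps) :
  let Y n w : 'I_n -> R := fun j => X n j w + eps n j w in
  let b := bstar alpha beta in
  let Theta n : set ((R -> R) * R) :=
    [set fq | density_class tau alpha L r zeta (U n) fq.1
              /\ is_quantile tau fq.1 fq.2] in
  unif_bigOP (fun n fq => P n fq.1) Theta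
    (fun n fq w => `|\int[@lebesgue_measure R]_(x in `]-oo, fq.2])
                      (fhat feps K (b n) (Y n w) x - fq.1 x)|)
    (psi alpha beta)
  /\
  (forall qhat : forall n, {mfun Omega n >-> R},
    (\forall n \near \oo, forall w,
       is_quantile_estimate feps K tau (U n) (b n) (Y n w) (qhat n w)) ->
    unif_bigOP (fun n fq => P n fq.1) Theta
      (fun n fq w => `|qhat n w - fq.2|) (psi alpha beta)).
Proof.
move=> Y b Theta.
have iuK := integrable_abs_first_moment hK hordK.
have [delta /andP[d0 dz] hd] := holder_radius halpha hL hr hzeta.
have [C4 C40 hC4] := prim_var_rate halpha hbeta K hL.
have [C5 C50 hC5] := kern_var_rate halpha hbeta K hL.
have bc0 : 0 <= bias_cst alpha L zeta K.
  by rewrite mulr_ge0 ?moment_mass_ge0// cdf_taylor_cst_ge0.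
have dc0 : 0 <= drift_cst alpha L K by rewrite mulr_ge0 ?moment_mass_ge0// ltW.
(* The level [1 + 8 * C4 / c] is at least 1, so its square is at least itself, and Chebyshev's bound
   drops to [c / 8]. *)
have tail c : 0 < c -> C4 / (1 + 8 * C4 / c) ^+ 2 <= c / 8.
  move=> c0; have s1 : 1 <= 1 + 8 * C4 / c by rewrite lerDl divr_ge0 ?mulr_ge0// ltW.
  rewrite ler_pdivrMr ?exprn_gt0 ?(lt_le_trans ltr01)//.
  apply: (@le_trans _ _ (c / 8 * (1 + 8 * C4 / c))).
    rewrite mulrDr mulr1 (_ : c / 8 * (8 * C4 / c) = C4); last by field; rewrite gt_eqF.
    by rewrite lerDr divr_ge0// ltW.
  rewrite ler_wpM2l ?divr_ge0 ?(ltW c0)// expr2 ler_peMr//.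
  exact: le_trans s1.
have common : \forall n \near \oo, [/\ (0 < n)%N, 0 < b n <= 1, 0 < psi alpha beta n,
    b n `^ (alpha + 1) <= psi alpha beta n &
    n%:R^-1 * prim_var beta L K (b n) <= C4 * psi alpha beta n ^+ 2 /\
    n%:R^-1 * kern_var beta L K (b n) <= C5].
  near=> n; split.
  - by near: n; exact: nbhs_infty_gt.
  - by near: n; exact: bstar_gt0_le1.
  - by near: n; exact: psi_gt0.
  - by near: n; exact: bstar_bias.
  - by split; near: n.
split.
- move=> c c0; pose S := 1 + 8 * C4 / c.
  have S1 : 1 <= S by rewrite lerDl divr_ge0 ?mulr_ge0// ltW.
  have S0 : 0 < S by exact: lt_le_trans S1.
  have S_tail : C4 / S ^+ 2 <= c / 8 by exact: tail.
  clearbody S.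
  exists (S + bias_cst alpha L zeta K); first by rewrite ltr_wpDr.
  near=> n.
  have [n0 /andP[bp b1] psi0 hb [h4 h5]] : [/\ (0 < n)%N, 0 < b n <= 1, 0 < psi alpha beta n,
    b n `^ (alpha + 1) <= psi alpha beta n &
    n%:R^-1 * prim_var beta L K (b n) <= C4 * psi alpha beta n ^+ 2 /\
    n%:R^-1 * kern_var beta L K (b n) <= C5] by near: n; exact: common.
  apply: (@le_lt_trans _ _ (c / 8)%:E); last by rewrite lte_fin ltr_pdivrMr// ltr_pMr// ltr1n.
  apply: ge_ereal_sup => _ [[f q] [/= hc hq] <-].
  apply: le_trans (_ : ((C4 / S ^+ 2)%:E <= _)%E); last by rewrite lee_fin.
  exact: (integrated_error_tail halpha hbeta hL hr hzeta hfeps hK hsuppK hordK bp b1 n0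
    (hmodel n f hc) hc hq psi0 S0 hb h4).
- move=> qhat hqhat c c0; pose S := 1 + 8 * C4 / c.
  have S1 : 1 <= S by rewrite lerDl divr_ge0 ?mulr_ge0// ltW.
  have S0 : 0 < S by exact: lt_le_trans S1.
  have S_tail : C4 / S ^+ 2 <= c / 8 by exact: tail.
  clearbody S.
  (* [256 = 8 * 32]: the near slope event gets probability at most [c / 8]. *)
  pose t0 := 1 + 256 / r ^+ 2 * (C4 + C4 + C5) / c.
  have CC : 0 < C4 + C4 + C5 by rewrite !addr_gt0.
  have r2 : 0 < r ^+ 2 by exact: exprn_gt0.
  have t01 : 1 <= t0.
    rewrite lerDl; apply: divr_ge0; last exact: ltW.
    by apply: mulr_ge0; [apply: divr_ge0; [exact: ler0n|exact: ltW]|exact: ltW].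
  have tp : 0 < t0 by exact: lt_le_trans t01.
  have near_tail : 32 / r ^+ 2 * ((C4 + C4 + C5) / t0) <= c / 8.
    rewrite mulrA ler_pdivrMr//.
    have -> : 32 / r ^+ 2 * (C4 + C4 + C5) = c / 8 * (256 / r ^+ 2 * (C4 + C4 + C5) / c).
      by field; rewrite !gt_eqF.
    by rewrite ler_wpM2l ?divr_ge0 ?(ltW c0)// lerDr.
  clearbody t0.
  exists (t0 + 8 / r * (S + bias_cst alpha L zeta K)).
    rewrite ltr_wpDr// mulr_ge0 ?addr_ge0 ?(ltW S0)// divr_ge0// ltW//.
  have [k k0 hk] : exists2 k : R, 0 < k & \forall n \near \oo, `|U n| <= k * `|ln (n%:R : R)|.
    by have /eqO_exP[k k0 hk] := hUlog; exists k.
  pose A := 512 / (r * delta) ^+ 2 * (C4 / delta ^+ 2 + (C4 + C5) / delta).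
  have rd : 0 < r * delta by rewrite mulr_gt0.
  have A0 : 0 <= A.
    apply: mulr_ge0; first by apply: divr_ge0; [exact: ler0n|exact: sqr_ge0].
    apply: addr_ge0; apply: divr_ge0; rewrite ?sqr_ge0 ?addr_ge0 ?ltW//.
  (* Smallness demanded of [psi], in order: [psi <= 1], [t0 * psi < delta],
     [2 * S * psi <= r * delta / 16], and a far slope event of probability at most [c / 8], through
     [U n ^+ 2 <= k ^+ 2 * ln n ^+ 2]. *)
  pose e1 := Num.min 1 (Num.min (delta / (2 * t0)) (Num.min (r * delta / (32 * S)) (c / 8 / (A * k ^+ 2 + 1)))).
  have Ak : 0 < A * k ^+ 2 + 1 by rewrite ltr_wpDl// mulr_ge0// sqr_ge0.
  have e10 : 0 < e1.
    rewrite !lt_min ltr01/=; apply/and3P; split.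
    - by rewrite divr_gt0// mulr_gt0.
    - by rewrite divr_gt0// mulr_gt0.
    - by rewrite divr_gt0// divr_gt0.
  have e20 : 0 < r * delta / (32 * (drift_cst alpha L K + 1)).
    by rewrite divr_gt0// mulr_gt0// ltr_wpDl.
  near=> n.
  have [n0 /andP[bp b1] psi0 hb [h4 h5]] : [/\ (0 < n)%N, 0 < b n <= 1, 0 < psi alpha beta n,
    b n `^ (alpha + 1) <= psi alpha beta n &
    n%:R^-1 * prim_var beta L K (b n) <= C4 * psi alpha beta n ^+ 2 /\
    n%:R^-1 * kern_var beta L K (b n) <= C5] by near: n; exact: common.
  have hs : psi alpha beta n * (1 + ln n%:R ^+ 2) <= e1.
    by near: n; exact: psi_ln_small.
  have hb2 : b n <= r * delta / (32 * (drift_cst alpha L K + 1)).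
    by near: n; exact: bstar_small.
  have hU : delta < U n by near: n; exact: cvgry_gt.
  have hUk : `|U n| <= k * `|ln (n%:R : R)| by near: n; exact: hk.
  have hq' : forall w, is_quantile_estimate feps K tau (U n) (b n) (Y n w) (qhat n w) by near: n.
  have U0 : 0 < U n by exact: lt_trans hU.
  have l2 : 0 <= ln (n%:R : R) ^+ 2 by exact: sqr_ge0.
  have pe : psi alpha beta n <= e1.
    by apply: le_trans hs; rewrite ler_peMr ?(ltW psi0)// lerDl.
  have U2 : psi alpha beta n * U n ^+ 2 <= k ^+ 2 * e1.
    apply: (@le_trans _ _ (k ^+ 2 * (psi alpha beta n * (1 + ln n%:R ^+ 2)))); last first.
      by rewrite ler_wpM2l ?sqr_ge0.
    rewrite [leRHS]mulrCA ler_wpM2l ?(ltW psi0)//.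
    apply: (@le_trans _ _ (k ^+ 2 * ln n%:R ^+ 2)); last by rewrite ler_wpM2l ?sqr_ge0// lerDr.
    rewrite -(real_normK (num_real (U n))) -(real_normK (num_real (ln n%:R))) -exprMn.
    by rewrite lerXn2r ?nnegrE// mulr_ge0// ltW.
  move: (pe); rewrite /e1 !le_min => /and4P[p1 p2 p3 _].
  have far_tail : A * (psi alpha beta n * U n ^+ 2) <= c / 8.
    apply: le_trans (ler_wpM2l A0 U2) _; rewrite mulrA.
    apply: (@le_trans _ _ (A * k ^+ 2 * (c / 8 / (A * k ^+ 2 + 1)))).
      by apply: ler_wpM2l; [rewrite mulr_ge0 ?sqr_ge0|rewrite /e1 !ge_min lexx !orbT].
    by rewrite mulrA ler_pdivrMr// mulrC ler_wpM2l ?lerDl// divr_ge0// ltW.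
  apply: (@le_lt_trans _ _ (c / 8 + c / 8 + c / 8)%:E); last first.
    by rewrite lte_fin; move: c0; clear; lra.
  apply: ge_ereal_sup => _ [[f q] [/= hc hq] <-].
  have [qU hfq rq] := density_class_quantile halpha hL hr hzeta hc hq.
  apply: (@le_trans _ _ (C4 / S ^+ 2 + 32 / r ^+ 2 * ((C4 + C4 + C5) / t0) +
    A * (psi alpha beta n * U n ^+ 2))%:E); last first.
    by rewrite lee_fin lerD// lerD.
  apply: (quantile_tail halpha hbeta hL hr hzeta hfeps hK hsuppK hordK bp b1 n0
    (hmodel n f hc) hc hq psi0 S0 hb h4 h5 t01 _ dz _ p1 (ltW C40) (hd q f hfq rq) _ hq').
  + rewrite -ltr_pdivlMl// mulrC; apply: le_lt_trans p2 _.
    rewrite ltr_pM2l// ltf_pV2 ?posrE ?mulr_gt0//.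
    by move: tp; clear; lra.
  + by move: hU d0; clear; lra.
  + have q1 : 2 * S * psi alpha beta n <= r * delta / 16.
      have -> : r * delta / 16 = 2 * S * (r * delta / (32 * S)) by field; rewrite gt_eqF.
      by rewrite ler_wpM2l// mulr_ge0// ltW.
    have q2 : 2 * drift_cst alpha L K * b n <= r * delta / 16.
      apply: (@le_trans _ _ (2 * (drift_cst alpha L K + 1) * (r * delta / (32 * (drift_cst alpha L K + 1))))).
        apply: ler_pM => //; [exact: mulr_ge0|exact: ltW|].
        by rewrite ler_wpM2l// lerDl.
      rewrite le_eqVlt; apply/orP; left; apply/eqP; field; rewrite gt_eqF// ltr_wpDl//.
    by move: q1 q2 rd; clear; lra.
Unshelve. all: by end_near.
Qed.
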